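(* Let $G$ be a Lie group with Lie algebra $\mathfrak{g}$, let $T_0<T_N$ be fixed, let $f_1,\dots,f_N: G\times\mathbb{R}^+\to\mathfrak{g}$ be mode functions, each of class $C^1$, and let $\mathcal{T}=[T_1\;T_2\;\cdots\;T_{N-1}]^T$ be transition times with $T_0\le T_1\le\cdots\le T_{N-1}\le T_N$. Consider the switched system on $G$ $$\dot g(t)=g(t)\,\xi(t),\qquad \xi(t)=f\big(g(t),\mathcal{T};t\big),\qquad t\in[T_0,T_N],$$ with fixed initial state $g(T_0)$ (independent of $\mathcal{T}$), where $$f\big(g,\mathcal{T};t\big)=\big[1(t-T_0)-1(t-T_1^-)\big]f_1(g;t)+\big[1(t-T_1^+)-1(t-T_2^-)\big]f_2(g;t)+\cdots+\big[1(t-T_{N-1}^+)-1(t-T_N^-)\big]f_N(g;t).$$ Let $$J(\mathcal{T})=\int_{T_0}^{T_N}L\big(g(\tau)\big)\,d\tau+\varphi\big(g(T_N)\big),$$ where $L,\varphi:G\to\mathbb{R}$ are of class $C^1$ and $g$ is the trajectory of the switched system determined by $\mathcal{T}$. Then the mode transition gradient of $J$ at $\mathcal{T}$ is $$\left.\frac{dJ}{d\mathcal{T}}\right|_{\mathcal{T}}=\left.\begin{bmatrix}\dfrac{dJ}{dT_1}&\dfrac{dJ}{dT_2}&\cdots&\dfrac{dJ}{dT_{N-1}}\end{bmatrix}^T\right|_{\mathcal{T}},$$ with $$\left.\frac{dJ}{dT_i}\right|_{\mathcal{T}}=\rho(T_i)^T\Big[f_i\big(g(T_i);T_i\big)-f_{i+1}\big(g(T_i);T_i\big)\Big],\qquad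 i=1,\dots,N-1,$$ where the costate $\rho$ is the solution on $[T_0,T_N]$ of $$\dot\rho(s)^T=-\rho(s)^T\Big[D_gf\big(g(s),\mathcal{T};s\big)-\mathrm{ad}_{f(g(s),\mathcal{T};s)}\Big]-D_gL\big(g(s)\big),\qquad \rho(T_N)^T=D_g\varphi\big(g(T_N)\big).$$
   Context: $G$ is a finite-dimensional real Lie group; $g\xi$, for $g\in G$ and $\xi\in\mathfrak{g}$, denotes the left translate of $\xi$ to $T_gG$ (matrix product for matrix Lie groups). $\mathrm{ad}_\xi\eta=[\xi,\eta]$ is the Lie bracket on $\mathfrak{g}$ (the bracket of left-invariant vector fields; the matrix commutator for matrix groups). For a differentiable map $F:G\to V$ into a finite-dimensional real vector space ($V=\mathbb{R}$ or $V=\mathfrak{g}$), $D_gF=D_gF|_g:\mathfrak{g}\to V$ is the linear map defined by $D_gF|_g\cdot\eta=\frac{d}{ds}F\big(g\exp(s\eta)\big)\big|_{s=0}$ for all $\eta\in\mathfrak{g}$. For $f(g,\mathcal{T};t)$ and $f_i(g;t)$, $D_g$ is taken in the $g$ argument only, with the other arguments fixed. A basis of $\mathfrak{g}$ is fixed, so that $\mathfrak{g}\cong\mathbb{R}^n$; $\rho(s)^T$ is a row vector (an element of $\mathfrak{g}^*$), and $D_gL$, $D_g\varphi$ are row vectors. $1(t):\mathbb{R}\to\{0,1\}$ is the unit step function, and the superscripts $\pm$ on the $T_i$ denote one-sided limits. Thus $f=f_i$ on the open interval $(T_{i-1},T_i)$, and values at the finitely many switching times are immaterial. The trajectory $g$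 is the continuous solution, satisfying the differential equation away from the switching times; it is assumed to exist on all of $[T_0,T_N]$. Likewise $\rho$ is the continuous solution of the costate equation, satisfied away from the switching times. The derivative $dJ/dT_i$ is taken with the other transition times held fixed, $f$ being given by the displayed step-function formula; where $T_i$ equals $T_0$ or $T_N$ it is understood as a one-sided derivative with $T_i$ varying in $[T_0,T_N]$. *)

(* Defs.v *)
From HB Require Import structures.
From mathcomp Require Import all_boot all_order all_algebra.
From mathcomp Require Import all_classical all_reals all_analysis.
Set Implicit Arguments.
Unset Strict Implicit.
Unset Printing Implicit Defensive.
Import Order.TTheory GRing.Theory Num.Theory.
Import numFieldNormedType.Exports.
Local Open Scope classical_set_scope.
Local Open Scope ring_scope.

HB.structure Definition GroupTopological := {G of Topological G & Group G}.

Section Smoothness.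
Context {R : realType}.

(* On an open subset U of a finite-dimensional space this is the usual class
   C^k: all iterated directional (equivalently, partial) derivatives of order
   at most k exist and are continuous on U. *)
Fixpoint Ck (k : nat) (V W : normedModType R) (U : set V) (f : V -> W)
    : Prop :=
  (forall x, U x -> {for x, continuous f}) /\
  (if k is k'.+1 then
     forall v : V, (forall x, U x -> derivable f x v) /\
                   Ck k' U (fun x => 'D_v f x)
   else True).

Definition smooth (V W : normedModType R) (U : set V) (f : V -> W) : Prop :=
  forall k, Ck k U f.

End Smoothness.

Section LieGroup.
Context {R : realType} {n : nat} {G : GroupTopological.type}.

(* [fwd] is meaningful on [dom] only, and [bwd] on [img] only. *)
Record chart := Chart {
  dom : set G ;
  fwd : G -> 'cV[R]_n ;
  bwd : 'cV[R]_n -> G }.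

Definition img (c : chart) : set 'cV[R]_n := fwd c @` dom c.

Definition is_chart (c : chart) : Prop :=
  [/\ open (dom c), open (img c),
      (forall p, dom c p -> bwd c (fwd c p) = p),
      (forall p, dom c p -> {for p, continuous (fwd c)}) &
      (forall x, img c x -> {for x, continuous (bwd c)})].

Definition compatible (c d : chart) : Prop :=
  smooth [set x | img c x /\ dom d (bwd c x)] (fun x => fwd d (bwd c x)) /\
  smooth [set x | img d x /\ dom c (bwd d x)] (fun x => fwd c (bwd d x)).

Record is_lie_group (A : set chart) : Prop := IsLieGroup {
  lie_hausdorff : hausdorff_space G ;
  lie_second_countable : second_countable (T := G) ;
  lie_is_chart : forall c, A c -> is_chart c ;
  lie_cover : forall p, exists2 c, A c & dom c p ;
  lie_compatible : forall c d, A c -> A d -> compatible c d ;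
  lie_maximal : forall c, is_chart c -> (forall d, A d -> compatible c d) ->
    A c ;
  lie_mul_continuous : continuous (fun pq : G * G => (pq.1 * pq.2)%g) ;
  lie_mul_smooth : forall a b c, A a -> A b -> A c ->
    smooth [set xy : 'cV[R]_n * 'cV[R]_n |
              [/\ img a xy.1, img b xy.2 &
                  dom c (bwd a xy.1 * bwd b xy.2)%g]]
           (fun xy => fwd c (bwd a xy.1 * bwd b xy.2)%g) ;
  lie_inv_continuous : continuous (fun p : G => (p^-1)%g) ;
  lie_inv_smooth : forall a c, A a -> A c ->
    smooth [set x | img a x /\ dom c ((bwd a x)^-1)%g]
           (fun x => fwd c ((bwd a x)^-1)%g) }.

(* The Lie algebra T_1 G is identified with R^n through a chart k around 1:
   xi stands for \sum_j xi_j (d/dx_j)|_1, where x = fwd k.  Composing k with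
   linear isomorphisms of R^n yields every basis of T_1 G, so an arbitrary k
   amounts to an arbitrary basis. *)

(* The left translate p xi, a tangent vector at p, in the coordinates of c. *)
Definition left_translate (k c : chart) (p : G) (xi : 'cV[R]_n) : 'cV[R]_n :=
  'D_xi (fun x => fwd c (p * bwd k x)%g) (fwd k 1%g).

(* gamma'(t) = gamma(t) xi in the tangent space at gamma(t). *)
Definition has_left_velocity (A : set chart) (k : chart) (gamma : R -> G)
    (t : R) (xi : 'cV[R]_n) : Prop :=
  {for t, continuous gamma} /\
  forall c, A c -> dom c (gamma t) ->
    is_derive t 1 (fun s => fwd c (gamma s)) (left_translate k c (gamma t) xi).

(* The left-invariant vector field p |-> p xi in the coordinates of k. *)
Definition left_field (k : chart) (xi x : 'cV[R]_n) : 'cV[R]_n :=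
  left_translate k k (bwd k x) xi.

Definition vf_bracket (X Y : 'cV[R]_n -> 'cV[R]_n) (x : 'cV[R]_n) :
    'cV[R]_n :=
  'D_(X x) Y x - 'D_(Y x) X x.

Definition ad (k : chart) (xi eta : 'cV[R]_n) : 'cV[R]_n :=
  vf_bracket (left_field k xi) (left_field k eta) (fwd k 1%g).

(* Characterises the exponential map: s |-> E (s eta) is the integral curve
   through 1 of the left-invariant vector field of eta. *)
Definition is_exponential (A : set chart) (k : chart) (E : 'cV[R]_n -> G) :
    Prop :=
  E 0 = 1%g /\
  forall eta s, has_left_velocity A k (fun u : R => E (u *: eta)) s eta.

Definition Dg (E : 'cV[R]_n -> G) (V : normedModType R) (F : G -> V) (g : G)
    (eta : 'cV[R]_n) : V :=
  'D_1 (fun s : R => F (g * E (s *: eta))%g) 0.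

Definition row_of (l : 'cV[R]_n -> R) : 'rV[R]_n :=
  \row_j l (delta_mx j 0).

Definition matrix_of (l : 'cV[R]_n -> 'cV[R]_n) : 'M[R]_n :=
  \matrix_(i, j) l (delta_mx j 0) i 0.

Definition C1 (A : set chart) (F : G -> R) : Prop :=
  forall c, A c -> Ck 1 (img c) (fun x => F (bwd c x)).

(* C^1 on G x [0, +oo[, in the sense that in every chart the map is the
   restriction of a C^1 map on an open set; h is irrelevant at negative
   times. *)
Definition C1_time (A : set chart) (h : G -> R -> 'cV[R]_n) : Prop :=
  forall c, A c -> exists2 H : 'cV[R]_n * R -> 'cV[R]_n,
    Ck 1 [set xt | img c xt.1] H &
    forall x t, img c x -> 0 <= t -> H (x, t) = h (bwd c x) t.

End LieGroup.
Arguments chart R n G : clear implicits.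

Section SwitchedSystem.
Context {R : realType} {n N : nat} {G : GroupTopological.type}.
Variables (A : set (chart R n G)) (k : chart R n G).
Variables (T0 Tf : R) (f : 'I_N.+1 -> G -> R -> 'cV[R]_n) (g0 : G).

(* There are N transition times T 0, ..., T (N-1), and N + 1 modes
   f 0, ..., f N.  [stime T] is the sequence T0, T 0, ..., T (N-1), Tf, so
   that mode i runs between [stime T i] and [stime T i.+1]. *)
Definition stime (T : 'cV[R]_N) (j : nat) : R :=
  if j is j'.+1 then
    if insub j' is Some i then T i 0 else Tf
  else T0.

Definition unit_step (t : R) : R := (0 <= t)%R%:R.

(* The one-sided limits in the arguments of the steps are dropped: they only
   affect the values at the switching times, which are never used.  T need
   not be ordered: the steps may then combine with negative signs. *)
Definition switched (T : 'cV[R]_N) (g : G) (t : R) : 'cV[R]_n :=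
  \sum_(i < N.+1)
    (unit_step (t - stime T i) - unit_step (t - stime T i.+1)) *: f i g t.

Definition nonswitching (T : 'cV[R]_N) (t : R) : Prop :=
  T0 < t < Tf /\ forall i, t != T i 0.

Definition is_trajectory (T : 'cV[R]_N) (g : R -> G) : Prop :=
  [/\ {within `[T0, Tf], continuous g}, g T0 = g0 &
      forall t, nonswitching T t ->
        has_left_velocity A k g t (switched T (g t) t)].

(* The trajectory determined by T (unique on [T0, Tf] when it exists, which
   it does for all T close to one for which it does; junk otherwise). *)
Definition trajectory (T : 'cV[R]_N) : R -> G :=
  xget (fun _ => g0) [set g | is_trajectory T g].

Variables (L phi : G -> R).

Definition cost (T : 'cV[R]_N) : R :=
  (\int[lebesgue_measure]_(tau in `[T0, Tf]) L (trajectory T tau))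
  + phi (trajectory T Tf).

(* rhoT is rho^T. *)
Definition is_costate (E : 'cV[R]_n -> G) (T : 'cV[R]_N) (g : R -> G)
    (rhoT : R -> 'rV[R]_n) : Prop :=
  [/\ {within `[T0, Tf], continuous rhoT},
      rhoT Tf = row_of (Dg E phi (g Tf)) &
      forall s, nonswitching T s ->
        is_derive s 1 rhoT
          (- (rhoT s *m (matrix_of (Dg E (fun h => switched T h s) (g s))
                         - matrix_of (ad k (switched T (g s) s))))
           - row_of (Dg E L (g s)))].

(* v is the vector of the derivatives of J with respect to each T_i, the other
   transition times being fixed and T_i ranging over [T0, Tf] (a two-sided
   derivative when T0 < T_i < Tf). *)
Definition is_mode_gradient (J : 'cV[R]_N -> R) (T v : 'cV[R]_N) : Prop :=
  forall i : 'I_N,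
    (J (\col_j (if j == i then s else T j 0)) - J T) / (s - T i 0)
      @[s --> within `[T0, Tf] (T i 0)^'] --> v i 0.

End SwitchedSystem.

(* Main.v *)
(* rho(t) is the gradient at g(t) of the cost-to-go, i.e. of the running cost on
   [t, Tf] plus the terminal cost as a function of the state at time t.  This
   holds at Tf by the terminal condition, and it propagates backwards over short
   intervals on which g stays in one chart and a single mode is active: there
   the pairing of rho with the displacement towards a nearby trajectory changes,
   up to a small error, at the rate of minus the difference of the running
   costs.  The term ad in the costate equation is the derivative of the frame of
   left-invariant fields along g, by symmetry of second derivatives.
   Moving T_i to s exchanges f_i and f_(i+1) between T_i and s; to first order
   this displaces the state at time T_i by (s - T_i) (f_i - f_(i+1)), and the
   cost changes by the value of rho(T_i) on this displacement. *)
From HB Require Import structures.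
Require Import Defs.
From mathcomp Require Import all_boot all_order all_algebra.
From mathcomp Require Import all_classical all_reals all_analysis.
From mathcomp Require Import ring lra.
Set Implicit Arguments.
Unset Strict Implicit.
Unset Printing Implicit Defensive.
Import Order.TTheory GRing.Theory Num.Theory.
Import numFieldNormedType.Exports.
Local Open Scope classical_set_scope.
Local Open Scope ring_scope.

(** Nearby trajectories are not assumed to exist: [cost] at a perturbed [T] is evaluated on a curve
    whose existence and uniqueness have to be proved. So existence from all nearby states is
    propagated backwards together with the gradient property. No flow map is built or
    differentiated: in a chart box nearby solutions separate by a factor of at most 2, hence the
    remainder of the linearised equation is small relative to the initial displacement, and a mean
    value inequality suffices. Transition times may coincide. The mode active just after [T i 0]
    then need not be [f_(i+1)], and moving [T i 0] past a neighbour makes the steps combine with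
    signs. Hence a mode is an arbitrary C1 field, and the perturbation adds plus or minus
    [f_i - f_(i+1)] to whatever mode is active next to [T i 0]; the resulting jump of the field does
    not depend on that mode. Both one-sided estimates refer to the gradient at [T i 0] alone, so the
    cases [T i 0 = T0] and [T i 0 = Tf] need no separate argument. *)

(* A reflexive decision procedure for identities between sums of vectors;
   the ring tactic does not apply to modules. *)
Inductive zexpr := ZVar of nat | ZAdd of zexpr & zexpr | ZOpp of zexpr | ZZero.

Fixpoint zcoef (e : zexpr) (i : nat) : int :=
  match e with
  | ZVar j => (i == j)%:R
  | ZAdd a b => zcoef a i + zcoef b i
  | ZOpp a => - zcoef a i
  | ZZero => 0
  end.

Fixpoint zeval (V : zmodType) (s : seq V) (e : zexpr) : V :=
  match e with
  | ZVar j => nth 0 s j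
  | ZAdd a b => zeval s a + zeval s b
  | ZOpp a => - zeval s a
  | ZZero => 0
  end.

Lemma zevalE (V : zmodType) (s : seq V) (e : zexpr) :
  zeval s e = \sum_(i < size s) nth 0 s i *~ zcoef e i.
Proof.
elim: e => /= [j|a -> b ->|a ->|]; last by rewrite big1.
- have [js|sj] := ltnP j (size s); last first.
    by rewrite nth_default// big1// => i _; rewrite ltn_eqF// (leq_trans _ sj).
  rewrite (bigD1 (Ordinal js))//= eqxx mulr1z big1 ?addr0// => i /negPf ij.
  by rewrite -[_ == _ :> nat]/(i == Ordinal js) ij.
- by rewrite -big_split; apply: eq_bigr => i _ /=; rewrite mulrzDr.
- by rewrite -sumrN; apply: eq_bigr => i _ /=; rewrite mulrNz.
Qed.

(** Both sides are integer combinations of the same atoms; the coefficients are compared by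
    computation, so that [isT] proves the premise. *)
Lemma zevalP (V : zmodType) (s : seq V) (e1 e2 : zexpr) :
  all (fun i => zcoef e1 i == zcoef e2 i) (iota 0 (size s)) ->
  zeval s e1 = zeval s e2.
Proof.
move=> /allP H; rewrite !zevalE; apply: eq_bigr => i _.
by have /eqP -> : zcoef e1 i == zcoef e2 i by apply: H; rewrite mem_iota /= add0n.
Qed.

(* Atoms are compared up to unification: their implicit structures may differ
   syntactically. *)
Ltac zfind_syntactic x s :=
  lazymatch s with
  | x :: _ => constr:(0%N)
  | _ :: ?t => let n := zfind_syntactic x t in constr:(S n)
  end.
Ltac zfind_unify x s :=
  match s with
  | ?y :: _ => let _ := match constr:(tt) with _ => unify x y end in constr:(0%N)
  | _ :: ?t => let n := zfind_unify x t in constr:(S n)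
  end.
Ltac zfind x s :=
  match constr:(tt) with
  | _ => zfind_syntactic x s
  | _ => zfind_unify x s
  end.
Ltac zatoms V t s :=
  lazymatch t with
  | @GRing.add _ ?a ?b => let s1 := zatoms V a s in zatoms V b s1
  | @GRing.opp _ ?a => zatoms V a s
  | @GRing.zero _ => s
  | _ => match constr:(tt) with
         | _ => let n := zfind t s in s
         | _ => constr:(t :: s)
         end
  end.
Ltac zreify t s :=
  lazymatch t with
  | @GRing.add _ ?a ?b => let a' := zreify a s in let b' := zreify b s in
      constr:(ZAdd a' b')
  | @GRing.opp _ ?a => let a' := zreify a s in constr:(ZOpp a')
  | @GRing.zero _ => constr:(ZZero)
  | _ => let n := zfind t s in constr:(ZVar n)
  end.
Ltac zmodule :=
  match goal with
  | |- @eq ?V ?l ?r =>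
    let s := zatoms V l (@nil V) in let s := zatoms V r s in
    let a := zreify l s in let b := zreify r s in
    exact: (@zevalP _ s a b isT)
  end.

(** * Mean value inequalities for curves in normed spaces *)

Section Calculus.
Context {R : realType}.
Implicit Types (V W Z : normedModType R).

(* Stands in for the compactness of [a, b]. *)
Lemma interval_chain (Q : R -> R -> Prop) (a b : R) : a <= b ->
  (forall u v w, a <= u -> u <= v -> v <= w -> w <= b ->
    Q u v -> Q v w -> Q u w) ->
  (forall t, a <= t <= b -> exists2 d, 0 < d &
    (forall u, a <= u -> t - d < u -> u <= t -> Q u t) /\
    (forall v, v <= b -> t <= v -> v < t + d -> Q t v)) ->
  Q a b.
Proof.
move=> ab trQ locQ.
have Qaa : Q a a.
  have [|d d0 [Ql _]] := locQ a; first by rewrite lexx.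
  by apply: Ql => //; lra.
pose S := [set t | a <= t <= b /\ Q a t].
have Sa : S a by split => //; rewrite lexx.
have Sub : ubound S b by move=> t [/andP[_ ?] _].
have supS : has_sup S by split; [exists a | exists b].
set s := sup S.
have as_ : a <= s by apply: ub_le_sup => //; exists b.
have sb : s <= b by apply: ge_sup => //; exists a.
have [|d d0 [Ql Qr]] := locQ s; first by rewrite as_.
have Qs : Q a s.
  have [u [/andP[au ub] Qu] su] := sup_adherent d0 supS.
  have us : u <= s by apply: ub_le_sup => //; [exists b | split => //; rewrite au].
  by apply: (trQ a u s) => //; apply: Ql.
have [sltb|bs] := ltP s b; last by have -> : b = s by apply/eqP; rewrite eq_le bs sb.
pose v := Num.min b (s + d / 2).
have vb : v <= b by rewrite ge_min lexx.
have sv : s < v by rewrite lt_min sltb /=; lra.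
have vd : v < s + d by rewrite gt_min; apply/orP; right; lra.
have : v <= s.
  apply: ub_le_sup; first by exists b.
  split; first by apply/andP; split => //; lra.
  by apply: (trQ a s v) => //; [exact: ltW | apply: Qr => //; exact: ltW].
by rewrite leNgt sv.
Qed.

Lemma is_derive_near W (f : R -> W) (t : R) (w : W) (e : R) :
  is_derive t 1 f w -> 0 < e ->
  exists2 d, 0 < d &
    forall s, `|s - t| < d -> `|f s - f t - (s - t) *: w| <= e * `|s - t|.
Proof.
move=> [dft <-] e0.
have : h^-1 *: (f (h *: 1 + t) - f t) @[h --> 0^'] --> 'D_1 f t by exact: dft.
move/cvgrPdist_le => /(_ _ e0) /nbhs_ballP[d /= d0 H].
exists d => // s std.
have [->|st0] := eqVneq s t.
  by rewrite !subrr scale0r subr0 !normr0 mulr0.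
have := H (s - t); rewrite /ball /= sub0r normrN => /(_ std).
rewrite subr_eq0 => /(_ st0).
rewrite /shift /= [_%:A]mulr1 subrK => H1.
have st1 : s - t != 0 by rewrite subr_eq0.
have -> : f s - f t - (s - t) *: 'D_1 f t =
  - ((s - t) *: ('D_1 f t - (s - t)^-1 *: (f s - f t))).
  by rewrite scalerBr scalerA mulfV// scale1r opprB.
by rewrite normrN normrZ mulrC ler_wpM2r.
Qed.

(* No Hahn-Banach: the bound with slack e is transitive over adjacent
   intervals and holds locally. *)
Lemma mean_value_closed W (f f' : R -> W) (v : W) (a b M : R) : a <= b ->
  (forall t, a <= t <= b -> is_derive t 1 f (f' t)) ->
  (forall t, a <= t <= b -> `|f' t - v| <= M) ->
  `|f b - f a - (b - a) *: v| <= M * (b - a).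
Proof.
move=> ab df bf.
apply/ler_addgt0Pr => e e0.
have e1 : 0 < e / (b - a + 1) by apply: divr_gt0 => //; lra.
set e' := e / (b - a + 1) in e1.
suff H : `|f b - f a - (b - a) *: v| <= (M + e') * (b - a).
  apply: (le_trans H); rewrite mulrDl lerD2l.
  rewrite /e' -mulrA -[leRHS]mulr1 ler_pM2l// mulrC ler_pdivrMr; lra.
have combine x y z : f z - f x - (z - x) *: v =
  (f z - f y - (z - y) *: v) + (f y - f x - (y - x) *: v).
  have -> : (z - x) *: v = (z - y) *: v + (y - x) *: v.
    by rewrite -scalerDl; congr (_ *: _); ring.
  by rewrite addrACA -opprD; congr (_ - _); rewrite addrA subrK.
apply: (@interval_chain (fun x y =>
    `|f y - f x - (y - x) *: v| <= (M + e') * (y - x))) => //.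
  move=> x y z _ _ _ _ H1 H2.
  rewrite (combine x y z); apply: (le_trans (ler_normD _ _)).
  by have := lerD H2 H1; rewrite -mulrDr; congr (_ <= _ * _); ring.
move=> t tab.
have [d d0 Hd] := is_derive_near (df t tab) e1.
have key s : `|s - t| < d -> `|f s - f t - (s - t) *: v| <= (M + e') * `|s - t|.
  move=> /Hd H.
  have -> : f s - f t - (s - t) *: v =
     (f s - f t - (s - t) *: f' t) + (s - t) *: (f' t - v).
    by rewrite scalerBr addrA subrK.
  apply: (le_trans (ler_normD _ _)); rewrite mulrDl [leRHS]addrC lerD//.
  by rewrite normrZ mulrC ler_wpM2r// bf.
exists d => //; split=> [u _ tu ut | u _ tu ut].
  have -> : f t - f u - (t - u) *: v = - (f u - f t - (u - t) *: v).
    by rewrite -(opprB u t) scaleNr opprK opprB addrC -(opprB (f t)) opprK addrC.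
  by rewrite normrN; have := key u; rewrite ler0_norm ?subr_le0// opprB; apply; lra.
by have := key u; rewrite ger0_norm ?subr_ge0//; apply; lra.
Qed.

(** The closed version is applied on [[a + s, b - s]], and continuity at the endpoints lets [s] tend
    to 0. This form fits solutions whose field switches at an endpoint. *)
Lemma mean_value W (f f' : R -> W) (v : W) (a b M : R) : a <= b ->
  (forall t, a <= t <= b -> {for t, continuous f}) ->
  (forall t, a < t < b -> is_derive t 1 f (f' t)) ->
  (forall t, a < t < b -> `|f' t - v| <= M) ->
  `|f b - f a - (b - a) *: v| <= M * (b - a).
Proof.
rewrite le_eqVlt => /predU1P[-> *|ab cf df bf].
  by rewrite !subrr scale0r subr0 normr0 mulr0.
have M0 : 0 <= M.
  by apply: (le_trans (normr_ge0 _)); apply: (bf ((a + b) / 2)); lra.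
apply/ler_addgt0Pr => e e0.
pose G s := f (b - s) - f (a + s) - ((b - s) - (a + s)) *: v.
have cG : {for 0, continuous G}.
  rewrite /G; apply: cvgB.
    apply: cvgB; (apply: continuous_comp; last by
      rewrite ?(subr0, addr0); apply: cf; lra).
      by apply: cvgB; [exact: cvg_cst|exact: cvg_id].
    by apply: cvgD; [exact: cvg_cst|exact: cvg_id].
  apply: cvgZr_tmp; apply: cvgB.
    by apply: cvgB; [exact: cvg_cst|exact: cvg_id].
  by apply: cvgD; [exact: cvg_cst|exact: cvg_id].
move/cvgrPdist_le : cG => /(_ _ e0) /nbhs_ballP[d /= d0 Hd].
(* The first bound brings [G s] within [e] of [G 0]; the second keeps [a + s <= b - s]. *)
pose s := Num.min (d / 2) ((b - a) / 3).
have s0 : 0 < s by rewrite lt_min; apply/andP; split; lra.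
have sd : s <= d / 2 by rewrite ge_min lexx.
have sb : s <= (b - a) / 3 by rewrite ge_min lexx orbT.
have := Hd s; rewrite /ball /= sub0r normrN gtr0_norm// => /(_ ltac:(lra)).
rewrite {1}/G subr0 addr0 => H1.
have H2 : `|G s| <= M * ((b - s) - (a + s)).
  apply: (@mean_value_closed W f f'); [lra| |] => t tab; [apply: df|apply: bf]; lra.
rewrite -(subrK (G s) (_ - _)); apply: (le_trans (ler_normD _ _)).
rewrite addrC lerD//; apply: (le_trans H2); rewrite ler_wpM2l//; lra.
Qed.

Lemma mean_value0 W (f f' : R -> W) (a b M : R) : a <= b ->
  (forall t, a <= t <= b -> {for t, continuous f}) ->
  (forall t, a < t < b -> is_derive t 1 f (f' t)) ->
  (forall t, a < t < b -> `|f' t| <= M) ->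
  `|f b - f a| <= M * (b - a).
Proof.
move=> ab cf df bf.
rewrite -(subr0 (f b - f a)) -(scaler0 _ (b - a)).
by apply: (mean_value ab cf df) => t tab; rewrite subr0 bf.
Qed.

Lemma mean_value_abs W (f f' : R -> W) (M s t : R) :
  (forall x, Num.min s t <= x <= Num.max s t -> {for x, continuous f}) ->
  (forall x, Num.min s t < x < Num.max s t -> is_derive x 1 f (f' x)) ->
  (forall x, Num.min s t < x < Num.max s t -> `|f' x| <= M) ->
  `|f t - f s| <= M * `|t - s|.
Proof.
have [st|/ltW ts] := leP s t => cf df bf.
  by rewrite (@ger0_norm _ (t - s)) ?subr_ge0//; exact: mean_value0 bf.
rewrite (@ler0_norm _ (t - s)) ?subr_le0// opprB distrC.
exact: mean_value0 bf.
Qed.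

Lemma is_derive_continuous W (f : R -> W) (t : R) (w : W) :
  is_derive t 1 f w -> {for t, continuous f}.
Proof. by move=> [d _]; exact/differentiable_continuous/derivable1_diffP. Qed.

Lemma is_derive_line V W (f : V -> W) (x v : V) (t : R) :
  derivable f (x + t *: v) v ->
  is_derive t 1 (fun s : R => f (x + s *: v)) ('D_v f (x + t *: v)).
Proof.
move=> df.
have E : (fun h : R => h^-1 *: (((fun s : R => f (x + s *: v)) \o shift t) (h *: 1)
            - f (x + t *: v))) =
   (fun h : R => h^-1 *: ((f \o shift (x + t *: v)) (h *: v) - f (x + t *: v))).
  apply/funext => h /=; congr (_ *: (f _ - _)).
  by rewrite [_%:A]mulr1 scalerDl addrCA addrA addrC addrA addrC addrA.
by apply: DeriveDef; rewrite /derivable /derive E.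
Qed.

Lemma mean_value_line V W (f : V -> W) (x v : V) (w : W) (M : R) :
  (forall t : R, 0 <= t <= 1 -> derivable f (x + t *: v) v) ->
  (forall t : R, 0 <= t <= 1 -> `|'D_v f (x + t *: v) - w| <= M) ->
  `|f (x + v) - f x - w| <= M.
Proof.
move=> df bf.
have := @mean_value_closed W (fun s => f (x + s *: v))
  (fun t => 'D_v f (x + t *: v)) w 0 1 M ler01.
rewrite scale1r scale0r addr0 subr0 scale1r mulr1; apply => // t tt.
exact/is_derive_line/df.
Qed.

End Calculus.

(** * Directional derivatives and the calculus of [Ck] maps *)

Section CkAlgebra.
Context {R : realType}.
Implicit Types (V W Z : normedModType R).

Lemma is_derive_comp_curve Z W (f : Z -> W) (g : R -> Z) (t : R) (w : Z) :
  is_derive t 1 g w -> differentiable f (g t) ->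
  is_derive t 1 (fun s => f (g s)) ('D_w f (g t)).
Proof.
move=> [dg gw] df; have dg' : differentiable g t by exact/derivable1_diffP.
have dfg : differentiable (f \o g) t by exact: differentiable_comp.
apply: DeriveDef; first exact: diff_derivable.
rewrite [LHS](deriveE _ dfg) diff_comp//= -(deriveE _ dg') gw.
by rewrite deriveE.
Qed.

Lemma derive_comp V Z W (f : Z -> W) (g : V -> Z) (x v : V) :
  differentiable g x -> differentiable f (g x) ->
  'D_v (f \o g) x = 'D_('D_v g x) f (g x).
Proof.
move=> dg df; rewrite deriveE; last exact: differentiable_comp.
by rewrite diff_comp//= deriveE// deriveE.
Qed.

(** Only the derivative along [v] is given, so [f] is restricted to the line through [x], where the
    problem is one-dimensional and the chain rule with [k |-> k * h] applies. *)
Lemma is_derive_scaledir V W (f : V -> W) (x v : V) (h : R) :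
  derivable f x v -> is_derive x (h *: v) f (h *: 'D_v f x).
Proof.
move=> /derivable1P/derivable1_diffP dg.
set g := (fun k : R => f (k *: v + x)) in dg.
have dk : is_derive (0 : R) 1 (fun k : R => k * h) h.
  have H : is_derive (0 : R) 1 (fun k : R => k * h) ((0 : R) *: (0 : R) + h *: (1 : R)).
    exact: (@is_deriveM _ _ id (cst h)).
  by apply: is_derive_eq H _; rewrite scaler0 add0r [_ *: _]mulr1.
have [|d1 d2] := is_derive_comp_curve (f := g) dk; first by rewrite mul0r.
have E : (fun s : R => g (s * h)) = (fun k : R => f (k *: (h *: v) + x)).
  by apply/funext => k; rewrite /g scalerA.
rewrite E in d1 d2.
have D (u : V) : 'D_1 (fun k : R => f (k *: u + x)) 0 = 'D_u f x.
  rewrite /derive; set g1 := fun h => h^-1 *: _; set g2 := fun h => h^-1 *: _.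
  suff -> : g1 = g2 by []; apply/funext => k; rewrite /g1 /g2 /=.
  by rewrite addr0 scale0r add0r [_%:A]mulr1.
apply: DeriveDef; first exact/derivable1P.
rewrite -D d2 mul0r deriveE// -(mulr1 h) -[h * 1]/(h *: (1 : R^o)) linearZ/=.
by rewrite -deriveE// D [h *: 1]mulr1.
Qed.

(** The product rule in a single direction, from the difference quotients; [f] is continuous along
    the line through [x] because its restriction to that line is differentiable. *)
Lemma is_derive_scale V W (a : V -> R) (f : V -> W) (x v : V) (da : R) (df : W) :
  is_derive x v a da -> is_derive x v f df ->
  is_derive x v (fun y => a y *: f y) (a x *: df + da *: f x).
Proof.
move=> [a1 a2] [f1 f2].
have cf : f (h *: v + x) @[h --> 0^'] --> f x.
  have /derivable1P/derivable1_diffP/differentiable_continuous := f1.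
  rewrite /prop_for /continuous_at /= scale0r add0r => H.
  by apply: cvg_trans H; apply: cvg_app; exact: cvg_within.
have H : h^-1 *: (a (h *: v + x) *: f (h *: v + x) - a x *: f x) @[h --> 0^']
   --> a x *: df + da *: f x.
  have -> : (fun h : R => h^-1 *: (a (h *: v + x) *: f (h *: v + x) - a x *: f x))
    = (fun h : R => a x *: (h^-1 *: (f (h *: v + x) - f x)) +
        (h^-1 *: (a (h *: v + x) - a x)) *: f (h *: v + x)).
    apply/funext => h; rewrite scalerA mulrC -!scalerA -scalerDr; congr (_ *: _).
    by rewrite scalerBr scalerBl [RHS]addrC addrA subrK.
  apply: cvgD.
    by apply: cvgZl_tmp; rewrite -f2; exact: f1.
  by apply: cvgZ => //; rewrite -a2; exact: a1.
apply: DeriveDef; first by apply/cvg_ex; eexists; exact: H.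
by apply/cvg_lim => //; exact: H.
Qed.

Lemma Ck_continuous V W k (U : set V) (f : V -> W) x :
  Ck k U f -> U x -> {for x, continuous f}.
Proof. by case: k => [|k] [+ _]; exact. Qed.

Lemma Ck_derivable V W k (U : set V) (f : V -> W) x v :
  Ck k.+1 U f -> U x -> derivable f x v.
Proof. by move=> [_ /(_ v)[+ _]]; apply. Qed.

Lemma Ck_derive V W k (U : set V) (f : V -> W) v :
  Ck k.+1 U f -> Ck k U (fun x => 'D_v f x).
Proof. by move=> [_ /(_ v)[_ +]]. Qed.

Lemma Ck_pred V W k (U : set V) (f : V -> W) : Ck k.+1 U f -> Ck k U f.
Proof.
elim: k f => [f [cf _]//|k IH f [cf df]]; split => // v.
by have [df1 df2] := df v; split => //; exact: IH.
Qed.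

Lemma Ck_subset V W k (U U' : set V) (f : V -> W) :
  U' `<=` U -> Ck k U f -> Ck k U' f.
Proof.
move=> UU; elim: k f => [f [cf _]|k IH f [cf df]]; split => //.
- by move=> x /UU; exact: cf.
- by move=> x /UU; exact: cf.
by move=> v; have [df1 df2] := df v; split; [move=> x /UU; exact: df1|exact: IH].
Qed.

Lemma near_eq_continuous (X Y : topologicalType) (f g : X -> Y) x :
  (\near x, f x = g x) -> {for x, continuous f} -> {for x, continuous g}.
Proof.
move=> fg; rewrite /prop_for /continuous_at -(nbhs_singleton fg).
apply: cvg_trans; apply: near_eq_cvg.
by apply: filterS fg => y.
Qed.

Lemma continuous_pair (X Y Z : topologicalType) (f : X -> Y) (g : X -> Z) x :
  {for x, continuous f} -> {for x, continuous g} ->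
  {for x, continuous (fun y => (f y, g y))}.
Proof. by move=> cf cg; exact: cvg_pair cf cg. Qed.

Lemma Ck_eq V W k (U : set V) (f g : V -> W) : open U ->
  (forall x, U x -> f x = g x) -> Ck k U f -> Ck k U g.
Proof.
move=> oU; elim: k f g => [|k IH] f g fg [cf df].
all: have nfg x : U x -> \near x, f x = g x
  by move=> Ux; apply: filterS (open_nbhs_nbhs (conj oU Ux)) => y; exact: fg.
  by split => // x Ux; apply: near_eq_continuous (nfg x Ux) (cf x Ux).
split; first by move=> x Ux; apply: near_eq_continuous (nfg x Ux) (cf x Ux).
move=> v; have [df1 df2] := df v; split.
  by move=> x Ux; apply: near_eq_derivable (df1 x Ux); exact: nfg.
by apply: IH df2 => x Ux; apply: near_eq_derive; exact: nfg.
Qed.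

(** The difference quotients of the two sides are the same function of [h]. Applied to slices such
    as [y |-> (x, y)] and to projections of a product. *)
Lemma derive_affine V Z W (f : Z -> W) (p A : V -> Z) (x v : V) :
  (forall (h : R) y u, p (h *: u + y) = h *: A u + p y) ->
  ((derivable f (p x) (A v) -> derivable (fun y => f (p y)) x v) *
   ('D_v (fun y => f (p y)) x = 'D_(A v) f (p x)))%type.
Proof.
move=> pA.
have E : (fun h : R => h^-1 *: (((fun y => f (p y)) \o shift x) (h *: v) - f (p x)))
  = (fun h : R => h^-1 *: ((f \o shift (p x)) (h *: A v) - f (p x))).
  by apply/funext => h /=; rewrite pA.
by rewrite /derivable /derive E.
Qed.

Lemma Ck_affine V Z W k (U : set Z) (f : Z -> W) (p A : V -> Z) :
  (forall (h : R) y u, p (h *: u + y) = h *: A u + p y) -> continuous p ->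
  Ck k U f -> Ck k [set x | U (p x)] (fun x => f (p x)).
Proof.
move=> pA cp; elim: k f => [|k IH] f [cf df].
  by split => // x Ux; apply: continuous_comp; [exact: cp|exact: cf].
split; first by move=> x Ux; apply: continuous_comp; [exact: cp|exact: cf].
move=> v; have [df1 df2] := df (A v); split.
  by move=> x Ux; apply: (derive_affine f x v pA).1; exact: df1.
have -> : (fun x => 'D_v (fun x0 => f (p x0)) x) = (fun x => 'D_(A v) f (p x)).
  by apply/funext => x; rewrite (derive_affine f x v pA).2.
exact: (IH (fun z => 'D_(A v) f z) df2).
Qed.

Lemma Ck_cst V W k (U : set V) (w : W) : Ck k U (fun _ : V => w).
Proof.
elim: k w => [|k IH] w; split => //; try by move=> x _; exact: cvg_cst.
move=> v; split; first by move=> x _; exact: derivable_cst.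
have -> : (fun x => 'D_v (fun _ : V => w) x) = (fun=> 0).
  by apply/funext => x; exact: derive_cst.
exact: (IH 0).
Qed.

Lemma Ck_add V W k (U : set V) (f g : V -> W) : open U ->
  Ck k U f -> Ck k U g -> Ck k U (fun x => f x + g x).
Proof.
move=> oU; elim: k f g => [|k IH] f g [cf df] [cg dg];
  (split; first by move=> x Ux; apply: cvgD; [exact: cf|exact: cg]) => //.
move=> v; have [df1 df2] := df v; have [dg1 dg2] := dg v; split.
  by move=> x Ux; apply: derivableD; [exact: df1|exact: dg1].
apply: (Ck_eq (f := fun x => 'D_v f x + 'D_v g x)) => //; last exact: IH.
by move=> x Ux; rewrite -deriveD//; [exact: df1|exact: dg1].
Qed.

Lemma Ck_sum V W k (U : set V) m (f : 'I_m -> V -> W) : open U ->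
  (forall i, Ck k U (f i)) -> Ck k U (fun x => \sum_i f i x).
Proof.
move=> oU; elim: m f => [|m IH] f Cf.
  under eq_fun do rewrite big_ord0; exact: Ck_cst.
under eq_fun do rewrite big_ord_recr/=.
by apply: Ck_add => //; apply: IH => i; exact: Cf.
Qed.

Lemma Ck_scale V W k (U : set V) (a : V -> R) (f : V -> W) : open U ->
  Ck k U a -> Ck k U f -> Ck k U (fun x => a x *: f x).
Proof.
move=> oU; elim: k a f => [|k IH] a f [ca da] [cf df];
  (split; first by move=> x Ux; apply: cvgZ; [exact: ca|exact: cf]) => //.
move=> v; have [da1 da2] := da v; have [df1 df2] := df v.
have H x : U x -> is_derive x v (fun x => a x *: f x) (a x *: 'D_v f x + 'D_v a x *: f x).
  by move=> Ux; apply: is_derive_scale; apply: derivableP; [exact: da1|exact: df1].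
split; first by move=> x /H[].
apply: (Ck_eq (f := fun x => a x *: 'D_v f x + 'D_v a x *: f x)) => //.
  by move=> x /H[_ ->].
apply: Ck_add => //; apply: IH => //; [exact: (@Ck_pred _ _ k)|exact: (@Ck_pred _ _ k)].
Qed.

Lemma is_derive_coord V m n (f : V -> 'M[R]_(m, n)) (x v : V) df i j :
  is_derive x v f df -> is_derive x v (fun y => f y i j) (df i j).
Proof.
move=> [d1 <-]; apply: DeriveDef; first by move/derivable_mxP : d1; exact.
by rewrite derive_mx// mxE.
Qed.

Lemma is_derive_mx V m n (f : V -> 'M[R]_(m, n)) (x v : V) (df : 'M[R]_(m, n)) :
  (forall i j, is_derive x v (fun y => f y i j) (df i j)) -> is_derive x v f df.
Proof.
move=> H; have d : derivable f x v by apply/derivable_mxP => i j; case: (H i j).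
apply: DeriveDef => //; rewrite derive_mx//; apply/matrixP => i j; rewrite mxE.
by case: (H i j).
Qed.

Lemma Ck_coord V m n k (U : set V) (f : V -> 'M[R]_(m, n)) i j : open U ->
  Ck k U f -> Ck k U (fun x => f x i j).
Proof.
move=> oU; elim: k f => [|k IH] f [cf df];
  (split; first by move=> x Ux;
    apply: (continuous_comp (g := fun M : 'M[R]_(m, n) => M i j) (cf x Ux));
    exact: coord_continuous) => //.
move=> v; have [df1 df2] := df v.
have H x : U x -> is_derive x v (fun y => f y i j) ('D_v f x i j).
  by move=> Ux; apply/is_derive_coord/derivableP/df1.
split; first by move=> x /H[].
by apply: (Ck_eq (f := fun x => 'D_v f x i j)) => //; [move=> x /H[]|exact: IH].
Qed.

End CkAlgebra.

(** * C1 maps in finite dimension: strict differentiability, and symmetry of second derivatives *)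

Section C1Differentiable.
Context {R : realType}.
Implicit Types (V W Z : normedModType R).

(** Finite dimension in the form in which the estimates use it: coordinates in a fixed finite
    family, bounded by the norm. This form passes to products, hence to space-time [E * R]. *)
Definition spanned V : Prop := exists m (e : 'I_m -> V) (a : 'I_m -> V -> R),
  (forall v, v = \sum_i a i v *: e i) /\ (forall i v, `|a i v| <= `|v|).

Lemma cV_coord_le m n (v : 'M[R]_(m, n)) i j : `|v i j| <= `|v|.
Proof.
rewrite [leRHS]/Num.Def.normr/= mx_normrE.
exact: (le_bigmax _ (fun ij => `|v ij.1 ij.2|) (i, j)).
Qed.

Lemma spanned_cV n : spanned 'cV[R]_n.
Proof.
exists n, (fun i => delta_mx i 0), (fun i (v : 'cV[R]_n) => v i 0); split.
  move=> v; rewrite [LHS]matrix_sum_delta; apply: eq_bigr => i _.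
  by rewrite big_ord1.
by move=> i v; exact: cV_coord_le.
Qed.

Lemma spanned_R : spanned R^o.
Proof.
exists 1%N, (fun=> 1), (fun=> id); split => // v.
by rewrite big_ord1 [_ *: _]mulr1.
Qed.

Lemma spanned_prod V W : spanned V -> spanned W -> spanned (V * W)%type.
Proof.
move=> [m [e [a [ea na]]]] [m' [e' [a' [ea' na']]]].
exists (m + m')%N, (fun i : 'I_(m + m') =>
    match fintype.split i with inl j => (e j, 0 : W) | inr j => (0 : V, e' j) end),
  (fun (i : 'I_(m + m')) (v : V * W) => match fintype.split i with inl j => a j v.1 | inr j => a' j v.2 end); split.
  move=> [v w]; rewrite big_split_ord/=.
  under eq_bigr => i _ do rewrite (unsplitK (inl i)).
  under [X in _ = _ + X]eq_bigr => i _ do rewrite (unsplitK (inr i)).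
  rewrite [X in X + _](_ : _ = (v, 0)); last first.
    rewrite [in RHS](ea v); elim/big_ind2 : _ => //= [x1 x2 y1 y2 -> ->|i _].
      by congr pair; rewrite addr0.
    by congr pair; rewrite scaler0.
  rewrite [X in _ + X](_ : _ = (0, w)); last first.
    rewrite [in RHS](ea' w); elim/big_ind2 : _ => //= [x1 x2 y1 y2 -> ->|i _].
      by congr pair; rewrite addr0.
    by congr pair; rewrite scaler0.
  by congr pair; rewrite ?addr0 ?add0r.
move=> i [v w] /=; case: fintype.split => j.
  by apply: (le_trans (na _ _)); rewrite prod_normE/= le_max lexx.
by apply: (le_trans (na' _ _)); rewrite prod_normE/= le_max lexx orbT.
Qed.

Lemma open_ball_sub V (U : set V) x : open U -> U x ->
  exists2 d : R, 0 < d & forall y, `|y - x| < d -> U y.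
Proof.
move=> oU Ux; have /nbhs_ballP[d /= d0 H] := open_nbhs_nbhs (conj oU Ux).
by exists d => // y yx; apply: H; rewrite -ball_normE /= distrC.
Qed.

Lemma continuous_ball V W (f : V -> W) x (e : R) : {for x, continuous f} -> 0 < e ->
  exists2 d : R, 0 < d & forall y, `|y - x| < d -> `|f y - f x| < e.
Proof.
move=> /cvgrPdist_lt/(_ _) + e0 => /(_ e e0) /nbhs_ballP[d /= d0 H].
by exists d => // y yx; rewrite distrC; apply: H; rewrite -ball_normE /= distrC.
Qed.

(** [Ck] speaks of one direction at a time, so additivity in the direction has to be proved. The
    step [h (u + v)] is split into [h u], handled by the derivative at [x], and [h v] from the point
    [x + h u], handled by the mean value inequality and the continuity of the derivative along
    [v]. *)
Lemma derive_add V W (U : set V) (f : V -> W) x (u v : V) : open U ->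
  Ck 1 U f -> U x -> 'D_(u + v) f x = 'D_u f x + 'D_v f x.
Proof.
move=> oU Cf Ux; apply/cvg_lim => //; apply/cvgrPdist_le => e e0.
have [d1 d10 H1] := open_ball_sub oU Ux.
have e2 : 0 < e / 2 by rewrite divr_gt0.
have [d2 d20 H2] := continuous_ball (Ck_continuous (Ck_derive v Cf) Ux) e2.
have : h^-1 *: (f (h *: u + x) - f x) @[h --> 0^'] --> 'D_u f x.
  exact: (Ck_derivable (v := u) Cf Ux).
move/cvgrPdist_le => /(_ _ e2) /nbhs_ballP[d3 /= d30 H3].
pose M := `|u| + `|v| + 1.
have M0 : 0 < M by rewrite /M ltr_wpDl// addr_ge0.
pose d := Num.min (Num.min d1 d2 / M) d3.
have d0 : 0 < d by rewrite !lt_min d30 andbT divr_gt0// lt_min d10.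
apply/nbhs_ballP; exists d => //= h; rewrite /ball /= sub0r normrN => hd h0.
have hM : `|h| * M < Num.min d1 d2.
  by rewrite -ltr_pdivlMr//; apply: (lt_le_trans hd); rewrite ge_min lexx.
have h3 : `|h| < d3 by apply: (lt_le_trans hd); rewrite ge_min lexx orbT.
have near_x (t : R) : 0 <= t <= 1 -> `|h *: u + x + t *: (h *: v) - x| < Num.min d1 d2.
  move=> t01; apply: le_lt_trans hM; have -> : h *: u + x + t *: (h *: v) - x = h *: (u + t *: v).
    by rewrite scalerDr !scalerA (mulrC t); zmodule.
  rewrite normrZ ler_wpM2l// /M.
  apply: (le_trans (ler_normD _ _)); rewrite -addrA lerD2l normrZ.
  have [t0 t1] : 0 <= t /\ t <= 1 by move/andP: t01.
  rewrite ger0_norm//; have := normr_ge0 v; nra.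
have U1 t : 0 <= t <= 1 -> U (h *: u + x + t *: (h *: v)).
  by move=> /near_x H; apply: H1; apply: (lt_le_trans H); rewrite ge_min lexx.
have key : `|f (h *: u + x + h *: v) - f (h *: u + x) - h *: 'D_v f x| <= `|h| * (e / 2).
  apply: mean_value_line => t t01.
    have := Ck_derivable (v := v) Cf (U1 t t01).
    by move=> /(@is_derive_scaledir _ _ _ _ _ _ h)[].
  have [_ ->] := @is_derive_scaledir _ _ _ _ _ _ h (Ck_derivable (v := v) Cf (U1 t t01)).
  rewrite -scalerBr normrZ ler_wpM2l//; apply/ltW/H2.
  by apply: (lt_le_trans (near_x t t01)); rewrite ge_min lexx orbT.
have := H3 h; rewrite /ball /= sub0r normrN => /(_ h3 h0) key2.
have -> : 'D_u f x + 'D_v f x - h^-1 *: (f (h *: (u + v) + x) - f x) =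
  ('D_u f x - h^-1 *: (f (h *: u + x) - f x)) -
   h^-1 *: (f (h *: u + x + h *: v) - f (h *: u + x) - h *: 'D_v f x).
  have -> : h *: (u + v) + x = h *: u + x + h *: v by rewrite scalerDr; zmodule.
  rewrite !scalerBr scalerA mulVf// scale1r; zmodule.
apply: (le_trans (ler_normB _ _)); rewrite [leRHS](splitr e) lerD//.
by rewrite normrZ normfV ler_pdivrMl ?normr_gt0.
Qed.

Lemma segment_ball V (x y z : V) (d t : R) : `|z - x| < d -> `|y - x| < d ->
  0 <= t -> t <= 1 -> `|z + t *: (y - z) - x| < d.
Proof.
move=> zd yd t0 t1.
have -> : z + t *: (y - z) - x = (1 - t) *: (z - x) + t *: (y - x)
  by rewrite scalerBl scale1r !scalerBr; zmodule.
apply: (le_lt_trans (ler_normD _ _)).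
rewrite !normrZ (ger0_norm t0) (@ger0_norm _ (1 - t)) ?subr_ge0//.
by have [h|h] := leP `|z - x| `|y - x|; nra.
Qed.

Lemma derive_frame V W (U : set V) (f : V -> W) x m (e : 'I_m -> V)
    (a : 'I_m -> R) : open U -> Ck 1 U f -> U x ->
  'D_(\sum_i a i *: e i) f x = \sum_i a i *: 'D_(e i) f x.
Proof.
move=> oU Cf Ux; elim/big_ind2 : _ => [|u1 w1 u2 w2 <- <-|i _].
- exact: derive0.
- exact: derive_add Cf Ux.
by have [] := @is_derive_scaledir _ _ _ _ _ _ (a i) (Ck_derivable (v := e i) Cf Ux).
Qed.

(** Along the segment from [z] to [y] the derivative is a combination of the finitely many
    ['D_(e i) f], each nearly constant around [x]. The linear part is taken at a third point [p],
    which the applications choose as [z] or as [x]. *)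
Lemma Ck1_strict V W (U : set V) (f : V -> W) x (eps : R) : spanned V -> open U ->
  Ck 1 U f -> U x -> 0 < eps ->
  exists2 d : R, 0 < d & (forall y, `|y - x| < d -> U y) /\
    forall y z p, `|y - x| < d -> `|z - x| < d -> `|p - x| < d ->
      `|f y - f z - 'D_(y - z) f p| <= eps * `|y - z|.
Proof.
move=> [m [e [a [ea na]]]] oU Cf Ux eps0.
(* Each of the [m] coordinates contributes at most [e']; the [+ 1] keeps the denominator positive
   when [m = 0]. *)
pose e' := eps / (m%:R + 1).
have e'0 : 0 < e' by rewrite divr_gt0// ltr_wpDl.
have e2 : 0 < e' / 2 by rewrite divr_gt0.
have : \forall q \near x, U q /\ forall i, `|'D_(e i) f x - 'D_(e i) f q| < e' / 2.
  near=> q; split; first by near: q; exact: open_nbhs_nbhs.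
  move=> i; move: i; near: q; apply: filter_forall => i.
  by have /cvgrPdist_lt := Ck_continuous (Ck_derive (e i) Cf) Ux; apply.
move=> /nbhs_ballP[d /= d0 H]; exists d => //.
have B q : `|q - x| < d -> U q /\ forall i, `|'D_(e i) f x - 'D_(e i) f q| < e' / 2.
  by move=> qx; apply: H; rewrite -ball_normE /= distrC.
split; first by move=> y /B[].
move=> y z p yd zd pd.
have E : y = z + (y - z) by rewrite addrC subrK.
rewrite {1}E; apply: mean_value_line => t /andP[t0 t1].
all: have qd := segment_ball zd yd t0 t1.
  by apply: (Ck_derivable Cf); exact: (B _ qd).1.
have D q : U q -> 'D_(y - z) f q = \sum_i a i (y - z) *: 'D_(e i) f q.
  by move=> Uq; rewrite [X in 'D_X _ _](ea (y - z)) (derive_frame _ _ oU Cf Uq).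
rewrite (D _ (B _ qd).1) (D _ (B _ pd).1).
rewrite -sumrB; under eq_bigr do rewrite -scalerBr.
apply: (le_trans (ler_norm_sum _ _ _)).
apply: (@le_trans _ _ (\sum_(i < m) `|y - z| * e')).
  apply: ler_sum => i _; rewrite normrZ ler_pM//.
  set q := z + _; have -> : 'D_(e i) f q - 'D_(e i) f p =
    ('D_(e i) f x - 'D_(e i) f p) - ('D_(e i) f x - 'D_(e i) f q) by zmodule.
  apply: (le_trans (ler_normB _ _)).
  by have := (B _ qd).2 i; have := (B _ pd).2 i; lra.
have m0 : 0 < m%:R + 1 :> R by rewrite ltr_wpDl.
have -> : eps = e' * (m%:R + 1) by rewrite /e' divfK ?gt_eqF.
rewrite sumr_const card_ord -[leLHS]mulr_natr.
have : 0 <= `|y - z| * e' by rewrite mulr_ge0// ltW.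
by move: (m%:R : R) => M; nra.
Unshelve. all: by end_near. Qed.

Lemma Ck1_lipschitz V W (U : set V) (f : V -> W) x : spanned V -> open U ->
  Ck 1 U f -> U x ->
  exists2 K : R, 0 < K & exists2 d : R, 0 < d & (forall y, `|y - x| < d -> U y) /\
    forall y z, `|y - x| < d -> `|z - x| < d -> `|f y - f z| <= K * `|y - z|.
Proof.
move=> sV oU Cf Ux; have [d d0 [dU Hd]] := Ck1_strict sV oU Cf Ux ltr01.
have [m [e [a [ea na]]]] := sV.
exists (1 + \sum_i `|'D_(e i) f x|); first by rewrite ltr_wpDr// sumr_ge0.
exists d => //; split => // y z yd zd.
rewrite -(subrK ('D_(y - z) f x) (f y - f z)); apply: (le_trans (ler_normD _ _)).
rewrite mulrDl lerD//; first by apply: Hd => //; rewrite subrr normr0.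
rewrite [X in 'D_X _ _](ea (y - z)) (derive_frame _ _ oU Cf Ux).
apply: (le_trans (ler_norm_sum _ _ _)); rewrite mulr_suml; apply: ler_sum => i _.
by rewrite normrZ mulrC ler_wpM2l.
Qed.

Lemma differentiable_of_linear_approx V W (f : V -> W) x (l : V -> W) (C : R) :
  (forall (h : R) u v, l (h *: u + v) = h *: l u + l v) ->
  (forall v, `|l v| <= C * `|v|) ->
  (forall e : R, 0 < e -> exists2 d : R, 0 < d &
    forall y, `|y - x| < d -> `|f y - f x - l (y - x)| <= e * `|y - x|) ->
  differentiable f x /\ 'd f x = l :> (V -> W).
Proof.
move=> ll lC H.
pose lin := GRing.isLinear.Build _ _ _ _ l ll.
pose L : {linear V -> W} := HB.pack l lin.
have cL : continuous L.
  apply: bounded_linear_continuous; apply/linear_boundedP.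
  near=> r => v /=; apply: (le_trans (lC v)).
  by rewrite ler_wpM2r//; near: r; exact: nbhs_pinfty_ge.
have Hl : f \o shift x = cst (f x) + L +o_ 0 id.
  apply/eqaddoP => e e0; have [d d0 Hd] := H e e0.
  apply/nbhs_ballP; exists d => // h; rewrite -ball_normE /= sub0r normrN => hd.
  have := Hd (h + x); rewrite addrK => /(_ hd).
  by rewrite -addrA -opprD.
have := diff_unique cL Hl => dE; split => //.
by apply/diff_locallyP; rewrite dE.
Unshelve. all: by end_near. Qed.

Lemma Ck1_differentiable V W (U : set V) (f : V -> W) x : spanned V -> open U ->
  Ck 1 U f -> U x -> differentiable f x.
Proof.
move=> sV oU Cf Ux.
have [m [e [a [ea na]]]] := sV.
apply: (@differentiable_of_linear_approx _ _ _ _ (fun v => 'D_v f x) (\sum_i `|'D_(e i) f x|) _ _ _).1.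
- move=> h u v; rewrite (derive_add _ _ oU Cf Ux); congr (_ + _).
  by have [] := @is_derive_scaledir _ _ _ _ _ _ h (Ck_derivable (v := u) Cf Ux).
- move=> v; rewrite [X in 'D_X _ _](ea v) (derive_frame _ _ oU Cf Ux).
  apply: (le_trans (ler_norm_sum _ _ _)); rewrite mulr_suml; apply: ler_sum => i _.
  by rewrite normrZ mulrC ler_wpM2l.
move=> eps eps0; have [d d0 [dU Hd]] := Ck1_strict sV oU Cf Ux eps0.
by exists d => // y yd; apply: Hd => //; rewrite subrr normr0.
Qed.

(** The mean value inequality twice: in direction [v] for ['D_u f], then in direction [u] for the
    difference of [f] along the parallel segments that start at [x + h v] and at [x]. *)
Lemma second_difference V W (U : set V) (f : V -> W) x (u v : V) (e : R) : open U ->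
  Ck 2 U f -> U x -> 0 < e ->
  exists2 d : R, 0 < d & forall h : R, 0 < h < d ->
    `|f (x + h *: v + h *: u) - f (x + h *: u) - (f (x + h *: v) - f x)
      - h *: (h *: 'D_v (fun y => 'D_u f y) x)| <= h * e * h.
Proof.
move=> oU Cf Ux e0.
have Cu : Ck 1 U (fun y => 'D_u f y) by exact: Ck_derive.
have [d1 d10 H1] := open_ball_sub oU Ux.
have [d2 d20 H2] := continuous_ball (Ck_continuous (Ck_derive v Cu) Ux) e0.
pose M := `|u| + `|v| + 1.
have M0 : 0 < M by rewrite /M ltr_wpDl// addr_ge0.
exists (Num.min d1 d2 / M); first by rewrite divr_gt0// lt_min d10.
move=> h /andP[h0]; rewrite ltr_pdivlMr// => hM.
have inball s t : 0 <= s <= h -> 0 <= t <= h -> `|x + s *: u + t *: v - x| < Num.min d1 d2.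
  move=> /andP[s0 sh] /andP[t0 th]; apply: le_lt_trans hM.
  have -> : x + s *: u + t *: v - x = s *: u + t *: v by zmodule.
  apply: (le_trans (ler_normD _ _)); rewrite !normrZ !ger0_norm// /M.
  by have := normr_ge0 u; have := normr_ge0 v; nra.
have inU s t : 0 <= s <= h -> 0 <= t <= h -> U (x + s *: u + t *: v).
  by move=> hs ht; apply: H1; apply: (lt_le_trans (inball _ _ hs ht)); rewrite ge_min lexx.
have h01 : 0 <= h by exact: ltW.
have h00 : 0 <= (0:R) <= h by rewrite lexx.
have hhh : 0 <= h <= h by rewrite lexx h01.
have key s : 0 <= s <= h -> `|'D_u f (x + h *: v + s *: u) - 'D_u f (x + s *: u)
    - h *: 'D_v (fun y => 'D_u f y) x| <= h * e.
  move=> hs.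
  have := @mean_value_closed _ _ (fun t => 'D_u f (x + s *: u + t *: v))
     (fun t => 'D_v (fun y => 'D_u f y) (x + s *: u + t *: v))
     ('D_v (fun y => 'D_u f y) x) 0 h e h01.
  rewrite scale0r addr0 subr0 mulrC (addrAC x (s *: u)); apply => t ht.
    by apply: is_derive_line; apply: (Ck_derivable Cu); exact: inU.
  by apply/ltW/H2; apply: (lt_le_trans (inball _ _ hs ht)); rewrite ge_min lexx orbT.
have := @mean_value_closed _ _ (fun s => f (x + h *: v + s *: u) - f (x + s *: u))
   (fun s => 'D_u f (x + h *: v + s *: u) - 'D_u f (x + s *: u))
   (h *: 'D_v (fun y => 'D_u f y) x) 0 h (h * e) h01.
rewrite scale0r !addr0 !subr0; apply => // t ht.
have U1 : U (x + h *: v + t *: u) by rewrite addrAC; apply: inU.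
have U2 : U (x + t *: u) by have := inU t 0 ht h00; rewrite scale0r addr0.
by apply: is_deriveB; apply: is_derive_line;
  [exact: (Ck_derivable Cf U1)|exact: (Ck_derivable Cf U2)].
Qed.

(** The second difference of [f] with steps [h u] and [h v] is symmetric in [u] and [v]; divided by
    [h ^ 2] it approximates both mixed derivatives. *)
Lemma Ck2_schwarz V W (U : set V) (f : V -> W) x (u v : V) : open U ->
  Ck 2 U f -> U x ->
  'D_v (fun y => 'D_u f y) x = 'D_u (fun y => 'D_v f y) x.
Proof.
move=> oU Cf Ux; apply/eqP; rewrite -subr_eq0 -normr_le0; apply/ler_addgt0Pr => e e0.
have e2 : 0 < e / 2 by rewrite divr_gt0.
have [d1 d10 H1] := second_difference u v oU Cf Ux e2.
have [d2 d20 H2] := second_difference v u oU Cf Ux e2.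
pose h := Num.min d1 d2 / 2.
have m0 : 0 < Num.min d1 d2 by rewrite lt_min d10.
have h0 : 0 < h by rewrite divr_gt0.
have hm : h < Num.min d1 d2 by rewrite /h; lra.
have {}H1 := H1 h; have {}H2 := H2 h.
rewrite add0r -(ler_pM2l h0) -(ler_pM2l h0).
rewrite -{1}(gtr0_norm h0) -{2}(gtr0_norm h0) -!normrZ !scalerBr.
have {}H1 := H1 ltac:(by rewrite h0 (lt_le_trans hm)// ge_min lexx).
have {}H2 := H2 ltac:(by rewrite h0 (lt_le_trans hm)// ge_min lexx orbT).
have E : f (x + h *: u + h *: v) - f (x + h *: v) - (f (x + h *: u) - f x) =
         f (x + h *: v + h *: u) - f (x + h *: u) - (f (x + h *: v) - f x).
  by rewrite (addrAC x (h *: u)); zmodule.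
rewrite E in H2; rewrite distrC in H1.
apply: (le_trans (ler_distD _ _ _)); apply: (le_trans (lerD H1 H2)).
by rewrite -mulrDl -mulrDr -splitr mulrC.
Qed.

End C1Differentiable.

(** * Primitives of continuous functions, and a uniform contraction principle *)

Section Primitives.
Context {R : realType}.

Definition primitive (a : R) (f : R -> R) (t : R) : R :=
  \int[lebesgue_measure]_(s in `[a, t]) f s.

Lemma continuous_integrable_segment (a b : R) (f : R -> R) : continuous f ->
  lebesgue_measure.-integrable `[a, b] (EFin \o f).
Proof.
move=> cf; apply: continuous_compact_integrable; first exact: segment_compact.
exact: continuous_subspaceT.
Qed.

Lemma is_derive_primitive (a : R) (f : R -> R) (t : R) : continuous f -> a < t ->
  is_derive t 1 (primitive a f) (f t).
Proof.
move=> cf at_.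
have tt : t < t + 1 by rewrite ltrDl.
have [] := continuous_FTC1_closed tt (continuous_integrable_segment _ _ cf) at_ (cf t).
rewrite -/(primitive a f) derive1E => d e.
exact: (DeriveDef d e).
Qed.

(** A base point [c] strictly below [a] makes the primitive differentiable from both sides at
    [a]. *)
Lemma primitive_integral (c a b : R) (f : R -> R) : continuous f -> c < a -> a <= b ->
  \int[lebesgue_measure]_(s in `[a, b]) f s = primitive c f b - primitive c f a.
Proof.
move=> cf ca; rewrite le_eqVlt => /predU1P[<-|ab].
  by rewrite subrr set_itv1 Rintegral_set1.
have dF t : c < t -> is_derive t 1 (primitive c f) (f t).
  by move=> ct; exact: is_derive_primitive.
have cF t : c < t -> {for t, continuous (primitive c f)}.
  by move=> /dF[d _]; exact/differentiable_continuous/derivable1_diffP.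
rewrite /Rintegral (@continuous_FTC2 _ f (primitive c f)) //.
- exact: continuous_subspaceT.
- split.
  + by move=> x; rewrite in_itv/= => /andP[ax _]; case: (dF x (lt_trans ca ax)).
  + by apply: cvg_at_right_filter; exact: cF.
  + by apply: cvg_at_left_filter; apply: cF; exact: (lt_trans ca).
- move=> x; rewrite in_itv/= => /andP[ax _].
  by rewrite derive1E; case: (dF x (lt_trans ca ax)).
Qed.

Lemma integral_segmentD (a b c : R) (f : R -> R) : continuous f -> a <= b -> b <= c ->
  \int[lebesgue_measure]_(s in `[a, c]) f s =
  \int[lebesgue_measure]_(s in `[a, b]) f s + \int[lebesgue_measure]_(s in `[b, c]) f s.
Proof.
move=> cf ab bc; have h : a - 1 < a by rewrite ltrBlDr ltrDl.
rewrite !(primitive_integral (c := a - 1) cf)//; [ring|exact: (lt_le_trans h)|].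
exact: le_trans bc.
Qed.

Lemma integral_segment_bound (a b : R) (f : R -> R) (v M : R) : continuous f -> a <= b ->
  (forall t, a <= t <= b -> `|f t - v| <= M) ->
  `|\int[lebesgue_measure]_(s in `[a, b]) f s - (b - a) * v| <= M * (b - a).
Proof.
move=> cf ab bf; have h : a - 1 < a by rewrite ltrBlDr ltrDl.
rewrite (primitive_integral (c := a - 1) cf)//.
apply: (@mean_value_closed _ R^o (primitive (a - 1) f) f) => //.
by move=> t /andP[at_ _]; apply: is_derive_primitive => //; exact: (lt_le_trans h).
Qed.

Lemma near_geometric (C e : R) : 0 < e -> exists N, C / 2 ^+ N < e.
Proof.
move=> e0; have [C0|C0] := leP C 0.
  by exists 0%N; rewrite expr0 divr1 (le_lt_trans C0).
have h1 : `|2^-1 : R| < 1 by rewrite gtr0_norm// invf_lt1// ltr1n.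
have := cvg_geometric C h1; move/cvgrPdist_lt => /(_ _ e0)[N _ H]; exists N.
have := H N (leqnn _); rewrite /geometric /= sub0r normrN gtr0_norm ?exprVn//.
by rewrite mulr_gt0// exprn_gt0.
Qed.

(** Banach's theorem for the supremum distance without a space of functions: the iterates converge
    pointwise, the geometric bound makes the convergence uniform, and [I], which will contain
    continuity, is stable under uniform limits. *)
Lemma contraction_fixpoint_uniform (T : Type) (n : nat)
    (I : set (T -> 'cV[R]_n)) (F : (T -> 'cV[R]_n) -> (T -> 'cV[R]_n))
    (y0 : T -> 'cV[R]_n) (C : R) :
  I y0 -> (forall y, I y -> I (F y)) ->
  (forall y z c, I y -> I z -> (forall t, `|y t - z t| <= c) ->
    forall t, `|F y t - F z t| <= c / 2) ->
  (forall t, `|F y0 t - y0 t| <= C) ->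
  (forall y, (forall e : R, 0 < e -> exists2 z, I z & forall t, `|y t - z t| <= e) -> I y) ->
  exists2 y, I y & forall t, F y t = y t.
Proof.
move=> I0 IF Fc FC Icl.
pose y m := iter m F y0.
have Iy m : I (y m) by elim: m => //= m; exact: IF.
have step m t : `|y m.+1 t - y m t| <= C / 2 ^+ m.
  elim: m t => [|m IH] t; first by rewrite expr0 divr1; exact: FC.
  by rewrite exprSr invfM mulrA; apply: (Fc (y m.+1) (y m)).
(* The sum of the geometric steps; the subtracted tail makes the induction on [k] go through. *)
have far m k t : `|y (m + k)%N t - y m t| <= 2 * C / 2 ^+ m - 2 * C / 2 ^+ (m + k).
  elim: k => [|k IH]; first by rewrite addn0 !subrr normr0.
  rewrite addnS; apply: (le_trans (ler_distD (y (m + k)%N t) _ _)).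
  have := lerD (step (m + k)%N t) IH; move=> /le_trans; apply.
  by rewrite exprSr invfM !mulrA; lra.
have C0 (t : T) : 0 <= C by apply: le_trans (FC t).
have far' m k t : (m <= k)%N -> `|y k t - y m t| <= 2 * C / 2 ^+ m.
  move=> /subnKC <-; apply: (le_trans (far _ _ _)); rewrite gerBl.
  by rewrite divr_ge0// ?exprn_ge0// mulr_ge0// (C0 t).
have cy t : cvg (y ^~ t @ \oo).
  apply: cauchy_cvg; apply: cauchy_exP => e e0; have [N HN] := near_geometric (2 * C) e0.
  exists (y N t); exists N => // k /= Nk; rewrite -ball_normE /= distrC.
  by apply: le_lt_trans HN; exact: far'.
pose z t := lim (y ^~ t @ \oo).
have zy m t : `|z t - y m t| <= 2 * C / 2 ^+ m.
  apply/ler_addgt0Pr => e e0.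
  have := cy t; move/cvgrPdist_le => /(_ _ e0)[N _ HN].
  apply: (le_trans (ler_distD (y (maxn N m) t) _ _)); rewrite addrC lerD//.
    by apply: far'; exact: leq_maxr.
  by apply: HN; exact: leq_maxl.
have Iz : I z.
  apply: Icl => e e0; have [N HN] := near_geometric (2 * C) e0.
  by exists (y N) => // t; apply: (le_trans (zy _ _)); exact: ltW.
exists z => // t; apply/eqP; rewrite -subr_eq0 -normr_le0; apply/ler_addgt0Pr => e e0.
have [N HN] := near_geometric (2 * C) e0; rewrite add0r.
apply: (le_trans (ler_distD (y N.+1 t) _ _)); apply: le_trans (ltW HN).
rewrite [leRHS](_ : _ = 2 * C / 2 ^+ N / 2 + 2 * C / 2 ^+ N.+1); last first.
  by rewrite exprSr invfM [X in _ + X]mulrA -splitr.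
by rewrite lerD//; [exact: (Fc z (y N))|rewrite distrC].
Qed.

End Primitives.

(** * Ordinary differential equations *)

Section Clamp.
Context {R : realType}.
Implicit Types a b t s : R.

(** The projection of the line on [[a, b]]: composing with it extends a curve on [[a, b]]
    continuously to the whole line. *)
Definition clamp a b t : R := Num.max a (Num.min b t).

Lemma between_minmax a b p q x : a <= p <= b -> a <= q <= b ->
  Num.min p q <= x <= Num.max p q -> a <= x <= b.
Proof. by case: (leP p q); lra. Qed.

Lemma strictly_between_minmax a b p q x : a <= p <= b -> a <= q <= b ->
  Num.min p q < x < Num.max p q -> a < x < b.
Proof. by case: (leP p q); lra. Qed.

Lemma clampP a b t : a <= b -> a <= clamp a b t <= b.
Proof. by move=> ab; rewrite le_max lexx /= ge_max ab ge_min lexx. Qed.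

Lemma clamp_id a b t : a <= t <= b -> clamp a b t = t.
Proof. by move=> /andP[at_ tb]; rewrite /clamp min_r// max_r. Qed.

Lemma continuous_clamp a b : continuous (clamp a b).
Proof.
move=> t; apply: continuous_max; first exact: cvg_cst.
by apply: continuous_min; [exact: cvg_cst|exact: cvg_id].
Qed.

End Clamp.

Section ODE.
Context {R : realType} {n : nat}.
Local Notation E := 'cV[R]_n.

Definition vprimitive (a : R) (f : R -> E) (t : R) : E :=
  \col_i primitive a (fun s => f s i 0) t.

Lemma is_derive_vprimitive (a : R) (f : R -> E) (t : R) : continuous f -> a < t ->
  is_derive t 1 (vprimitive a f) (f t).
Proof.
move=> cf at_; apply: is_derive_mx => i j; rewrite (ord1 j).
have -> : (fun s => vprimitive a f s i 0) = primitive a (fun s => f s i 0).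
  by apply/funext => s; rewrite mxE.
apply: is_derive_primitive => // s.
by apply: (continuous_comp (g := fun M : E => M i 0) (cf s)); exact: coord_continuous.
Qed.

Variables (U : set (E * R)%type) (X : E * R -> E).

(** No derivative is asked at the endpoints, where the field of a switched system may change. *)
Definition solves (y : R -> E) (u v : R) : Prop :=
  (forall t, u <= t <= v -> {for t, continuous y}) /\
  (forall t, u < t < v -> is_derive t 1 y (X (y t, t))).

(** The outcome of local Picard-Lindelof theory. The existence clause starts at any time [s] of the
    window and reaches all of it, so that solutions can also be run backwards; from the ball of
    radius [r] they stay in the ball of radius [2 r]. The last clause is Lipschitz dependence on the
    value at any one time, with constant 2. *)
Definition ode_box (x0 : E) (t0 r d : R) : Prop :=
  [/\ 0 < r /\ 0 < d,
    (forall x t, `|x - x0| <= 2 * r -> `|t - t0| <= d -> U (x, t)),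
    (exists M, forall x t, `|x - x0| <= 2 * r -> `|t - t0| <= d -> `|X (x, t)| <= M),
    (forall s y0, `|s - t0| <= d -> `|y0 - x0| <= r ->
      exists2 y : R -> E, y s = y0 & forall t, `|t - t0| <= d ->
        `|y t - x0| <= 2 * r /\ is_derive t 1 y (X (y t, t))) &
    (forall y z u v, `|u - t0| <= d -> `|v - t0| <= d -> solves y u v -> solves z u v ->
      (forall t, u <= t <= v -> `|y t - x0| <= 2 * r /\ `|z t - x0| <= 2 * r) ->
      forall s t, u <= s <= v -> u <= t <= v -> `|y t - z t| <= 2 * `|y s - z s|)].

(** Replaces Gronwall's inequality on a short window. If [S] is the maximum of the distance, two
    values of [y - z] differ by at most [K * S * (2 * d) <= S / 2], so [S] is at most [S / 2] plus
    the distance at [s]. *)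
Lemma solves_lipschitz_dist (K r d : R) (x0 : E) (t0 : R) : 0 <= K -> K * d <= 1 / 4 ->
  (forall x y t, `|x - x0| <= 2 * r -> `|y - x0| <= 2 * r -> `|t - t0| <= d ->
     `|X (x, t) - X (y, t)| <= K * `|x - y|) ->
  forall y z u v, `|u - t0| <= d -> `|v - t0| <= d -> solves y u v -> solves z u v ->
    (forall t, u <= t <= v -> `|y t - x0| <= 2 * r /\ `|z t - x0| <= 2 * r) ->
    forall s t, u <= s <= v -> u <= t <= v -> `|y t - z t| <= 2 * `|y s - z s|.
Proof.
move=> K0 Kd lipX y z u v ud vd [cy dy] [cz dz] yzb s t suv tuv.
have uv : u <= v by move/andP: suv => [? ?]; exact: le_trans suv _ || lra.
have td x : u <= x <= v -> `|x - t0| <= d.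
  by move=> xuv; move: ud vd; rewrite !ler_norml; lra.
have cw x : u <= x <= v -> {for x, continuous (fun t => y t - z t)}.
  by move=> xuv; apply: cvgB; [exact: cy|exact: cz].
have [|c] := @EVT_max R (fun t => `|y t - z t|) u v uv.
  apply: continuous_in_subspaceT => x; rewrite inE /= in_itv /= => xuv.
  by apply: (continuous_comp (cw x xuv)); exact: norm_continuous.
rewrite in_itv /= => cuv cmax.
set S := `|y c - z c| in cmax.
have S0 : 0 <= S by exact: normr_ge0.
have maxS x : u <= x <= v -> `|y x - z x| <= S by move=> xuv; apply: cmax; rewrite in_itv.
have half p q : u <= p <= v -> u <= q <= v -> `|(y q - z q) - (y p - z p)| <= S / 2.
  move=> puv quv.
  have pq2 : `|q - p| <= 2 * d.
    by move: (td p puv) (td q quv); rewrite !ler_norml; lra.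
  have pq1 x : Num.min p q <= x <= Num.max p q -> u <= x <= v.
    by move: puv quv; exact: between_minmax.
  have pq3 x : Num.min p q < x < Num.max p q -> u < x < v.
    by move: puv quv; exact: strictly_between_minmax.
  have : `|(y q - z q) - (y p - z p)| <= K * S * `|q - p|.
    apply: (@mean_value_abs _ _ (fun t => y t - z t) (fun t => X (y t, t) - X (z t, t))).
    - by move=> x /pq1; exact: cw.
    - by move=> x /pq3 xuv; apply: is_deriveB; [apply: dy|apply: dz].
    move=> x /pq3 /andP[ux xv]; have xuv : u <= x <= v by lra.
    have [h1 h2] := yzb x xuv.
    apply: (le_trans (lipX _ _ _ h1 h2 (td x xuv))).
    by rewrite ler_wpM2l// maxS.
  move=> /le_trans; apply.
  apply: (@le_trans _ _ (K * S * (2 * d))); first by rewrite ler_wpM2l// mulr_ge0.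
  by nra.
have Sle : S <= 2 * `|y s - z s|.
  have := half s c suv cuv => h.
  have : S <= S / 2 + `|y s - z s|.
    rewrite /S -{1}(subrK (y s - z s) (y c - z c)).
    by apply: (le_trans (ler_normD _ _)); rewrite lerD2r.
  lra.
exact: le_trans (maxS t tuv) Sle.
Qed.

Lemma ode_box_exists (x0 : E) (t0 : R) : open U -> Ck 1 U X -> U (x0, t0) ->
  exists r d, ode_box x0 t0 r d.
Proof.
move=> oU CX Ux0.
have sE : spanned (E * R)%type.
  by apply: spanned_prod; [exact: spanned_cV|exact: spanned_R].
have [K K0 [d1 d10 [inU lip]]] := Ck1_lipschitz sE oU CX Ux0.
pose r := d1 / 4.
pose M := `|X (x0, t0)| + K * d1.
have M0 : 0 <= M by rewrite addr_ge0// mulr_ge0// ltW.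
(* The three bounds keep times inside the Lipschitz neighbourhood, the displacement [M * (2 * d)] at
   most [r], and the contraction factor [K * (2 * d)] at most [1 / 2]. *)
pose d := Num.min (Num.min (d1 / 2) (r / (2 * (M + 1)))) (1 / (4 * K)).
have r0 : 0 < r by rewrite divr_gt0.
have d0 : 0 < d by rewrite !lt_min; apply/andP; split; [apply/andP; split|];
  rewrite divr_gt0// mulr_gt0// ltr_wpDl.
have dd1 : d <= d1 / 2 by rewrite !ge_min lexx.
have Md : M * (2 * d) <= r.
  have : d <= r / (2 * (M + 1)) by rewrite !ge_min lexx orbT.
  rewrite ler_pdivlMr ?mulr_gt0 ?ltr_wpDl//; nra.
have Kd : K * d <= 1 / 4.
  have : d <= 1 / (4 * K) by rewrite !ge_min lexx orbT.
  rewrite ler_pdivlMr ?mulr_gt0//; nra.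
have near0 x t : `|x - x0| <= 2 * r -> `|t - t0| <= d -> `|(x, t) - (x0, t0)| < d1.
  move=> xr td; rewrite prod_normE /= gt_max; apply/andP; split.
    by apply: (le_lt_trans xr); rewrite /r; lra.
  by apply: (le_lt_trans td); apply: (le_lt_trans dd1); lra.
have UX x t : `|x - x0| <= 2 * r -> `|t - t0| <= d -> U (x, t).
  by move=> xr td; apply: inU; exact: near0.
have bX x t : `|x - x0| <= 2 * r -> `|t - t0| <= d -> `|X (x, t)| <= M.
  move=> xr td; rewrite -(subrK (X (x0, t0)) (X (x, t))).
  apply: (le_trans (ler_normD _ _)); rewrite addrC lerD2l.
  have h := near0 _ _ xr td.
  apply: (le_trans (lip _ _ h _)); first by rewrite subrr normr0.
  by apply: ler_wpM2l; exact: ltW.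
have lipX x y t : `|x - x0| <= 2 * r -> `|y - x0| <= 2 * r -> `|t - t0| <= d ->
     `|X (x, t) - X (y, t)| <= K * `|x - y|.
  move=> xr yr td; apply: (le_trans (lip _ _ (near0 _ _ xr td) (near0 _ _ yr td))).
  apply: ler_wpM2l; first exact: ltW.
  rewrite prod_normE /= subrr normr0.
  by rewrite ge_max lexx normr_ge0.
have cX x t : `|x - x0| <= 2 * r -> `|t - t0| <= d -> {for (x, t), continuous X}.
  by move=> xr td; apply: (Ck_continuous CX); exact: UX.
exists r, d; split => //; first by exists M.
  move=> s y0 sd y0r.
  (* Time is clamped so that the Picard operator acts on functions on the whole line; nothing
     changes within distance [d] of [t0]. *)
  pose cl := clamp (t0 - d) (t0 + d).
  have clP t : `|cl t - t0| <= d.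
    have tt : t0 - d <= t0 + d by lra.
    by have := clampP t tt; rewrite -/(cl t) ler_norml; lra.
  have clid t : `|t - t0| <= d -> cl t = t.
    by rewrite ler_norml => td; apply: clamp_id; lra.
  have ccl : continuous cl by exact: continuous_clamp.
  (* Primitives start strictly before the window, so that they are differentiable at all its points;
     subtracting the value at [s] normalises them afterwards. *)
  clearbody cl; pose a := t0 - d - 1.
  have acl t : a < cl t by have := clP t; rewrite /a ler_norml; lra.
  pose f (Y : R -> E) t := X (Y t, cl t).
  pose G (Y : R -> E) t : E := y0 + vprimitive a (f Y) t - vprimitive a (f Y) s.
  pose I (Y : R -> E) := continuous Y /\ forall t, `|Y t - x0| <= 2 * r.
  have cf Y : I Y -> continuous (f Y).
    move=> [cY bY] t; apply: (@continuous_comp _ _ _ (fun t => (Y t, cl t)) X).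
      by apply: continuous_pair; [exact: cY|exact: ccl].
    by apply: cX.
  have dG Y : I Y -> forall t, a < t -> is_derive t 1 (G Y) (f Y t).
    move=> IY t at_; rewrite /G.
    have H : is_derive t 1 (fun t => y0 + vprimitive a (f Y) t - vprimitive a (f Y) s)
       (0 + f Y t - 0).
      apply: is_deriveB; apply: is_deriveD.
      exact: is_derive_vprimitive (cf Y IY) at_.
    by rewrite subr0 add0r in H.
  have acs : a < s by have := acl s; rewrite clid.
  have Gs Y : G Y s = y0 by rewrite /G addrK.
  clearbody G.
  have amin t x : `|t - t0| <= d -> Num.min s t <= x -> a < x.
    move=> td; rewrite ge_min => /orP[|]; first exact: lt_le_trans.
    by apply: lt_le_trans; have := acl t; rewrite clid.
  have ts2 t : `|t - t0| <= d -> `|t - s| <= 2 * d.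
    by move: sd; rewrite !ler_norml; lra.
  have Glip Y Z c : I Y -> I Z -> (forall t, `|f Y t - f Z t| <= c) -> forall t, `|t - t0| <= d ->
      `|G Y t - G Z t| <= c * (2 * d).
    move=> IY IZ fc t td.
    have dd x : a < x -> is_derive x 1 (fun t => G Y t - G Z t) (f Y x - f Z x).
      by move=> ax; apply: is_deriveB; [exact: (dG Y IY)|exact: (dG Z IZ)].
    have := @mean_value_abs R _ (fun t => G Y t - G Z t) (fun t => f Y t - f Z t) c s t.
    rewrite (Gs Y) (Gs Z) subrr subr0 => H; apply: (le_trans (H _ _ _)).
    - by move=> x /andP[/(amin _ _ td) ax _]; exact: is_derive_continuous (dd x ax).
    - by move=> x /andP[/ltW /(amin _ _ td) ax _]; exact: dd.
    - by move=> x _; exact: fc.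
    by rewrite ler_wpM2l ?ts2//; apply: le_trans (fc t).
  pose F (Y : R -> E) t := G Y (cl t).
  have I0 : I (fun=> y0).
    split; first by move=> ?; exact: cvg_cst.
    by move=> _; apply: (le_trans y0r); lra.
  have Gbound Y : I Y -> forall t, `|t - t0| <= d -> `|G Y t - y0| <= r.
    move=> IY t td.
    have := @mean_value_abs R _ (G Y) (f Y) M s t.
    rewrite Gs => H; apply: le_trans Md; apply: (le_trans (H _ _ _)).
    - by move=> x /andP[/(amin _ _ td) ax _]; exact: is_derive_continuous (dG Y IY x ax).
    - by move=> x /andP[/ltW /(amin _ _ td) ax _]; exact: dG.
    - by move=> x _; apply: bX; [exact: IY.2|exact: clP].
    by rewrite ler_wpM2l// ts2.
  have IF Y : I Y -> I (F Y).
    move=> IY; split.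
      move=> t; apply: (@continuous_comp _ _ _ cl (G Y)); first exact: ccl.
      by apply: is_derive_continuous; apply: dG.
    move=> t; rewrite -(subrK y0 (F Y t)) -addrA.
    apply: (le_trans (ler_normD _ _)).
    have := lerD (Gbound Y IY (cl t) (clP t)) y0r => /le_trans; apply; lra.
  have [|||Y IY FY] := @contraction_fixpoint_uniform R R n I F (fun=> y0) r I0 IF.
  - move=> y z c Iy Iz yzc t.
    apply: (le_trans (Glip y z (K * c) Iy Iz _ _ (clP t))).
      move=> x; apply: (le_trans (lipX _ _ _ (Iy.2 x) (Iz.2 x) (clP x))).
      by apply: ler_wpM2l; [exact: ltW|].
    have c0 : 0 <= c by apply: le_trans (yzc t).
    by nra.
  - by move=> t; exact: Gbound.
  - move=> Y HY; split.
      move=> t; apply/cvgrPdist_le => e e0.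
      have e3 : 0 < e / 3 by rewrite divr_gt0.
      have [Z [cZ _] YZ] := HY _ e3.
      have := cZ t; move/cvgrPdist_le => /(_ _ e3); apply: filterS => x Zx.
      have -> : Y t - Y x = (Y t - Z t) + (Z t - Z x) - (Y x - Z x) by zmodule.
      apply: (le_trans (ler_normB _ _)).
      have := ler_normD (Y t - Z t) (Z t - Z x).
      by have := YZ t; have := YZ x; lra.
    move=> t; apply/ler_addgt0Pr => e e0; have [Z [_ bZ] YZ] := HY _ e0.
    rewrite -(subrK (Z t) (Y t)) -addrA addrC; apply: (le_trans (ler_normD _ _)).
    by rewrite addrC lerD// addrC.
  exists (G Y); first exact: Gs.
  move=> t td; have E1 : G Y t = Y t by rewrite -[in LHS](clid t td) -[LHS]/(F Y t) FY.
  split; first by rewrite E1; exact: IY.2.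
  by have := dG Y IY t; rewrite /f E1 (clid t td); apply; have := acl t; rewrite clid.
exact: solves_lipschitz_dist (ltW K0) Kd lipX.
Qed.

End ODE.

(** * Left-invariant vector fields in charts *)

Section LieCharts.
Context {R : realType} {n : nat} {G : GroupTopological.type}.
Variables (A : set (chart R n G)) (hA : is_lie_group A).
Variables (k : chart R n G) (hk : A k) (hk1 : dom k 1%g).
Local Notation E := 'cV[R]_n.
Implicit Types (a b c d : chart R n G) (p q : G) (x y xi eta : E).

Local Notation e := (fwd k 1%g).

Lemma open_dom c : A c -> open (dom c).
Proof. by move=> /(lie_is_chart hA)[]. Qed.

Lemma open_img c : A c -> open (img c).
Proof. by move=> /(lie_is_chart hA)[]. Qed.

Lemma fwdK c p : A c -> dom c p -> bwd c (fwd c p) = p.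
Proof. by move=> /(lie_is_chart hA)[_ _ + _ _]; apply. Qed.

Lemma img_fwd c p : dom c p -> img c (fwd c p).
Proof. by move=> cp; exists p. Qed.

Lemma dom_bwd c x : A c -> img c x -> dom c (bwd c x).
Proof. by move=> hc [p cp <-]; rewrite fwdK. Qed.

Lemma bwdK c x : A c -> img c x -> fwd c (bwd c x) = x.
Proof. by move=> hc [p cp <-]; rewrite fwdK. Qed.

Lemma continuous_fwd c p : A c -> dom c p -> {for p, continuous (fwd c)}.
Proof. by move=> /(lie_is_chart hA)[_ _ _ + _]; apply. Qed.

Lemma continuous_bwd c x : A c -> img c x -> {for x, continuous (bwd c)}.
Proof. by move=> /(lie_is_chart hA)[_ _ _ _ +]; apply. Qed.

Lemma near_dom c p : A c -> dom c p -> \forall q \near p, dom c q.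
Proof. by move=> hc cp; exact: open_nbhs_nbhs (conj (open_dom hc) cp). Qed.

Lemma near_img c x : A c -> img c x -> \forall y \near x, img c y.
Proof. by move=> hc cx; exact: open_nbhs_nbhs (conj (open_img hc) cx). Qed.

Lemma near_dom_bwd c d x : A c -> A d -> img c x -> dom d (bwd c x) ->
  \forall y \near x, dom d (bwd c y).
Proof.
move=> hc hd cx dx; have := continuous_bwd hc cx.
exact: (fun H => H _ (near_dom hd dx)).
Qed.

Lemma continuous_mulg (T : topologicalType) (f g : T -> G) (t : T) :
  {for t, continuous f} -> {for t, continuous g} ->
  {for t, continuous (fun s => (f s * g s)%g)}.
Proof.
move=> cf cg.
apply: (@continuous_comp _ _ _ (fun s => (f s, g s)) (fun pq : G * G => (pq.1 * pq.2)%g)).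
  exact: continuous_pair.
exact: (lie_mul_continuous hA).
Qed.

Definition mul_domain a b c : set (E * E) :=
  [set xy | [/\ img a xy.1, img b xy.2 & dom c (bwd a xy.1 * bwd b xy.2)%g]].

Definition mul_coord a b c (xy : E * E) : E := fwd c (bwd a xy.1 * bwd b xy.2)%g.

Lemma open_mul_domain a b c : A a -> A b -> A c -> open (mul_domain a b c).
Proof.
move=> ha hb hc; rewrite openE => -[x y] [/= ax biy cxy].
have c1 : {for (x, y), continuous (fun xy : E * E => xy.1)} by exact: cvg_fst.
have c2 : {for (x, y), continuous (fun xy : E * E => xy.2)} by exact: cvg_snd.
have b1 : {for (x, y), continuous (fun xy : E * E => bwd a xy.1)}.
  by apply: (continuous_comp c1); exact: continuous_bwd.
have b2 : {for (x, y), continuous (fun xy : E * E => bwd b xy.2)}.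
  by apply: (continuous_comp c2); exact: continuous_bwd.
near=> xy; split.
- by near: xy; apply: c1; exact: near_img.
- by near: xy; apply: c2; exact: near_img.
- by near: xy; apply: (continuous_mulg b1 b2); exact: near_dom.
Unshelve. all: by end_near. Qed.

Lemma Ck_mul_coord a b c j : A a -> A b -> A c ->
  Ck j (mul_domain a b c) (mul_coord a b c).
Proof. by move=> ha hb hc; exact: (lie_mul_smooth hA ha hb hc). Qed.

Lemma open_preimage_continuous (X Y : topologicalType) (f : X -> Y) (O : set Y) :
  continuous f -> open O -> open [set x | O (f x)].
Proof. by move=> /continuousP + oO; exact. Qed.

Lemma continuous_pairl x : continuous (fun y : E => (x, y)).
Proof. by move=> y; apply: (continuous_pair (f := cst x)); [exact: cst_continuous|exact: cvg_id]. Qed.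

Lemma continuous_pairr y : continuous (fun x : E => (x, y)).
Proof. by move=> x; apply: (continuous_pair (g := cst y)); [exact: cvg_id|exact: cst_continuous]. Qed.

Lemma pairl_affine x (h : R) y u : (x, h *: u + y) = h *: ((0 : E), u) + (x, y).
Proof. by rewrite -[RHS]/(h *: 0 + x, h *: u + y) scaler0 add0r. Qed.

Lemma pairr_affine y (h : R) x u : (h *: u + x, y) = h *: (u, (0 : E)) + (x, y).
Proof. by rewrite -[RHS]/(h *: u + x, h *: 0 + y) scaler0 add0r. Qed.

Definition translate b c p (y : E) : E := fwd c (p * bwd b y)%g.

Definition translate_domain b c p : set E :=
  [set y | img b y /\ dom c (p * bwd b y)%g].

Lemma open_translate_domain b c p : A b -> A c -> open (translate_domain b c p).
Proof.
move=> hb hc; have [a ha ap] := lie_cover hA p.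
have -> : translate_domain b c p = [set y | mul_domain a b c (fwd a p, y)].
  by apply/seteqP; split => y; rewrite /mul_domain /= fwdK//;
    [move=> [? ?]; split => //; exact: img_fwd|move=> []].
by apply: open_preimage_continuous; [exact: continuous_pairl|exact: open_mul_domain].
Qed.

(** A slice of the smooth multiplication, the first factor being held at the coordinates of [p]. *)
Lemma Ck_translate b c p j : A b -> A c -> Ck j (translate_domain b c p) (translate b c p).
Proof.
move=> hb hc; have [a ha ap] := lie_cover hA p.
have -> : translate_domain b c p = [set y | mul_domain a b c (fwd a p, y)].
  by apply/seteqP; split => y; rewrite /mul_domain /= fwdK//;
    [move=> [? ?]; split => //; exact: img_fwd|move=> []].
have -> : translate b c p = fun y => mul_coord a b c (fwd a p, y).
  by apply/funext => y; rewrite /mul_coord /= fwdK.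
apply: (Ck_affine (A := fun u => (0, u))).
- by move=> h y u; exact: pairl_affine.
- exact: continuous_pairl.
- exact: Ck_mul_coord.
Qed.

Lemma translate_domain_base c p : dom c p -> translate_domain k c p e.
Proof. by move=> cp; split; [exact: img_fwd|rewrite fwdK// mulg1]. Qed.

Lemma translate_base c p : translate k c p e = fwd c p.
Proof. by rewrite /translate fwdK// mulg1. Qed.

Lemma differentiable_translate b c p y : A b -> A c -> translate_domain b c p y ->
  differentiable (translate b c p) y.
Proof.
move=> hb hc; apply: (Ck1_differentiable (spanned_cV _)).
  exact: open_translate_domain.
exact: Ck_translate.
Qed.

Lemma differentiable_matrix (f : E -> E) x xi : differentiable f x ->
  'D_xi f x = matrix_of (fun v => 'D_v f x) *m xi.
Proof.
move=> df; rewrite deriveE// {1}(matrix_sum_delta xi).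
apply/matrixP => i j; rewrite (ord1 j) mxE linear_sum summxE; apply: eq_bigr => l _.
by rewrite big_ord1 linearZ/= !mxE mulrC deriveE.
Qed.

(** The frame at [p]: its columns are the values of the left-invariant fields of the basis vectors,
    in the coordinates of [c]. *)
Definition left_matrix c p : 'M[R]_n := matrix_of (left_translate k c p).

Lemma left_translate_derive c p xi :
  left_translate k c p xi = 'D_xi (translate k c p) e.
Proof. by []. Qed.

Lemma left_translateE c p xi : A c -> dom c p ->
  left_translate k c p xi = left_matrix c p *m xi.
Proof.
move=> hc cp; apply: differentiable_matrix.
by apply: differentiable_translate => //; exact: translate_domain_base.
Qed.

(** [left_field] in the coordinates of a chart that may differ from [k]. *)
Definition left_vf c xi x : E := left_translate k c (bwd c x) xi.

Lemma mul_domain_base c x : A c -> img c x -> mul_domain c k c (x, e).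
Proof.
move=> hc cx; split => //=; first exact: img_fwd.
by rewrite fwdK// mulg1; exact: dom_bwd.
Qed.

(** The field at [x] is a partial derivative of the multiplication: that of [mul_coord] at [(x, e)]
    in the direction [(0, xi)]. *)
Lemma Ck_left_vf c xi j : A c -> Ck j (img c) (left_vf c xi).
Proof.
move=> hc.
have -> : left_vf c xi = fun x => 'D_((0 : E), xi) (mul_coord c k c) (x, e).
  apply/funext => x; rewrite /left_vf /left_translate.
  have := (derive_affine (mul_coord c k c) (p := fun y => (x, y))
    (A := fun u => ((0 : E), u)) e xi _).2.
  by apply => h y u; exact: pairl_affine.
apply: (Ck_subset (U := [set x | mul_domain c k c (x, e)])).
  by move=> x cx; exact: mul_domain_base.
apply: (Ck_affine (f := fun xy => 'D_((0 : E), xi) (mul_coord c k c) xy) (A := fun u => (u, 0))).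
- by move=> h y u; exact: pairr_affine.
- exact: continuous_pairr.
- by apply: Ck_derive; exact: Ck_mul_coord.
Qed.

Definition transition c d x : E := fwd d (bwd c x).

Lemma differentiable_transition c d x : A c -> A d -> img c x -> dom d (bwd c x) ->
  differentiable (transition c d) x.
Proof.
move=> hc hd cx dx.
have o : open [set x | img c x /\ dom d (bwd c x)].
  rewrite openE => y [cy dy]; near=> z; split; near: z; first exact: near_img.
  exact: near_dom_bwd.
exact: (Ck1_differentiable (spanned_cV _) o ((lie_compatible hA hc hd).1 1%N) (conj cx dx)).
Unshelve. all: by end_near. Qed.

Lemma left_translate_transition c d p xi : A c -> A d -> dom c p -> dom d p ->
  left_translate k d p xi =
    'D_(left_translate k c p xi) (transition c d) (fwd c p).
Proof.
move=> hc hd cp dp.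
have dc := differentiable_translate hk hc (translate_domain_base cp).
have tb : translate k c p e = fwd c p by exact: translate_base.
have dt : differentiable (transition c d) (translate k c p e).
  by rewrite tb; apply: differentiable_transition; rewrite ?fwdK//; exact: img_fwd.
have := derive_comp xi dc dt; rewrite tb => <-.
apply: near_eq_derive; near=> y.
have [_ cy] : translate_domain k c p y.
  near: y; apply: open_nbhs_nbhs; split; first exact: open_translate_domain.
  exact: translate_domain_base.
by rewrite /transition /= /translate fwdK.
Unshelve. all: by end_near. Qed.

(** Velocities and left translates both transform by the derivative of the transition map, so one
    chart suffices. *)
Lemma velocity_of_chart c (gamma : R -> G) (t : R) xi : A c -> dom c (gamma t) ->
  {for t, continuous gamma} ->
  is_derive t 1 (fun s => fwd c (gamma s)) (left_translate k c (gamma t) xi) ->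
  has_left_velocity A k gamma t xi.
Proof.
move=> hc ct cg dg; split; first exact: cg.
move=> d hd dt.
rewrite (left_translate_transition xi hc hd ct dt).
have := @is_derive_comp_curve _ _ _ (transition c d) _ _ _ dg.
have df : differentiable (transition c d) (fwd c (gamma t)).
  by apply: differentiable_transition; rewrite ?fwdK//; exact: img_fwd.
move=> /(_ df); apply: near_eq_is_derive.
near=> s; rewrite /transition fwdK//; near: s; apply: cg; exact: near_dom.
Unshelve. all: by end_near. Qed.

Lemma near_translate_domain b c p y : A b -> A c -> translate_domain b c p y ->
  \forall z \near y, translate_domain b c p z.
Proof.
move=> hb hc h; have o := open_translate_domain (p := p) hb hc.
by apply: open_nbhs_nbhs; split.
Qed.

Lemma derive_id_near (f : E -> E) x xi : (\near x, f x = x) -> 'D_xi f x = xi.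
Proof. by move=> fx; rewrite (near_eq_derive xi fx) -[RHS](derive_id x xi). Qed.

Lemma left_translate_one xi : left_translate k k 1%g xi = xi.
Proof.
apply: derive_id_near; near=> y; rewrite mul1g bwdK//.
by near: y; apply: near_img => //; exact: img_fwd.
Unshelve. all: by end_near. Qed.

Lemma left_vf_one xi : left_vf k xi e = xi.
Proof. by rewrite /left_vf fwdK// left_translate_one. Qed.

Lemma matrix_of_id (M : 'M[R]_n) : (forall v : E, M *m v = v) -> M = 1%:M.
Proof.
move=> H; apply/matrixP => i j.
have /matrixP/(_ i 0) := H (delta_mx j 0).
by rewrite -colE !mxE eqxx andbT => ->.
Qed.

(** The inverse is the derivative of the translation by [p^-1], since the two translations compose
    to the identity near [e]. *)
Lemma left_matrix_unit c p : A c -> dom c p -> left_matrix c p \in unitmx.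
Proof.
move=> hc cp.
have tk := translate_domain_base cp.
have tc : translate_domain c k p^-1%g (translate k c p e).
  rewrite translate_base; split; first exact: img_fwd.
  by rewrite fwdK// mulVg.
pose N := matrix_of (fun v => 'D_v (translate c k p^-1%g) (translate k c p e)).
have NM : N *m left_matrix c p = 1%:M.
  apply: matrix_of_id => v; rewrite -mulmxA -left_translateE//.
  rewrite -differentiable_matrix; last exact: differentiable_translate.
  have dk := differentiable_translate hk hc tk.
  have := derive_comp v dk (differentiable_translate hc hk tc) => <-.
  apply: derive_id_near; near=> y.
  have [ky cy] : translate_domain k c p y by near: y; exact: near_translate_domain.
  by rewrite /= {1}/translate /translate fwdK// mulKg bwdK.
by case/mulmx1_unit : NM.
Unshelve. all: by end_near. Qed.

(** Left invariance of the field, from associativity: translating by [bwd k y] and then by [p] is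
    translating by their product. *)
Lemma left_vf_translate c p eta : A c -> dom c p ->
  \forall y \near e, left_vf c eta (translate k c p y) =
    'D_(left_vf k eta y) (translate k c p) y.
Proof.
move=> hc cp; near=> y.
have [ky cy] : translate_domain k c p y.
  by near: y; apply: near_translate_domain => //; exact: translate_domain_base.
have tb : translate k k (bwd k y) e = y by rewrite translate_base// bwdK.
have kdy : dom k (bwd k y) by exact: dom_bwd.
have d1 : differentiable (translate k k (bwd k y)) e.
  by apply: differentiable_translate => //; exact: translate_domain_base.
have d2 : differentiable (translate k c p) (translate k k (bwd k y) e).
  by rewrite tb; exact: differentiable_translate.
have := derive_comp eta d1 d2; rewrite tb => <-.
apply: near_eq_derive; near=> z.
have [kz kyz] : translate_domain k k (bwd k y) z.
  by near: z; apply: near_translate_domain => //; exact: translate_domain_base.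
by rewrite /= /translate fwdK// fwdK// mulgA.
Unshelve. all: by end_near. Qed.

Lemma differentiable_left_vf c xi x : A c -> img c x -> differentiable (left_vf c xi) x.
Proof.
move=> hc; apply: (Ck1_differentiable (spanned_cV _) (open_img hc)).
exact: Ck_left_vf.
Qed.

(** The invariance identity is differentiated at [e] along [xi]. On its right-hand side the base
    point and the direction both vary with [y], which gives the two terms. *)
Lemma derive_left_vf_translate c p xi eta : A c -> dom c p ->
  'D_(left_vf c xi (fwd c p)) (left_vf c eta) (fwd c p) =
  'D_xi (fun y => 'D_eta (translate k c p) y) e +
  'D_('D_xi (left_vf k eta) e) (translate k c p) e.
Proof.
move=> hc cp.
have tb : translate k c p e = fwd c p by exact: translate_base.
have tk := translate_domain_base cp.
have otk := open_translate_domain (p := p) hk hc.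
have Cphi j := Ck_translate p j hk hc.
have ke : img k e by exact: img_fwd.
have xiE : left_vf c xi (fwd c p) = 'D_xi (translate k c p) e by rewrite /left_vf fwdK.
have dphi := differentiable_translate hk hc tk.
have dvf : differentiable (left_vf c eta) (translate k c p e).
  by rewrite tb; exact: differentiable_left_vf hc (img_fwd cp).
have := derive_comp xi dphi dvf; rewrite xiE tb => <-.
(* The varying direction is expanded in the basis, so that the product rule applies to its
   coordinates. *)
have cols (v : E) : v = \sum_j v j 0 *: (delta_mx j 0 : E).
  by rewrite [LHS]matrix_sum_delta; apply: eq_bigr => i _; rewrite big_ord1.
have Ephi v y : translate_domain k c p y ->
    'D_v (translate k c p) y = \sum_j v j 0 *: 'D_(delta_mx j 0) (translate k c p) y.
  by move=> ty; rewrite [X in 'D_X _ _](cols v) (derive_frame _ _ otk (Cphi 1%N) ty).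
have -> : 'D_xi (left_vf c eta \o translate k c p) e =
    'D_xi (fun y => \sum_j left_vf k eta y j 0 *: 'D_(delta_mx j 0) (translate k c p) y) e.
  apply: near_eq_derive; near=> y; rewrite -Ephi.
    by near: y; exact: left_vf_translate.
  by near: y; exact: near_translate_domain.
have d1 j : is_derive e xi (fun y => left_vf k eta y j 0) ('D_xi (left_vf k eta) e j 0).
  apply: is_derive_coord; apply: derivableP; apply: diff_derivable.
  exact: differentiable_left_vf.
have d2 v : is_derive e xi (fun y => 'D_v (translate k c p) y)
    ('D_xi (fun y => 'D_v (translate k c p) y) e).
  by apply: derivableP; exact: (Ck_derivable (Ck_derive v (Cphi 2%N)) tk).
have ds : is_derive e xi
    (fun y => \sum_j left_vf k eta y j 0 *: 'D_(delta_mx j 0) (translate k c p) y)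
    (\sum_j (left_vf k eta e j 0 *: 'D_xi (fun y => 'D_(delta_mx j 0) (translate k c p) y) e
      + 'D_xi (left_vf k eta) e j 0 *: 'D_(delta_mx j 0) (translate k c p) e)).
  have := is_derive_sum (fun j => is_derive_scale (d1 j) (d2 (delta_mx j 0))).
  by rewrite fct_sumE.
have ds2 : is_derive e xi
    (fun y => \sum_j eta j 0 *: 'D_(delta_mx j 0) (translate k c p) y)
    (\sum_j eta j 0 *: 'D_xi (fun y => 'D_(delta_mx j 0) (translate k c p) y) e).
  have := is_derive_sum (fun j => is_deriveZ (eta j 0) (d2 (delta_mx j 0))).
  by rewrite fct_sumE.
have [_ E1] := ds; have [_ E2] := ds2; rewrite E1 big_split /=.
have S2 := Ephi ('D_xi (left_vf k eta) e) e tk.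
have S1 : \sum_j left_vf k eta e j 0 *: 'D_xi (fun y => 'D_(delta_mx j 0) (translate k c p) y) e
    = 'D_xi (fun y => 'D_eta (translate k c p) y) e.
  rewrite left_vf_one -E2; apply: near_eq_derive; near=> y.
  by apply/esym/Ephi; near: y; exact: near_translate_domain.
exact: (congr2 +%R S1 (esym S2)).
Unshelve. all: by end_near. Qed.

Lemma adE xi eta : ad k xi eta = 'D_xi (left_vf k eta) e - 'D_eta (left_vf k xi) e.
Proof.
rewrite /ad /vf_bracket -[left_field k xi]/(left_vf k xi).
by rewrite -[left_field k eta]/(left_vf k eta) !left_vf_one.
Qed.

(* Both iterated derivatives of the left fields contain the second derivative
   of the translation by p, which is symmetric and cancels in the bracket. *)
Lemma left_vf_bracket c p xi eta : A c -> dom c p ->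
  'D_(left_vf c xi (fwd c p)) (left_vf c eta) (fwd c p) -
  'D_(left_vf c eta (fwd c p)) (left_vf c xi) (fwd c p) =
  left_translate k c p (ad k xi eta).
Proof.
move=> hc cp.
have tk := translate_domain_base cp.
have otk : open (translate_domain k c p) := open_translate_domain hk hc.
have symm := Ck2_schwarz xi eta otk (Ck_translate p 2 hk hc) tk.
have H1 := derive_left_vf_translate xi eta hc cp.
have H2 := derive_left_vf_translate eta xi hc cp.
have cancel (S S' a b r : E) : S = S' -> r = a - b -> (S' + a) - (S + b) = r.
  by move=> -> ->; zmodule.
apply: (etrans (congr2 +%R H1 (congr1 -%R H2))); apply: (cancel _ _ _ _ _ symm).
have lt_sub v w : left_translate k c p (v - w) = left_translate k c p v - left_translate k c p w.
  by rewrite !(left_translateE _ hc cp) mulmxBr.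
rewrite adE lt_sub.
exact: (congr2 +%R (left_translate_derive c p _) (congr1 -%R (left_translate_derive c p _))).
Qed.

Lemma ad_linear (r : R) xi eta eta' :
  ad k xi (r *: eta + eta') = r *: ad k xi eta + ad k xi eta'.
Proof.
have ke : img k e by exact: img_fwd.
have d v w : is_derive e v (left_vf k w) ('D_v (left_vf k w) e).
  by apply: derivableP; apply: diff_derivable; exact: differentiable_left_vf.
have E1 : 'D_xi (left_vf k (r *: eta + eta')) e =
    r *: 'D_xi (left_vf k eta) e + 'D_xi (left_vf k eta') e.
  have [_ <-] := is_deriveD (is_deriveZ r (d xi eta)) (d xi eta').
  apply: near_eq_derive; near=> y.
  have ky : dom k (bwd k y) by apply: dom_bwd => //; near: y; exact: near_img.
  rewrite /left_vf (left_translateE _ hk ky) mulmxDr -scalemxAr.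
  by rewrite -(left_translateE eta hk ky) -(left_translateE eta' hk ky).
have E2 : 'D_(r *: eta + eta') (left_vf k xi) e =
    r *: 'D_eta (left_vf k xi) e + 'D_eta' (left_vf k xi) e.
  apply: (etrans (derive_add _ _ (open_img hk) (Ck_left_vf xi 1 hk) ke)).
  have [dd _] := d eta xi; have [_ E3] := is_derive_scaledir r dd.
  exact: (congr1 (+%R^~ _) E3).
have lin (a a' b b' : E) : (r *: a + a') - (r *: b + b') = r *: (a - b) + (a' - b').
  by rewrite scalerBr; zmodule.
rewrite (adE xi eta) (adE xi eta') (adE xi (_ + _)).
by apply: (etrans (congr2 +%R E1 (congr1 -%R E2))); exact: lin.
Unshelve. all: by end_near. Qed.

Variables (Ex : E -> G) (hEx : is_exponential A k Ex).

Lemma is_derive_exp_curve c p eta : A c -> dom c p ->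
  is_derive (0 : R) 1 (fun s : R => fwd c (p * Ex (s *: eta))%g) (left_translate k c p eta).
Proof.
move=> hc cp; have [Ex0 /(_ eta 0)[cE /(_ k hk)]] := hEx.
have E0 : Ex (0 *: eta) = 1%g by rewrite scale0r Ex0.
rewrite E0 left_translate_one => /(_ hk1) dE.
have tk := translate_domain_base cp.
have := is_derive_comp_curve (f := translate k c p) dE.
rewrite E0 => /(_ (differentiable_translate hk hc tk)).
apply: near_eq_is_derive; near=> s.
rewrite /translate fwdK//; near: s; apply: cE.
by rewrite -[nbhs _]/(nbhs (Ex (0 *: eta))) E0; exact: near_dom.
Unshelve. all: by end_near. Qed.

(** The curve [p exp(s eta)] has velocity [p eta] at [s = 0]; from here on the exponential is
    replaced by this tangent vector. *)
Lemma DgE (V : normedModType R) (F : G -> V) c p eta : A c -> dom c p ->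
  differentiable (fun x => F (bwd c x)) (fwd c p) ->
  Dg Ex F p eta = 'D_(left_translate k c p eta) (fun x => F (bwd c x)) (fwd c p).
Proof.
move=> hc cp dF; have d := is_derive_exp_curve eta hc cp.
have pE : (p * Ex (0 *: eta))%g = p by rewrite scale0r hEx.1 mulg1.
have dF' : differentiable (fun x => F (bwd c x)) (fwd c (p * Ex (0 *: eta))%g) by rewrite pE.
have [_] := is_derive_comp_curve (f := fun x => F (bwd c x)) d dF'.
rewrite pE => <-.
have [cE _] := hEx.2 eta 0.
have cp' : {for (0 : R), continuous (fun s : R => (p * Ex (s *: eta))%g)}.
  by apply: continuous_mulg => //; exact: cst_continuous.
apply: near_eq_derive; near=> s; rewrite fwdK//.
near: s; apply: cp'; rewrite /= pE; exact: near_dom.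
Unshelve. all: by end_near. Qed.

End LieCharts.

(** * Flows of piecewise continuous fields *)

(** The mean value inequality on either side of [t], comparing the derivative with its limit [l]. It
    supplies the derivative at the junction of two glued solutions. *)
Lemma is_derive_removable {R : realType} (W : normedModType R) (f f' : R -> W) (t : R) (l : W) :
  {for t, continuous f} ->
  (forall e : R, 0 < e -> exists2 d : R, 0 < d & forall s, `|s - t| < d -> s != t ->
     is_derive s 1 f (f' s) /\ `|f' s - l| <= e) ->
  is_derive t 1 f l.
Proof.
move=> cf H.
suff Hl : h^-1 *: (f (h *: 1 + t) - f t) @[h --> 0^'] --> l.
  apply: DeriveDef; first by apply/cvg_ex; exists l.
  exact/cvg_lim.
apply/cvgrPdist_le => e e0; have [d d0 Hd] := H e e0.
apply/nbhs_ballP; exists d => //= h; rewrite /ball /= sub0r normrN => hd h0.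
rewrite [h *: 1]mulr1.
have key a b : a <= b -> (a = t \/ b = t) -> b - a < d ->
    `|f b - f a - (b - a) *: l| <= e * (b - a).
  move=> ab abt bad.
  have D s : a <= s <= b -> s != t -> is_derive s 1 f (f' s) /\ `|f' s - l| <= e.
    move=> sab st; apply: Hd => //.
    by rewrite ltr_norml; case: abt => <-; lra.
  have D' s : a < s < b -> is_derive s 1 f (f' s) /\ `|f' s - l| <= e.
    move=> sab; apply: D; first by lra.
    by case: abt => <-; [rewrite gt_eqF|rewrite lt_eqF] => //; lra.
  apply: (@mean_value _ _ f f') => //.
  - move=> s sab; have [->//|st] := eqVneq s t.
    exact: is_derive_continuous (D s sab st).1.
  - by move=> s /D'[].
  - by move=> s /D'[].
have -> : l - h^-1 *: (f (h + t) - f t) = - (h^-1 *: (f (h + t) - f t - h *: l)).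
  by rewrite !scalerBr scalerA mulVf// scale1r; zmodule.
rewrite normrN normrZ normfV ler_pdivrMl ?normr_gt0// mulrC.
have [hp|hn] := ltP 0 h.
  have := @key t (h + t); rewrite addrK (gtr0_norm hp); apply; [lra|by left|].
  by move: hd; rewrite gtr0_norm.
have := @key (h + t) t; rewrite opprD addrCA subrr addr0.
have -> : f t - f (h + t) - - h *: l = - (f (h + t) - f t - h *: l).
  by rewrite scaleNr; zmodule.
rewrite normrN (ler0_norm hn); apply; [lra|by right|].
by move: hd; rewrite ler0_norm.
Qed.

Lemma near_between {R : realType} (a b t : R) : a < t < b -> \forall s \near t, a < s < b.
Proof.
move=> /andP[at_ tb]; near=> s; apply/andP; split; near: s.
  exact: lt_nbhsr.
exact: lt_nbhsl.
Unshelve. all: by end_near. Qed.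

Section PiecewiseFlows.
Context {R : realType} {n : nat} {G : GroupTopological.type}.
Variables (A : set (chart R n G)) (hA : is_lie_group A).
Variables (k : chart R n G) (hk : A k) (hk1 : dom k 1%g).
Local Notation E := 'cV[R]_n.
Implicit Types (c : chart R n G) (h : R -> G) (w m : G -> R -> E) (S : set R).

Definition cylinder c : set (E * R) := [set xt | img c xt.1].

Lemma open_cylinder c : A c -> open (cylinder c).
Proof.
move=> hc; apply: (open_preimage_continuous (f := fun xt : E * R => xt.1)).
  by move=> xt; exact: cvg_fst.
exact: (open_img hA hc).
Qed.

Definition chart_vf c (H : E * R -> E) (xt : E * R) : E :=
  left_matrix k c (bwd c xt.1) *m H xt.

Lemma Ck_chart_vf c H : A c -> Ck 1 (cylinder c) H -> Ck 1 (cylinder c) (chart_vf c H).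
Proof.
move=> hc CH; have oc := open_cylinder hc.
apply: (Ck_eq (f := fun xt => \sum_j H xt j 0 *: left_vf k c (delta_mx j 0) xt.1) oc).
  move=> [x t] /= cx; rewrite /chart_vf /= [in RHS](matrix_sum_delta (H (x, t))) mulmx_sumr.
  apply: eq_bigr => j _; rewrite big_ord1 -scalemxAr; congr (_ *: _).
  by rewrite /left_vf (left_translateE hA hk hk1)//; exact: (dom_bwd hA).
apply: (Ck_sum oc) => j; apply: (Ck_scale oc); first exact: (Ck_coord _ _ oc CH).
apply: (Ck_affine (U := img c) (f := left_vf k c (delta_mx j 0))
    (p := fun xt : E * R => xt.1) (A := fun xt => xt.1)).
- by [].
- by move=> xt; exact: cvg_fst.
- exact: (Ck_left_vf hA hk hk1 _ 1 hc).
Qed.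

(** [H] extends the mode to negative times, so that the field is C1 on an open set of space-time
    even around time 0. *)
Definition represents c (H : E * R -> E) m : Prop :=
  Ck 1 (cylinder c) H /\ forall x t, img c x -> 0 <= t -> H (x, t) = m (bwd c x) t.

Lemma chart_vfE c H m p t : A c -> represents c H m -> dom c p -> 0 <= t ->
  chart_vf c H (fwd c p, t) = left_translate k c p (m p t).
Proof.
move=> hc [_ HE] cp t0; rewrite (left_translateE hA hk hk1)// /chart_vf /=.
by rewrite HE// ?(fwdK hA)//; exact: img_fwd.
Qed.

(* h is continuous on all of R, so that running costs are integrable without
   side conditions; curves on [u, v] are extended by [clamp]. *)
Definition sol w S (u v : R) h : Prop :=
  continuous h /\
  (forall t, u < t < v -> ~ S t -> has_left_velocity A k h t (w (h t) t)).

Definition mode_on w S (u v : R) m : Prop :=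
  C1_time A m /\ forall t, u < t < v -> ~ S t /\ (forall p, w p t = m p t).

(** Across a time outside [S] one mode must be active on both sides, because solutions are
    differentiable there; the value of [w] at a time in [S] is left free. *)
Definition piecewise w S : Prop := forall t, exists2 d, 0 < d &
  [/\ exists m, mode_on w S (t - d) t m,
      exists m, mode_on w S t (t + d) m &
      ~ S t -> exists m, mode_on w S (t - d) (t + d) m].

Lemma mode_on_sub w S u v u' v' m : u <= u' -> v' <= v ->
  mode_on w S u v m -> mode_on w S u' v' m.
Proof. by move=> uu vv [Cm mE]; split => // t tuv; apply: mE; lra. Qed.

Lemma sol_sub w S u v u' v' h : u <= u' -> v' <= v -> sol w S u v h -> sol w S u' v' h.
Proof. by move=> uu vv [ch dh]; split=> [|t tuv]; [exact: ch|apply: dh; lra]. Qed.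

Lemma sol_ext w S w' S' u v h :
  (forall t, u < t < v -> ~ S' t -> ~ S t /\ forall p, w p t = w' p t) ->
  sol w S u v h -> sol w' S' u v h.
Proof.
move=> ww [ch dh]; split=> [|t tuv S't]; first exact: ch.
have [nS <-] := ww t tuv S't.
exact: dh.
Qed.

Lemma near_eq_velocity h h' (t : R) xi : (\forall s \near t, h s = h' s) ->
  has_left_velocity A k h t xi -> has_left_velocity A k h' t xi.
Proof.
move=> hh [ch dh]; have ht := nbhs_singleton hh; split.
  exact: near_eq_continuous hh ch.
move=> c hc; rewrite -ht => ct; have := dh c hc ct; apply: near_eq_is_derive.
by apply: filterS hh => s ->.
Qed.

Lemma sol_eq w S u v h h' : continuous h' -> (forall t, u < t < v -> h t = h' t) ->
  sol w S u v h -> sol w S u v h'.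
Proof.
move=> ch' hh [ch dh]; split=> [|t tuv St]; first exact: ch'.
rewrite -(hh t tuv); apply: near_eq_velocity (dh t tuv St).
by apply: filterS (near_between tuv) => s; exact: hh.
Qed.

Lemma sol_chart c H w S m u v h : A c -> represents c H m -> mode_on w S u v m ->
  0 <= u -> (forall t, u <= t <= v -> dom c (h t)) -> sol w S u v h ->
  solves (chart_vf c H) (fun t => fwd c (h t)) u v.
Proof.
move=> hc HE [Cm mE] u0 ch [coh dh]; split=> t tuv.
  by apply: (continuous_comp (coh t)); apply: (continuous_fwd hA) => //; exact: ch.
have [nS wE] := mE t tuv.
have ct : dom c (h t) by apply: ch; lra.
have t0 : 0 <= t by lra.
rewrite (chart_vfE hc HE ct t0).
by rewrite -wE; have [_] := dh t tuv nS; apply.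
Qed.

Lemma chart_sol c H w S m u v (y : R -> E) : A c -> represents c H m ->
  mode_on w S u v m -> 0 <= u -> u <= v -> (forall t, u <= t <= v -> img c (y t)) ->
  solves (chart_vf c H) y u v -> sol w S u v (fun t => bwd c (y (clamp u v t))).
Proof.
move=> hc HE [Cm mE] u0 uv cy [coy dy]; split.
  move=> t; have tt := clampP t uv.
  have cc : {for t, continuous (fun t => y (clamp u v t))}.
    by apply: (continuous_comp (f := clamp u v) (g := y)); [exact: continuous_clamp|exact: coy].
  by apply: (continuous_comp cc); apply: (continuous_bwd hA) => //; exact: cy.
move=> t tuv nS; have tuv' : u <= t <= v by lra.
have [_ wE] := mE t tuv.
have ct := cy t tuv'; have dt : dom c (bwd c (y t)) by exact: (dom_bwd hA).
apply: (@near_eq_velocity (fun t => bwd c (y t))).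
  by apply: filterS (near_between tuv) => s suv; rewrite clamp_id//; lra.
have cby : {for t, continuous (fun t => bwd c (y t))}.
  by apply: (continuous_comp (coy t tuv')); exact: (continuous_bwd hA).
rewrite (clamp_id tuv') wE; apply: (velocity_of_chart hA hk hk1 hc dt cby).
have t0 : 0 <= t by lra.
rewrite -(chart_vfE hc HE dt t0) (bwdK hA hc ct); apply: near_eq_is_derive (dy t tuv).
apply: filterS (near_between tuv) => s suv.
by rewrite (bwdK hA)//; apply: cy; lra.
Qed.

Definition splice (v : R) h h' : R -> G := fun t => if t <= v then h t else h' t.

Lemma continuous_splice v h h' : continuous h -> continuous h' -> h v = h' v ->
  continuous (splice v h h').
Proof.
move=> ch ch' hh t; have [tv|vt|->] := ltgtP t v.
- apply: near_eq_continuous (ch t); near=> s.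
  by rewrite /splice ifT//; apply: ltW; near: s; exact: lt_nbhsl.
- apply: near_eq_continuous (ch' t); near=> s.
  by rewrite /splice leNgt ifF//; apply/negbF; near: s; exact: lt_nbhsr.
- have gv : splice v h h' v = h v by rewrite /splice lexx.
  move=> U; rewrite gv => Uv; have U1 := ch v U Uv.
  have U2 : nbhs (h' v) U by rewrite -hh.
  have {}U2 := ch' v U U2.
  change (\forall s \near v, U (splice v h h' s)).
  by near=> s; rewrite /splice; case: (s <= v); near: s.
Unshelve. all: by end_near. Qed.

Lemma spliceL v h h' t : t <= v -> splice v h h' t = h t.
Proof. by rewrite /splice => ->. Qed.

Lemma spliceR v h h' t : h v = h' v -> v <= t -> splice v h h' t = h' t.
Proof. by rewrite /splice => hh vt; case: ifP => // tv; have <- : v = t by lra. Qed.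

(** Only the junction is in question. If it is not a switching time, both pieces obey the same
    continuous field around it, and the derivative exists there as a limit of nearby derivatives. *)
Lemma sol_splice w S u v z h h' : piecewise w S -> 0 <= u -> u <= v -> v <= z -> h v = h' v ->
  sol w S u v h -> sol w S v z h' -> sol w S u z (splice v h h').
Proof.
move=> pw u0 uv vz hh [ch dh] [ch' dh'].
have cg : continuous (splice v h h') by exact: continuous_splice.
split=> [|t tuz nS]; first exact: cg.
have dleft s : u < s < v -> ~ S s -> has_left_velocity A k (splice v h h') s (w (splice v h h' s) s).
  move=> suv nSs; rewrite spliceL; last by lra.
  apply: near_eq_velocity (dh s suv nSs).
  by apply: filterS (near_between suv) => x xuv; rewrite spliceL//; lra.
have dright s : v < s < z -> ~ S s -> has_left_velocity A k (splice v h h') s (w (splice v h h' s) s).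
  move=> svz nSs; rewrite spliceR//; last by lra.
  apply: near_eq_velocity (dh' s svz nSs).
  by apply: filterS (near_between svz) => x xvz; rewrite spliceR//; lra.
have [tv|vt|tv] := ltgtP t v; first by apply: dleft => //; lra.
  by apply: dright => //; lra.
have [d d0 [_ _ /(_ nS)[m [Cm mE]]]] := pw t.
have [c hc ct] := lie_cover hA (splice v h h' t).
have [H CH HE] := Cm c hc; have HR : represents c H m by [].
have gt0 : 0 < t by lra.
have [_ wE] : ~ S t /\ (forall p, w p t = m p t) by apply: mE; lra.
apply: (velocity_of_chart hA hk hk1 hc ct (cg t)).
rewrite wE -(chart_vfE hc HR ct (ltW gt0)).
set y := fun s => fwd c (splice v h h' s).
have cy : {for t, continuous y}.
  by apply: (continuous_comp (cg t)); exact: (continuous_fwd hA).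
have cF : {for t, continuous (fun s => chart_vf c H (y s, s))}.
  apply: (@continuous_comp _ _ _ (fun s => (y s, s)) (chart_vf c H)).
    by apply: continuous_pair => //; exact: cvg_id.
  by apply: (Ck_continuous (Ck_chart_vf hc CH)); exact: img_fwd.
apply: (@is_derive_removable _ _ y (fun s => chart_vf c H (y s, s))) => // e e0.
have : \forall s \near t, [/\ t - d < s < t + d, u < s < z, dom c (splice v h h' s) &
    `|chart_vf c H (y t, t) - chart_vf c H (y s, s)| < e].
  near=> s; split.
  - by near: s; apply: near_between; lra.
  - by near: s; apply: near_between.
  - by near: s; apply: cg; exact: (near_dom hA).
  - by near: s; move: e e0; exact/cvgrPdist_lt.
move=> /nbhs_ballP[d' /= d'0 Hd']; exists d' => // s std st.
have [|sd suz cs Fs] := Hd' s; first by rewrite /ball /= distrC.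
split; last by rewrite distrC ltW.
have [nSs wsE] := mE s sd.
have [_ dy] : has_left_velocity A k (splice v h h') s (w (splice v h h' s) s).
  by move: st; rewrite neq_lt => /orP[] st; [apply: dleft|apply: dright] => //; lra.
have s0 : 0 <= s by lra.
rewrite (chart_vfE hc HR cs s0).
by rewrite -wsE; exact: dy.
Unshelve. all: by end_near. Qed.

Lemma mode_box c m p t : A c -> C1_time A m -> dom c p ->
  exists H, represents c H m /\ exists r d, ode_box (cylinder c) (chart_vf c H) (fwd c p) t r d.
Proof.
move=> hc Cm cp; have [H CH HE] := Cm c hc; exists H; split => //.
apply: ode_box_exists; first exact: open_cylinder.
  exact: Ck_chart_vf.
exact: img_fwd.
Qed.

Lemma curve_near c h (t r : R) : A c -> continuous h -> dom c (h t) -> 0 < r ->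
  exists2 d, 0 < d & forall s, `|s - t| < d ->
    dom c (h s) /\ `|fwd c (h s) - fwd c (h t)| < r.
Proof.
move=> hc ch ct r0.
have cy : {for t, continuous (fun s => fwd c (h s))}.
  by apply: (continuous_comp (ch t)); exact: (continuous_fwd hA).
have : \forall s \near t, dom c (h s) /\ `|fwd c (h t) - fwd c (h s)| < r.
  near=> s; split.
    by near: s; apply: ch; exact: (near_dom hA).
  by near: s; move: r r0; exact/cvgrPdist_lt.
move=> /nbhs_ballP[d /= d0 Hd]; exists d => // s std.
have [|? ?] := Hd s; first by rewrite /ball /= distrC.
by split => //; rewrite distrC.
Unshelve. all: by end_near. Qed.

(** Agreement at a time spreads to the right by the stability estimate of a box, and [Q], being an
    implication, composes over adjacent intervals. *)
Lemma sol_unique w S u v h h' : piecewise w S -> 0 <= u -> h u = h' u ->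
  sol w S u v h -> sol w S u v h' -> forall t, u <= t <= v -> h t = h' t.
Proof.
move=> pw u0 huu sh sh' t /andP[ut tv].
have [ch _] := sh; have [ch' _] := sh'.
pose Q (a b : R) := h a = h' a -> h b = h' b.
suff : Q u t by apply.
apply: interval_chain => //; first by move=> a b c _ _ _ _ Qab Qbc /Qab.
move=> s /andP[us st].
(* Where the curves differ at [s] they differ nearby, the group being Hausdorff, so the implications
   on both sides have false premises. Where they agree, the implication ending at [s] is trivial. *)
have [hs|hs] := pselect (h s = h' s); last first.
  apply: contrapT => noQ; apply/hs/(lie_hausdorff hA) => U V Uh Vh.
  have : \forall x \near s, U (h x) /\ V (h' x).
    by near=> x; split; near: x; [exact: (ch s U Uh)|exact: (ch' s V Vh)].
  move=> /nbhs_ballP[d /= d0 Hd]; apply: contrapT => UV; apply: noQ.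
  exists d => //; split=> [x _ sx xs hx|x _ _ _ hx]; last by case: hs.
  exfalso; apply: UV; exists (h x).
  have [|Ux Vx] := Hd x; first by rewrite /ball /= ger0_norm; lra.
  by split => //; rewrite hx.
have [d d0 [_ [m mE] _]] := pw s.
have [c hc cs] := lie_cover hA (h s).
have [H [HR [r [d1 box]]]] := mode_box s hc mE.1 cs.
have [[r0 d10] _ _ _ stab] := box.
have [d2 d20 near2] := curve_near hc ch cs r0.
have cs' : dom c (h' s) by rewrite -hs.
have [d3 d30 near3] := curve_near hc ch' cs' r0.
pose dd := Num.min (Num.min d d1) (Num.min d2 d3).
exists dd; first by rewrite !lt_min d0 d10 d20 d30.
split; first by move=> a _ _ _ _.
move=> b bt sb bd _.
have [bd0 bd1 bd2 bd3] : [/\ b < s + d, b < s + d1, b < s + d2 & b < s + d3].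
  by move: bd; rewrite /dd -!ltrBlDl !lt_min => /andP[/andP[-> ->] /andP[-> ->]].
have in2 x : s <= x <= b -> `|x - s| < d2.
  by move=> /andP[sx xb]; rewrite ger0_norm ?subr_ge0// ltrBlDl (le_lt_trans xb).
have in3 x : s <= x <= b -> `|x - s| < d3.
  by move=> /andP[sx xb]; rewrite ger0_norm ?subr_ge0// ltrBlDl (le_lt_trans xb).
have mE' : mode_on w S s b m by apply: mode_on_sub mE => //; exact: ltW.
have s0 : 0 <= s by lra.
have sub g : sol w S u v g -> sol w S s b g by apply: sol_sub => //; lra.
have y1 := sol_chart hc HR mE' s0 (fun x xb => (near2 x (in2 x xb)).1) (sub h sh).
have y2 := sol_chart hc HR mE' s0 (fun x xb => (near3 x (in3 x xb)).1) (sub h' sh').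
have sbb : s <= b <= b by rewrite sb lexx.
have ssb : s <= s <= b by rewrite sb lexx.
have : `|fwd c (h b) - fwd c (h' b)| <= 2 * `|fwd c (h s) - fwd c (h' s)|.
  apply: (stab _ _ _ _ _ _ y1 y2) => //.
  - by rewrite subrr normr0 ltW.
  - by rewrite ger0_norm ?subr_ge0// lerBlDl ltW.
  move=> x xb; have [_ h2] := near2 x (in2 x xb); have [_ h3] := near3 x (in3 x xb).
  by rewrite -hs in h3; split; apply: ltW; [apply: (lt_trans h2)|apply: (lt_trans h3)]; rewrite ltr_pMl// ltr1n.
rewrite hs subrr normr0 mulr0 normr_le0 subr_eq0 => /eqP E1.
rewrite -(fwdK hA hc (near2 b (in2 b sbb)).1) E1 (fwdK hA)//.
exact: (near3 b (in3 b sbb)).1.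
Unshelve. all: by end_near. Qed.

End PiecewiseFlows.

(** * The costate as a gradient *)

Section MatrixCurves.
Context {R : realType}.

Lemma mx_norm_le m n (M : 'M[R]_(m, n)) (C : R) : 0 <= C ->
  (forall i j, `|M i j| <= C) -> `|M| <= C.
Proof.
move=> C0 H; rewrite [leLHS]/Num.Def.normr/= mx_normrE.
by apply: bigmax_le => // -[i j] _; exact: H.
Qed.

Lemma mulmx_norm_le m n p (M : 'M[R]_(m, n)) (N : 'M[R]_(n, p)) :
  `|M *m N| <= n%:R * `|M| * `|N|.
Proof.
apply: mx_norm_le; first by rewrite !mulr_ge0.
move=> i j; rewrite mxE; apply: (le_trans (ler_norm_sum _ _ _)).
apply: (@le_trans _ _ (\sum_(l < n) `|M| * `|N|)).
  by apply: ler_sum => l _; rewrite normrM ler_pM// cV_coord_le.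
by rewrite sumr_const card_ord -[leLHS]mulr_natl mulrA.
Qed.

Lemma cvg_mx (T : Type) (F : set_system T) {FF : Filter F} m n
    (f : T -> 'M[R]_(m, n)) (l : 'M[R]_(m, n)) :
  (forall i j, f x i j @[x --> F] --> l i j) -> f @ F --> l.
Proof.
move=> H; apply/cvgrPdist_le => e e0; near=> x.
apply: mx_norm_le; first exact: ltW.
near: x; apply: filter_forall => i; apply: filter_forall => j.
have := H i j; move/cvgrPdist_le => /(_ _ e0); apply: filterS => x.
by rewrite !mxE.
Unshelve. all: by end_near. Qed.

Lemma cvg_mulmx (T : Type) (F : set_system T) {FF : Filter F} m n p
    (f : T -> 'M[R]_(m, n)) (g : T -> 'M[R]_(n, p)) (a : 'M[R]_(m, n)) (b : 'M[R]_(n, p)) :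
  f @ F --> a -> g @ F --> b -> f x *m g x @[x --> F] --> a *m b.
Proof.
move=> fa gb; apply: cvg_mx => i j; rewrite mxE.
have -> : (fun x => (f x *m g x) i j) = \sum_l (fun x => f x i l * g x l j).
  by rewrite fct_sumE; apply/funext => y; rewrite mxE.
elim/big_ind2 : _ => [|u u' v v' cu cv|l _]; first exact: cvg_cst.
  exact: cvgD.
apply: cvgM.
  have ca : {for a, continuous (fun M : 'M[R]_(m, n) => M i l)} by exact: coord_continuous.
  exact: cvg_comp fa ca.
have cb : {for b, continuous (fun M : 'M[R]_(n, p) => M l j)} by exact: coord_continuous.
exact: cvg_comp gb cb.
Qed.

Lemma is_derive_mulmx (V : normedModType R) m n p (f : V -> 'M[R]_(m, n))
    (g : V -> 'M[R]_(n, p)) (x v : V) (df : 'M[R]_(m, n))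
    (dg : 'M[R]_(n, p)) :
  is_derive x v f df -> is_derive x v g dg ->
  is_derive x v (fun y => f y *m g y) (f x *m dg + df *m g x).
Proof.
move=> Hf Hg; apply: is_derive_mx => i j.
have -> : (fun y => (f y *m g y) i j) = \sum_l (fun y => f y i l * g y l j).
  by rewrite fct_sumE; apply/funext => y; rewrite mxE.
have -> : (f x *m dg + df *m g x) i j =
    \sum_l (f x i l *: dg l j + g x l j *: df i l).
  by rewrite !mxE -big_split; apply: eq_bigr => l _; congr (_ + _); rewrite mulrC.
apply: is_derive_sum => l.
exact: (is_deriveM (is_derive_coord i l Hf) (is_derive_coord l j Hg)).
Qed.

(** In [N^-1 = M^-1 - N^-1 (N - M) M^-1] the term with [N^-1] is absorbed into the left-hand side.
    The norm is the maximum norm, so each product costs a factor [n]. *)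
Lemma invmx_norm_near n (M N : 'M[R]_n) : M \in unitmx -> N \in unitmx ->
  n%:R * n%:R * `|N - M| * `|invmx M| <= 1 / 2 -> `|invmx N| <= 2 * `|invmx M|.
Proof.
move=> uM uN H.
have E : invmx N = invmx M - invmx N *m (N - M) *m invmx M.
  rewrite mulmxBr mulmxBl mulVmx// mul1mx -mulmxA mulmxV// mulmx1; zmodule.
have : `|invmx N| <= `|invmx M| + `|invmx N| / 2.
  rewrite {1}E; apply: (le_trans (ler_normB _ _)); rewrite lerD2l.
  apply: (le_trans (mulmx_norm_le _ _)).
  apply: (@le_trans _ _ (n%:R * (n%:R * `|invmx N| * `|N - M|) * `|invmx M|)).
    by rewrite ler_wpM2r// ler_wpM2l// mulmx_norm_le.
  have := normr_ge0 (invmx N); nra.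
lra.
Qed.

Lemma invmx_sub n (M N : 'M[R]_n) : M \in unitmx -> N \in unitmx ->
  invmx N - invmx M = - (invmx N *m (N - M) *m invmx M).
Proof.
move=> uM uN; rewrite mulmxBr mulmxBl mulVmx// mul1mx -mulmxA mulmxV// mulmx1; zmodule.
Qed.

Lemma continuous_invmx (T : topologicalType) n (M : T -> 'M[R]_n) (t : T) :
  (\forall s \near t, M s \in unitmx) -> {for t, continuous M} ->
  {for t, continuous (fun s => invmx (M s))}.
Proof.
move=> uM cM; have uMt : M t \in unitmx := nbhs_singleton uM.
apply/cvgrPdist_le => e e0.
pose C := n%:R * (n%:R * (2 * `|invmx (M t)|)) * `|invmx (M t)| + 1.
have C0 : 0 < C by rewrite ltr_wpDl// !mulr_ge0.
pose C' := n%:R * n%:R * `|invmx (M t)| + 1.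
have C'0 : 0 < C' by rewrite ltr_wpDl// !mulr_ge0.
have h1 : 0 < e / C by rewrite divr_gt0.
have h2 : 0 < (1 / 2) / C' by rewrite divr_gt0.
have n1 : \forall s \near t, `|M t - M s| <= e / C.
  by have := cM; move/cvgrPdist_le; apply.
have n2 : \forall s \near t, `|M t - M s| <= (1 / 2) / C'.
  by have := cM; move/cvgrPdist_le; apply.
near=> s.
have us : M s \in unitmx by near: s.
have b1 : `|M s - M t| <= e / C by rewrite distrC; near: s.
have b2 : `|M s - M t| <= (1 / 2) / C' by rewrite distrC; near: s.
have Nb : `|invmx (M s)| <= 2 * `|invmx (M t)|.
  apply: invmx_norm_near => //; move: b2; rewrite ler_pdivlMr// /C'.
  have := normr_ge0 (M s - M t); nra.
rewrite distrC (invmx_sub uMt us) normrN; apply: (le_trans (mulmx_norm_le _ _)).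
move: b1; rewrite ler_pdivlMr// => b1; apply: le_trans b1.
apply: (@le_trans _ _ (n%:R * (n%:R * `|invmx (M s)| * `|M s - M t|) * `|invmx (M t)|)).
  by rewrite ler_wpM2r// ler_wpM2l// mulmx_norm_le.
have nn : 0 <= n%:R * n%:R * `|M s - M t| * `|invmx (M t)| by rewrite !mulr_ge0.
have := normr_ge0 (M s - M t); rewrite /C; nra.
Unshelve. all: by end_near. Qed.

(** By [invmx_sub] the difference quotient is a product of three factors; the one that moves with
    the step besides the quotient of [M] converges by [continuous_invmx]. *)
Lemma is_derive_invmx n (M : R -> 'M[R]_n) (t : R) (dM : 'M[R]_n) :
  (\forall s \near t, M s \in unitmx) -> is_derive t 1 M dM ->
  is_derive t 1 (fun s => invmx (M s)) (- (invmx (M t) *m dM *m invmx (M t))).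
Proof.
move=> uM dMt; have uMt : M t \in unitmx := nbhs_singleton uM.
have cM : {for t, continuous M} := is_derive_continuous dMt.
have cN := continuous_invmx uM cM.
have H : h^-1 *: (invmx (M (h *: 1 + t)) - invmx (M t)) @[h --> 0^'] -->
    - (invmx (M t) *m dM *m invmx (M t)).
  have cth : (fun h : R => h *: 1 + t) @ 0^' --> t.
    have : {for 0, continuous (fun h : R => h *: 1 + t)}.
      by apply: cvgD; [apply: cvgZr_tmp; exact: cvg_id|exact: cvg_cst].
    rewrite /prop_for /continuous_at scale0r add0r => cc.
    by apply: cvg_trans cc; apply: cvg_app; exact: cvg_within.
  have Hc : - (invmx (M (h *: 1 + t)) *m (h^-1 *: (M (h *: 1 + t) - M t)) *m invmx (M t))
      @[h --> 0^'] --> - (invmx (M t) *m dM *m invmx (M t)).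
    apply: cvgN; apply: cvg_mulmx; last exact: cvg_cst.
    apply: cvg_mulmx; first exact: (cvg_comp _ _ cth cN).
    by case: dMt => d <-; exact: d.
  apply: cvg_trans Hc; apply: near_eq_cvg; near=> h.
  rewrite invmx_sub//; last by near: h; exact: (cth _ uM).
  by rewrite scalerN -scalemxAr -scalemxAl.
apply: DeriveDef; first by apply/cvg_ex; eexists; exact: H.
by apply/cvg_lim => //; exact: H.
Unshelve. all: by end_near. Qed.

End MatrixCurves.

(** * The moving frame along a curve, and the derivative of the pairing *)

Section Adjoint.
Context {R : realType} {n : nat} {G : GroupTopological.type}.
Variables (A : set (chart R n G)) (hA : is_lie_group A).
Variables (k : chart R n G) (hk : A k) (hk1 : dom k 1%g).
Variables (Ex : 'cV[R]_n -> G) (hEx : is_exponential A k Ex).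
Local Notation E := 'cV[R]_n.
Implicit Types (c : chart R n G) (h : R -> G) (w m : G -> R -> E) (S : set R).

Lemma bounded_segment (W : normedModType R) (f : R -> W) (a b : R) : a <= b ->
  (forall t, a <= t <= b -> {for t, continuous f}) ->
  exists2 M : R, 0 <= M & forall t, a <= t <= b -> `|f t| <= M.
Proof.
move=> ab cf.
apply: (@interval_chain _ (fun u v => exists2 M : R, 0 <= M & forall t, u <= t <= v -> `|f t| <= M)) => //.
  move=> u v w _ _ _ _ [M M0 HM] [M' M'0 HM']; exists (Num.max M M'); first by rewrite le_max M0.
  move=> t /andP[ut tw]; have [tv|/ltW vt] := leP t v.
    by rewrite le_max HM// ut.
  by rewrite le_max HM' ?orbT// vt.
move=> s sab; have [d d0 Hd] := continuous_ball (cf s sab) ltr01.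
have B t : `|t - s| < d -> `|f t| <= `|f s| + 1.
  move=> /Hd /ltW H; rewrite -(subrK (f s) (f t)); apply: (le_trans (ler_normD _ _)).
  by rewrite addrC lerD2l.
have p1 : 0 <= `|f s| + 1 by rewrite addr_ge0.
by exists d => //; split=> [u _ du us | u _ us du]; exists (`|f s| + 1) => // t tt;
  apply: B; rewrite ltr_norml; lra.
Qed.

(** Strict differentiability at [(x s, s)] covers all [(x t, t)] with [t] near [s], because its
    linear part may be taken at a moving point; chaining over [[a, b]] then gives one radius for all
    times. *)
Lemma uniform_linearization c (W : normedModType R) (F : E * R -> W) (a b : R) (x : R -> E) :
  A c -> Ck 1 (cylinder c) F -> a <= b ->
  (forall t, a <= t <= b -> {for t, continuous x}) ->
  (forall t, a <= t <= b -> img c (x t)) ->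
  forall e : R, 0 < e -> exists2 d : R, 0 < d & forall t y, a <= t <= b -> `|y - x t| < d ->
    `|F (y, t) - F (x t, t) - 'D_(y - x t, (0 : R)) F (x t, t)| <= e * `|y - x t|.
Proof.
move=> hc CF ab cx ix e e0.
pose P (d t : R) := forall y, `|y - x t| < d ->
    `|F (y, t) - F (x t, t) - 'D_(y - x t, (0 : R)) F (x t, t)| <= e * `|y - x t|.
suff [d d0 Hd] : exists2 d : R, 0 < d & forall t, a <= t <= b -> P d t.
  by exists d => // t y tab; exact: Hd.
apply: (@interval_chain _ (fun u v => exists2 d : R, 0 < d & forall t, u <= t <= v -> P d t)) => //.
  move=> u v w _ _ _ _ [d d0 Hd] [d' d'0 Hd']; exists (Num.min d d'); first by rewrite lt_min d0.
  move=> t /andP[ut tw] y; rewrite lt_min => /andP[y1 y2]; have [tv|/ltW vt] := leP t v.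
    by apply: Hd => //; rewrite ut.
  by apply: Hd' => //; rewrite vt.
move=> s sab.
have sE : spanned (E * R)%type.
  by apply: spanned_prod; [exact: spanned_cV|exact: spanned_R].
have [d1 d10 [_ strict]] := Ck1_strict sE (open_cylinder hA hc) CF (x := (x s, s)) (ix s sab) e0.
have d12 : 0 < d1 / 2 by rewrite divr_gt0.
have [d2 d20 Hd2] := continuous_ball (cx s sab) d12.
have loc t : `|t - s| < d1 -> `|t - s| < d2 -> P (d1 / 2) t.
  move=> ts1 /Hd2 xts y yxt.
  have E1 : (y, t) - (x t, t) = (y - x t, 0 : R).
    by rewrite -[LHS]/(y - x t, t - t) subrr.
  have E2 : `|(y - x t, 0 : R)| = `|y - x t|.
    by rewrite prod_normE /= normr0 max_l.
  have near0 y' : `|y' - x s| < d1 -> `|(y', t) - (x s, s)| < d1.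
    by move=> ?; rewrite prod_normE /= gt_max ts1 andbT.
  have xs1 : `|x t - x s| < d1 by apply: (lt_le_trans xts); lra.
  have ys1 : `|y - x s| < d1.
    rewrite -(subrK (x t) y) -addrA; apply: (le_lt_trans (ler_normD _ _)).
    by rewrite (splitr d1) ltrD.
  have := strict _ _ _ (near0 _ ys1) (near0 _ xs1) (near0 _ xs1).
  by rewrite E1 E2.
exists (Num.min d1 d2); first by rewrite lt_min d10.
have mm u : `|u - s| < Num.min d1 d2 -> P (d1 / 2) u.
  by rewrite lt_min => /andP[]; exact: loc.
by split=> [u _ du us|u _ us du]; exists (d1 / 2) => // t tt; apply: mm;
  rewrite ltr_norml; lra.
Qed.

Lemma matrix_of_linear (l : E -> E) v :
  (forall (a : R) u u', l (a *: u + u') = a *: l u + l u') -> matrix_of l *m v = l v.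
Proof.
move=> ll; pose lin := GRing.isLinear.Build _ _ _ _ l ll.
pose L : {linear E -> E} := HB.pack l lin.
rewrite -[l]/(L : E -> E) [in RHS](matrix_sum_delta v) linear_sum.
apply/matrixP => i j; rewrite (ord1 j) mxE summxE; apply: eq_bigr => q _.
by rewrite big_ord1 linearZ/= !mxE mulrC.
Qed.

Lemma row_of_linear (l : E -> R) v :
  (forall (a : R) u u', l (a *: u + u') = a * l u + l u') -> (row_of l *m v) 0 0 = l v.
Proof.
move=> ll; pose lin := GRing.isLinear.Build _ _ _ _ (l : E -> R^o) ll.
pose L : {linear E -> R^o} := HB.pack (l : E -> R^o) lin.
rewrite -[l]/(L : E -> R) [in RHS](matrix_sum_delta v) linear_sum mxE.
by apply: eq_bigr => q _; rewrite big_ord1 linearZ/= !mxE mulrC.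
Qed.

Lemma derive_dir_linear (W : normedModType R) c (f : E -> W) x : A c -> Ck 1 (img c) f -> img c x ->
  forall (a : R) u u', 'D_(a *: u + u') f x = a *: 'D_u f x + 'D_u' f x.
Proof.
move=> hc Cf cx a u u'; rewrite (derive_add _ _ (open_img hA hc) Cf cx); congr (_ + _).
by have [] := is_derive_scaledir a (Ck_derivable (v := u) Cf cx).
Qed.

Lemma left_translate_linear c p : A c -> dom c p ->
  forall (a : R) u u', left_translate k c p (a *: u + u') =
    a *: left_translate k c p u + left_translate k c p u'.
Proof.
move=> hc cp a u u'; rewrite (left_translateE hA hk hk1 _ hc cp) mulmxDr -scalemxAr.
by rewrite -!(left_translateE hA hk hk1 _ hc cp).
Qed.

Lemma derive_left_vf_linear c x z : A c -> img c x ->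
  forall (a : R) u u', 'D_z (left_vf k c (a *: u + u')) x =
    a *: 'D_z (left_vf k c u) x + 'D_z (left_vf k c u') x.
Proof.
move=> hc cx a u u'.
have d v : is_derive x z (left_vf k c v) ('D_z (left_vf k c v) x).
  by apply: derivableP; exact: (Ck_derivable (Ck_left_vf hA hk hk1 v 1 hc) cx).
have [_ <-] := is_deriveD (is_deriveZ a (d u)) (d u').
apply: near_eq_derive; near=> y.
have cy : dom c (bwd c y) by apply: (dom_bwd hA hc); near: y; exact: (near_img hA).
by rewrite /left_vf left_translate_linear.
Unshelve. all: by end_near. Qed.

Lemma is_derive_left_matrix c x z : A c -> img c x ->
  is_derive x z (fun y => left_matrix k c (bwd c y))
    (matrix_of (fun v => 'D_z (left_vf k c v) x)).
Proof.
move=> hc cx; apply: is_derive_mx => i j; rewrite mxE.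
have -> : (fun y => left_matrix k c (bwd c y) i j) = (fun y => left_vf k c (delta_mx j 0) y i 0).
  by apply/funext => y; rewrite mxE.
apply: is_derive_coord; apply: derivableP.
exact: (Ck_derivable (Ck_left_vf hA hk hk1 _ 1 hc) cx).
Qed.

Lemma is_derive_left_matrix_curve c h (t : R) X : A c -> dom c (h t) ->
  {for t, continuous h} -> is_derive t 1 (fun s => fwd c (h s)) X ->
  is_derive t 1 (fun s => left_matrix k c (h s))
    (matrix_of (fun v => 'D_X (left_vf k c v) (fwd c (h t)))).
Proof.
move=> hc ct ch dx; apply: is_derive_mx => i j; rewrite mxE.
have := is_derive_comp_curve (f := left_vf k c (delta_mx j 0)) dx
  (differentiable_left_vf hA hk hk1 _ hc (img_fwd ct)).
move=> /(is_derive_coord i 0); apply: near_eq_is_derive; near=> s.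
rewrite /left_vf (fwdK hA hc) ?mxE//.
by near: s; apply: ch; exact: (near_dom hA).
Unshelve. all: by end_near. Qed.

(** The product rule for frame times coefficients: the first term differentiates the left-invariant
    field whose Lie algebra element is frozen at [H (x, t)]. *)
Lemma derive_chart_vf c (H : E * R -> E) x (t : R) z : A c -> Ck 1 (cylinder c) H -> img c x ->
  'D_(z, (0 : R)) (chart_vf k c H) (x, t) =
  'D_z (left_vf k c (H (x, t))) x + left_matrix k c (bwd c x) *m 'D_(z, (0 : R)) H (x, t).
Proof.
move=> hc CH cx.
have dM : is_derive (x, t) (z, 0 : R) (fun xt => left_matrix k c (bwd c xt.1))
    (matrix_of (fun v => 'D_z (left_vf k c v) x)).
  have [d1 d2] := is_derive_left_matrix z hc cx.
  have aff := derive_affine (fun y => left_matrix k c (bwd c y)) (p := fun xt : E * R => xt.1)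
    (A := fun xt : E * R => xt.1) (x, t) (z, 0) (fun _ _ _ => erefl).
  by apply: DeriveDef; [exact: aff.1|rewrite aff.2].
have dH : is_derive (x, t) (z, 0 : R) H ('D_(z, (0 : R)) H (x, t)).
  by apply: derivableP; exact: (Ck_derivable (U := cylinder c) CH).
have [_ E1] := is_derive_mulmx dM dH.
rewrite /chart_vf E1 /= addrC; congr (_ + _); rewrite matrix_of_linear//.
exact: derive_left_vf_linear.
Qed.

Lemma Ck_represented c H m (t : R) : A c -> represents c H m -> 0 <= t ->
  Ck 1 (img c) (fun y => m (bwd c y) t).
Proof.
move=> hc [CH HE] t0; apply: (Ck_eq (f := fun y => H (y, t)) (open_img hA hc)).
  by move=> y cy; rewrite HE.
apply: (Ck_subset (U := [set y | cylinder c (y, t)])); first by [].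
apply: (Ck_affine (U := cylinder c) (f := H) (p := fun y => (y, t)) (A := fun u => (u, 0))).
- by move=> r y u; rewrite -[RHS]/(r *: u + y, r *: 0 + t) scaler0 add0r.
- by move=> y; apply: (continuous_pair (g := cst t)); [exact: cvg_id|exact: cst_continuous].
- exact: CH.
Qed.

Lemma derive_represented c H m (t : R) x z : A c -> represents c H m -> 0 <= t -> img c x ->
  'D_z (fun y => m (bwd c y) t) x = 'D_(z, (0 : R)) H (x, t).
Proof.
move=> hc [CH HE] t0 cx.
have pA (r : R) (y v : E) : (r *: v + y, t) = r *: (v, 0 : R) + (y, t).
  by rewrite -[RHS]/(r *: v + y, r *: 0 + t) scaler0 add0r.
have aff := derive_affine H (p := fun y : E => (y, t)) (A := fun v => (v, 0)) x z pA.
rewrite -aff.2.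
by apply: near_eq_derive; near=> y; rewrite HE//; near: y; exact: (near_img hA).
Unshelve. all: by end_near. Qed.

Lemma Dg_linear (W : normedModType R) (F : G -> W) c p : A c -> dom c p ->
  Ck 1 (img c) (fun y => F (bwd c y)) ->
  forall (a : R) u u', Dg Ex F p (a *: u + u') = a *: Dg Ex F p u + Dg Ex F p u'.
Proof.
move=> hc cp CF a u u'.
have dF := Ck1_differentiable (spanned_cV _) (open_img hA hc) CF (img_fwd cp).
rewrite !(DgE hA hk hk1 hEx _ hc cp dF) left_translate_linear//.
exact: (derive_dir_linear hc CF (img_fwd cp)).
Qed.

Lemma add_eq (V : zmodType) (x y z : V) : x - y = z -> x = y + z.
Proof. by move=> <-; zmodule. Qed.

Lemma costate_algebra (rho r1 : 'rV[R]_n) (N M' D1 A1 B : 'M[R]_n) (z z' g1 a1 u : E) :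
  N *m z = u -> N *m B = 1%:M -> M' *m u = g1 + B *m a1 -> A1 *m u = a1 ->
  rho *m N *m z' + (rho *m - (N *m M' *m N) + (- (rho *m (D1 - A1)) - r1) *m N) *m z =
  rho *m N *m (z' - (g1 + B *m (D1 *m u))) - r1 *m u.
Proof.
move=> Nz NB M'u A1u.
have cancelB (v : E) : rho *m N *m (B *m v) = rho *m v.
  by rewrite mulmxA -(mulmxA rho N B) NB mulmx1.
rewrite (mulmxDl (rho *m _)) -(mulmxA _ N z) Nz mulmxN mulNmx.
have -> : rho *m (N *m M' *m N) *m z = rho *m N *m (g1 + B *m a1).
  by rewrite -!mulmxA Nz M'u.
have -> : (- (rho *m (D1 - A1)) - r1) *m u = - (rho *m (D1 *m u) - rho *m a1) - r1 *m u.
  by rewrite mulmxBl mulNmx -(mulmxA rho) (mulmxBl D1) A1u mulmxBr.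
rewrite (mulmxBr (rho *m N)) !(mulmxDr (rho *m N)) !cancelB.
by zmodule.
Qed.

(** If [z] solves the linearised equation, the pairing changes by [- D_z L] only. For the difference
    [z] of two solutions, [z'] misses the linearisation by a remainder of smaller order than [z]. *)
Lemma adjoint_derivative c H m (Lag : G -> R) h (rho : R -> 'rV[R]_n) (z : R -> E) z' (t : R) :
  A c -> represents c H m -> 0 <= t -> dom c (h t) -> {for t, continuous h} ->
  is_derive t 1 (fun s => fwd c (h s)) (chart_vf k c H (fwd c (h t), t)) ->
  C1 A Lag ->
  is_derive t 1 rho
    (- (rho t *m (matrix_of (Dg Ex (fun p => m p t) (h t)) - matrix_of (ad k (m (h t) t))))
     - row_of (Dg Ex Lag (h t))) ->
  is_derive t 1 z z' ->
  is_derive t 1 (fun s => (rho s *m invmx (left_matrix k c (h s)) *m z s) 0 0)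
    ((rho t *m invmx (left_matrix k c (h t)) *m
       (z' - 'D_(z t, (0 : R)) (chart_vf k c H) (fwd c (h t), t))) 0 0
     - 'D_(z t) (fun x => Lag (bwd c x)) (fwd c (h t))).
Proof.
move=> hc HR t0 ct ch dx CL drho dz.
have [CH HE] := HR; have ix := img_fwd ct; set x := fwd c (h t) in ix *.
have bx : bwd c x = h t by rewrite /x (fwdK hA).
set B := left_matrix k c (h t); set u := invmx B *m z t; set F := m (h t) t.
have uB : B \in unitmx by exact: (left_matrix_unit hA hk hk1 hc ct).
have Bu : B *m u = z t by rewrite /u mulmxA mulmxV// mul1mx.
have ltu : left_translate k c (h t) u = z t by rewrite (left_translateE hA hk hk1 u hc ct).
have ltF : left_translate k c (h t) F = chart_vf k c H (x, t).
  by rewrite (chart_vfE hA hk hk1 hc HR ct t0).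
set X := chart_vf k c H (x, t) in dx ltF *.
set M' := matrix_of (fun v => 'D_X (left_vf k c v) x).
have dM : is_derive t 1 (fun s => left_matrix k c (h s)) M'.
  exact: is_derive_left_matrix_curve.
have uM : \forall s \near t, left_matrix k c (h s) \in unitmx.
  near=> s; apply: (left_matrix_unit hA hk hk1 hc).
  by near: s; apply: ch; exact: (near_dom hA).
have dN := is_derive_invmx uM dM.
have dp := is_derive_mulmx (is_derive_mulmx drho dN) dz.
apply: (is_derive_eq (is_derive_coord 0 0 dp)); rewrite -/B.
have CFm := Ck_represented hc HR t0.
have dFm := Ck1_differentiable (spanned_cV _) (open_img hA hc) CFm ix.
have h1E : matrix_of (Dg Ex (fun p => m p t) (h t)) *m u = 'D_(z t, (0 : R)) H (x, t).
  rewrite (matrix_of_linear _ (Dg_linear hc ct CFm)).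
  by rewrite (DgE hA hk hk1 hEx u hc ct dFm) ltu (derive_represented (z t) hc HR t0 ix).
have a1E : matrix_of (ad k F) *m u = ad k F u.
  by apply: matrix_of_linear => a v v'; exact: (ad_linear hA hk hk1).
have dL := Ck1_differentiable (spanned_cV _) (open_img hA hc) (CL c hc) ix.
have lE : (row_of (Dg Ex Lag (h t)) *m u) 0 0 = 'D_(z t) (fun y => Lag (bwd c y)) x.
  rewrite (row_of_linear _ (Dg_linear hc ct (CL c hc))).
  by rewrite (DgE hA hk hk1 hEx u hc ct dL) ltu.
(* The bracket identity exchanges the derivative of the field of [u] along that of [F] for the
   derivative of the field of [F] along that of [u], at the price of [ad k F u]. *)
have M'u : M' *m u = 'D_(z t) (left_vf k c F) x + B *m ad k F u.
  rewrite (matrix_of_linear _ (derive_left_vf_linear X hc ix)).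
  have := left_vf_bracket hA hk hk1 F u hc ct; rewrite -/x.
  have -> : left_vf k c F x = X by rewrite /left_vf bx.
  have -> : left_vf k c u x = z t by rewrite /left_vf bx.
  rewrite (left_translateE hA hk hk1 _ hc ct) -/B.
  exact: add_eq.
have HF : H (x, t) = F by rewrite HE// bx.
have vfE : 'D_(z t, (0 : R)) (chart_vf k c H) (x, t) =
    'D_(z t) (left_vf k c F) x + B *m 'D_(z t, (0 : R)) H (x, t).
  by rewrite (derive_chart_vf t (z t) hc CH ix) HF bx.
rewrite vfE -lE -h1E.
set g1 := 'D_(z t) (left_vf k c F) x in M'u *.
have entry (P Q T : 'M[R]_1) : P = Q - T -> P 0 0 = Q 0 0 - T 0 0.
  by move=> ->; rewrite !mxE.
apply: entry.
have NB : invmx B *m B = 1%:M by rewrite mulVmx.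
exact: (costate_algebra _ _ _ _ erefl NB M'u a1E).
Unshelve. all: by end_near. Qed.

End Adjoint.

Section Arith.
Variable R : realType.
Implicit Types e len x z : R.

Lemma scaled_quotient_le e len x : 0 < e -> 0 < len -> 0 <= x -> x * (e / (8 * (x + 1) * len)) <= e / (8 * len).
Proof.
move=> e0 l0 x0; rewrite mulrA ler_pdivrMr; last by rewrite !mulr_gt0// ltr_wpDl.
have -> : e / (8 * len) * (8 * (x + 1) * len) = x * e + e by field; lra.
lra.
Qed.

Lemma average_le e len x z : 0 < e -> 0 < len -> 0 <= z -> x <= len ->
  e / (4 * len) * (2 * z) * x <= e / 2 * z.
Proof.
move=> e0 l0 z0 xl; apply: (@le_trans _ _ (e / (4 * len) * (2 * z) * len)).
  by rewrite ler_wpM2l// !mulr_ge0// ?invr_ge0 ?mulr_ge0//; lra.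
by rewrite le_eqVlt; apply/orP; left; apply/eqP; field; lra.
Qed.

Lemma error_sum (e de D D1 v i1 i2 x : R) : D = D1 + (i1 - i2) -> `|D1 - x| <= e / 3 * de ->
  `|i1 - v| <= e / 3 * de -> `|i2 - v| <= e / 3 * de -> `|D - x| <= e * de.
Proof. by move=> ->; rewrite !ler_norml; lra. Qed.

End Arith.

(** * The cost-to-go and the backward propagation of its gradient *)

Section CostToGo.
Context {R : realType} {n : nat} {G : GroupTopological.type}.
Variables (A : set (chart R n G)) (hA : is_lie_group A).
Variables (k : chart R n G) (hk : A k) (hk1 : dom k 1%g).
Variables (Ex : 'cV[R]_n -> G) (hEx : is_exponential A k Ex).
Local Notation E := 'cV[R]_n.
Implicit Types (c d : chart R n G) (h : R -> G) (p q : G).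

Lemma C1_continuous (F : G -> R) : C1 A F -> continuous F.
Proof.
move=> CF p; have [c hc cp] := lie_cover hA p.
have cFb : {for fwd c p, continuous (fun x => F (bwd c x))}.
  exact: (Ck_continuous (CF c hc) (img_fwd cp)).
apply: (@near_eq_continuous _ _ (fun q => F (bwd c (fwd c q)))).
  by near=> q; rewrite (fwdK hA hc)//; near: q; exact: (near_dom hA).
apply: (@continuous_comp _ _ _ (fwd c) (fun x => F (bwd c x))); last exact: cFb.
exact: (continuous_fwd hA).
Unshelve. all: by end_near. Qed.

(* l is an element of the dual of the Lie algebra, v a tangent vector at p in
   the coordinates of c. *)
Definition covector c p (l : 'rV[R]_n) (v : E) : R := (l *m invmx (left_matrix k c p) *m v) 0 0.

Lemma covector_norm c p (l : 'rV[R]_n) v :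
  `|covector c p l v| <= n%:R * `|l *m invmx (left_matrix k c p)| * `|v|.
Proof. by apply: (le_trans (cV_coord_le _ _ _)); exact: mulmx_norm_le. Qed.

Lemma covectorB c p (l : 'rV[R]_n) u v :
  covector c p l (u - v) = covector c p l u - covector c p l v.
Proof. by rewrite /covector mulmxBr mxE [X in _ + X]mxE. Qed.

Lemma covector_left c p (l : 'rV[R]_n) u : A c -> dom c p ->
  covector c p l (left_matrix k c p *m u) = (l *m u) 0 0.
Proof.
move=> hc cp; rewrite /covector mulmxA -(mulmxA l) mulVmx ?mulmx1//.
exact: (left_matrix_unit hA hk hk1 hc cp).
Qed.

(** A Frechet derivative, read in the chart [c], of a multivalued function that vanishes at [p]: the
    estimate is asked of every value [r] related to [q]. *)
Definition gradient (V : G -> R -> Prop) c p (l : 'rV[R]_n) : Prop :=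
  forall e : R, 0 < e -> \forall q \near p, forall r, V q r ->
    `|r - covector c p l (fwd c q - fwd c p)| <= e * `|fwd c q - fwd c p|.

Lemma near_chart_ball c p (d : R) : A c -> dom c p -> 0 < d ->
  \forall q \near p, dom c q /\ `|fwd c q - fwd c p| < d.
Proof.
move=> hc cp d0; near=> q; split; first by near: q; exact: (near_dom hA).
rewrite distrC; near: q.
by have := continuous_fwd hA hc cp; move/cvgrPdist_lt; apply.
Unshelve. all: by end_near. Qed.

(** The derivative of the transition map carries the frame in [d] to the frame in [c], so the
    covector agrees on corresponding displacements to first order. Half of [e] pays for the estimate
    in [c], through the Lipschitz constant [K], and half for the nonlinearity of the transition
    map. *)
Lemma gradient_chart V c d p l : A c -> A d -> dom c p -> dom d p ->
  gradient V c p l -> gradient V d p l.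
Proof.
move=> hc hd cp dp gV e e0.
pose U := [set x | img d x /\ dom c (bwd d x)].
have oU : open U.
  rewrite openE => y [dy cy]; near=> z; split; near: z; first exact: (near_img hA).
  exact: (near_dom_bwd hA).
have Ct : Ck 1 U (transition d c) := (lie_compatible hA hd hc).1 1%N.
have Ux : U (fwd d p) by split; [exact: img_fwd|rewrite (fwdK hA)].
pose lN := n%:R * `|l *m invmx (left_matrix k c p)|.
have lN0 : 0 <= lN by rewrite mulr_ge0.
have e1 : 0 < e / (2 * (lN + 1)) by rewrite divr_gt0// mulr_gt0// ltr_wpDl.
have [d1 d10 [_ strict]] := Ck1_strict (spanned_cV _) oU Ct Ux e1.
have [K K0 [d2 d20 [_ lip]]] := Ck1_lipschitz (spanned_cV _) oU Ct Ux.
have e2 : 0 < e / (2 * K) by rewrite divr_gt0// mulr_gt0.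
near=> q => r Vqr.
have gq : `|r - covector c p l (fwd c q - fwd c p)| <= e / (2 * K) * `|fwd c q - fwd c p|.
  by move: r Vqr; near: q; exact: gV.
have cq : dom c q by near: q; exact: (near_dom hA).
have [dq dq1] : dom d q /\ `|fwd d q - fwd d p| < d1 by near: q; exact: near_chart_ball.
have [_ dq2] : dom d q /\ `|fwd d q - fwd d p| < d2 by near: q; exact: near_chart_ball.
have p1 : `|fwd d p - fwd d p| < d1 by rewrite subrr normr0.
have p2 : `|fwd d p - fwd d p| < d2 by rewrite subrr normr0.
have tq : transition d c (fwd d q) = fwd c q by rewrite /transition (fwdK hA).
have tp : transition d c (fwd d p) = fwd c p by rewrite /transition (fwdK hA).
have := strict _ _ _ dq1 p1 p1; have := lip _ _ dq2 p2; rewrite tq tp; move: gq.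
set z := fwd c q - fwd c p; set z' := fwd d q - fwd d p => gq zK zD.
have DE : 'D_z' (transition d c) (fwd d p) = left_matrix k c p *m (invmx (left_matrix k d p) *m z').
  have := left_translate_transition hA hk hk1 (invmx (left_matrix k d p) *m z') hd hc dp cp.
  rewrite (left_translateE hA hk hk1 _ hd dp) (left_translateE hA hk hk1 _ hc cp).
  have BN : left_matrix k d p *m (invmx (left_matrix k d p) *m z') = z'.
    by rewrite mulmxA (mulmxV (left_matrix_unit hA hk hk1 hd dp)) mul1mx.
  by rewrite BN => <-.
have cov : covector c p l ('D_z' (transition d c) (fwd d p)) = covector d p l z'.
  by rewrite DE (covector_left _ _ hc cp) mulmxA.
move: zD cov; set Dz := 'D_z' _ _ => zD cov.
have -> : r - covector d p l z' = (r - covector c p l z) + covector c p l (z - Dz).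
  by rewrite (covectorB c p l z Dz) cov; ring.
apply: (le_trans (ler_normD _ _)).
have b1 : `|r - covector c p l z| <= e / 2 * `|z'|.
  apply: (le_trans gq); apply: (@le_trans _ _ (e / (2 * K) * (K * `|z'|))).
    by apply: ler_wpM2l => //; exact: ltW.
  by rewrite mulrA; apply: ler_wpM2r => //; rewrite le_eqVlt; apply/orP; left; apply/eqP; field; lra.
have b2 : `|covector c p l (z - Dz)| <= e / 2 * `|z'|.
  apply: (le_trans (covector_norm _ _ _ _)); rewrite -/lN.
  apply: (@le_trans _ _ (lN * (e / (2 * (lN + 1)) * `|z'|))); first exact: ler_wpM2l.
  rewrite mulrA; apply: ler_wpM2r => //.
  rewrite mulrA ler_pdivrMr ?mulr_gt0 ?ltr_wpDl//; nra.
by rewrite (splitr e) mulrDl lerD.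
Unshelve. all: by end_near. Qed.

Variables (w : G -> R -> E) (S : set R) (pw : piecewise A w S).
Variables (T0 Tf : R) (hT0 : 0 <= T0) (hTf : T0 < Tf).
Variables (L phi : G -> R) (hL : C1 A L) (hphi : C1 A phi).
Variables (g : R -> G) (hg : sol A k w S T0 Tf g).
Variables (rho : R -> 'rV[R]_n) (crho : continuous rho).
Hypothesis rhoTf : rho Tf = row_of (Dg Ex phi (g Tf)).
Hypothesis drho : forall t, T0 < t < Tf -> ~ S t ->
  is_derive t 1 rho
    (- (rho t *m (matrix_of (Dg Ex (fun p => w p t) (g t)) - matrix_of (ad k (w (g t) t))))
     - row_of (Dg Ex L (g t))).

Definition cost_to_go (a : R) h : R :=
  \int[lebesgue_measure]_(t in `[a, Tf]) L (h t) + phi (h Tf).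

Definition reachable (a : R) : Prop :=
  \forall q \near g a, exists2 h, sol A k w S a Tf h & h a = q.

(* A relation, since q may have no trajectory. *)
Definition cost_rel (a : R) q r : Prop :=
  exists h, [/\ sol A k w S a Tf h, h a = q & r = cost_to_go a h - cost_to_go a g].

(** Reachability accompanies the gradient, which alone would hold vacuously where no trajectory
    starts. *)
Definition costate_is_gradient (a : R) : Prop :=
  reachable a /\ forall c, A c -> dom c (g a) -> gradient (cost_rel a) c (g a) (rho a).

Lemma continuous_running h : continuous h -> continuous (fun t => L (h t)).
Proof. by move=> ch t; apply: (continuous_comp (ch t)); exact: C1_continuous. Qed.

Lemma costate_is_gradient_end : costate_is_gradient Tf.
Proof.
split.
  (* On the empty open interval from [Tf] to [Tf] every continuous curve is a solution. *)
  near=> q; exists (fun=> q) => //; split; first by move=> ?; exact: cvg_cst.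
  by move=> t ?; lra.
move=> c hc cg e e0.
have cp := img_fwd cg.
have [d1 d10 [_ strict]] := Ck1_strict (spanned_cV _) (open_img hA hc) (hphi hc) cp e0.
near=> q => r [h [[ch _] hq ->]].
have [cq dq1] : dom c q /\ `|fwd c q - fwd c (g Tf)| < d1 by near: q; exact: near_chart_ball.
have int0 h' : \int[lebesgue_measure]_(t in `[Tf, Tf]) L (h' t) = 0.
  by rewrite set_itv1 Rintegral_set1.
have p1 : `|fwd c (g Tf) - fwd c (g Tf)| < d1 by rewrite subrr normr0.
have := strict _ _ _ dq1 p1 p1; rewrite !(fwdK hA)//.
rewrite /cost_to_go !int0 !add0r hq rhoTf.
set z := fwd c q - _.
have -> : covector c (g Tf) (row_of (Dg Ex phi (g Tf))) z = 'D_z (fun x => phi (bwd c x)) (fwd c (g Tf)).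
  rewrite /covector -mulmxA (row_of_linear _ (Dg_linear hA hk hk1 hEx hc cg (hphi hc))).
  rewrite (DgE hA hk hk1 hEx _ hc cg); last first.
    exact: (Ck1_differentiable (spanned_cV _) (open_img hA hc) (hphi hc) cp).
  rewrite (left_translateE hA hk hk1 _ hc cg) mulmxA mulmxV ?mul1mx//.
  exact: (left_matrix_unit hA hk hk1 hc cg).
by [].
Unshelve. all: by end_near. Qed.

Lemma continuous_left_matrix c h (t : R) : A c -> dom c (h t) -> {for t, continuous h} ->
  {for t, continuous (fun s => left_matrix k c (h s))}.
Proof.
move=> hc ct ch; apply: cvg_mx => i j.
have -> : (fun s => left_matrix k c (h s) i j) = (fun s => left_translate k c (h s) (delta_mx j 0) i 0).
  by apply/funext => s; rewrite mxE.
have cv : {for t, continuous (fun s => left_vf k c (delta_mx j 0) (fwd c (h s)) i 0)}.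
  have c1 : {for t, continuous (fun s => left_vf k c (delta_mx j 0) (fwd c (h s)))}.
    apply: (@continuous_comp _ _ _ (fun s => fwd c (h s)) (left_vf k c (delta_mx j 0))).
      by apply: (continuous_comp ch); exact: (continuous_fwd hA).
    exact: (Ck_continuous (Ck_left_vf hA hk hk1 _ 1 hc) (img_fwd ct)).
  by apply: (continuous_comp (g := fun M : E => M i 0) c1); exact: coord_continuous.
rewrite mxE; have -> : left_translate k c (h t) (delta_mx j 0) i 0 =
    left_vf k c (delta_mx j 0) (fwd c (h t)) i 0 by rewrite /left_vf (fwdK hA).
apply: cvg_trans cv; apply: near_eq_cvg; near=> s; rewrite /left_vf (fwdK hA hc)//.
by near: s; apply: ch; exact: (near_dom hA).
Unshelve. all: by end_near. Qed.

Lemma cost_to_goB (a b : R) h h' : a <= b -> b <= Tf -> continuous h -> continuous h' ->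
  cost_to_go a h - cost_to_go a h' =
  (cost_to_go b h - cost_to_go b h') +
  (\int[lebesgue_measure]_(t in `[a, b]) L (h t) - \int[lebesgue_measure]_(t in `[a, b]) L (h' t)).
Proof.
move=> ab bT ch ch'; rewrite /cost_to_go.
rewrite (integral_segmentD (continuous_running ch) ab bT).
rewrite (integral_segmentD (continuous_running ch') ab bT).
by ring.
Qed.

Lemma continuous_covector c h (r : R -> 'rV[R]_n) (t : R) : A c -> dom c (h t) ->
  {for t, continuous h} -> {for t, continuous r} ->
  {for t, continuous (fun s => r s *m invmx (left_matrix k c (h s)))}.
Proof.
move=> hc ct ch cr.
suff cN : {for t, continuous (fun s => invmx (left_matrix k c (h s)))} by exact: cvg_mulmx cr cN.
apply: continuous_invmx; last exact: continuous_left_matrix.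
near=> s; apply: (left_matrix_unit hA hk hk1 hc).
by near: s; apply: ch; exact: (near_dom hA).
Unshelve. all: by end_near. Qed.

Section Step.
Variables (c : chart R n G) (hc : A c) (H : E * R -> E) (m : G -> R -> E).
Variables (HR : represents c H m) (x0 : E) (s r d a b : R).
Hypotheses (box : ode_box (cylinder c) (chart_vf k c H) x0 s r d)
  (mode : mode_on A w S a b m) (ads : `|a - s| <= d) (bds : `|b - s| <= d)
  (T0a : T0 <= a) (ab : a <= b) (bTf : b <= Tf)
  (gbox : forall t, a <= t <= b -> dom c (g t) /\ `|fwd c (g t) - x0| < r).

Let x t := fwd c (g t).

Let X := chart_vf k c H.

Let a0 : 0 <= a. Proof. exact: le_trans T0a. Qed.

Let sab : sol A k w S a b g. Proof. exact: sol_sub hg. Qed.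

Let xsol : solves X x a b.
Proof. by apply: (sol_chart hA hk hk1 hc HR mode a0 _ sab) => t /gbox[]. Qed.

Lemma flow_in_box q : dom c q -> `|fwd c q - x0| <= r ->
  exists y : R -> E, [/\ y a = fwd c q, solves X y a b,
    forall t, a <= t <= b -> img c (y t),
    forall t, a <= t <= b -> `|y t - x t| <= 2 * `|fwd c q - x a| &
    sol A k w S a b (fun t => bwd c (y (clamp a b t)))].
Proof.
move=> cq qr; have [[r0 d0] inU _ ex stab] := box.
have [y ya Hy] := ex a (fwd c q) ads qr.
have td t : a <= t <= b -> `|t - s| <= d.
  by move=> tab; move: ads bds; rewrite !ler_norml; lra.
have ys : solves X y a b.
  split=> t tab; first by apply: is_derive_continuous (Hy t (td t tab)).2.
  by apply: (Hy t (td t _)).2; lra.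
have iy t : a <= t <= b -> img c (y t).
  by move=> tab; have := inU _ _ (Hy t (td t tab)).1 (td t tab).
exists y; split; [exact: ya|exact: ys|exact: iy| |].
  move=> t tab; rewrite -ya; apply: (stab y x a b ads bds ys xsol) => //.
    move=> t' tab'; split; first exact: (Hy t' (td t' tab')).1.
    by apply: (le_trans (ltW (gbox tab').2)); lra.
  by rewrite lexx ab.
exact: (chart_sol hA hk hk1 hc HR mode a0 ab iy ys).
Qed.

Let aab : a <= a <= b. Proof. by rewrite lexx ab. Qed.
Let bab : a <= b <= b. Proof. by rewrite lexx ab. Qed.

Lemma near_in_box (e : R) : 0 < e ->
  \forall q \near g a, [/\ dom c q, `|fwd c q - x0| <= r & `|fwd c q - x a| < e].
Proof.
move=> e0; have [ca xr] := gbox aab.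
have r1 : 0 < r - `|x a - x0| by rewrite subr_gt0.
near=> q.
have [cq q1] : dom c q /\ `|fwd c q - fwd c (g a)| < r - `|x a - x0|.
  by near: q; exact: near_chart_ball.
split => //; last by near: q; apply: filterS (near_chart_ball hc ca e0) => ? [].
rewrite -(subrK (x a) (fwd c q)) -addrA; apply: (le_trans (ler_normD _ _)).
by rewrite -lerBrDr ltW.
Unshelve. all: by end_near. Qed.

(** From [q] the mode is followed inside the box up to [b], ending near [g b]; a trajectory from
    there is appended. *)
Lemma reachable_step : reachable b -> reachable a.
Proof.
move=> Rb; have [cb _] := gbox bab.
have bxb : bwd c (x b) = g b by rewrite /x (fwdK hA).
have cbw : {for x b, continuous (bwd c)} by apply: (continuous_bwd hA hc); exact: img_fwd.
have : \forall y \near x b, exists2 h, sol A k w S b Tf h & h b = bwd c y.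
  by rewrite /reachable -bxb in Rb; exact: (cbw _ Rb).
move=> /nbhs_ballP[d1 /= d10 Hd1].
have d12 : 0 < d1 / 2 by rewrite divr_gt0.
apply: filterS (near_in_box d12) => q [cq qr qa].
have [y [ya ys iy yx h1s]] := flow_in_box cq qr.
have [|h2 h2s h2b] := Hd1 (y b).
  by rewrite -ball_normE /= distrC; apply: (le_lt_trans (yx b bab)); lra.
set h1 := fun t => bwd c (y (clamp a b t)) in h1s.
have h12 : h1 b = h2 b by rewrite h2b /h1 clamp_id.
exists (splice b h1 h2); first exact: (sol_splice hA hk hk1 pw a0 ab bTf h12 h1s h2s).
by rewrite spliceL// /h1 clamp_id// ya (fwdK hA).
Qed.

Let p t := rho t *m invmx (left_matrix k c (g t)).

Let ell (xt : E * R) := L (bwd c xt.1).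

Let Cell : Ck 1 (cylinder c) ell.
Proof.
apply: (Ck_affine (U := img c) (f := fun y => L (bwd c y)) (p := fun xt : E * R => xt.1)
  (A := fun xt => xt.1)); first by [].
- by move=> xt; exact: cvg_fst.
- exact: hL.
Qed.

Let derive_ell (y : E) (t : R) z : 'D_(z, (0 : R)) ell (y, t) = 'D_z (fun x => L (bwd c x)) y.
Proof.
exact: (derive_affine (fun x => L (bwd c x)) (p := fun xt : E * R => xt.1)
    (A := fun xt : E * R => xt.1) (y, t) (z, 0) (fun _ _ _ => erefl)).2.
Qed.

Let dx t : a < t < b -> is_derive t 1 x (X (x t, t)).
Proof. exact: xsol.2. Qed.

Lemma derivative_pairing (y : R -> E) (t : R) : a < t < b -> solves X y a b ->
  is_derive t 1 (fun s => (p s *m (y s - x s)) 0 0)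
    ((p t *m (X (y t, t) - X (x t, t) - 'D_(y t - x t, (0 : R)) X (x t, t))) 0 0
     - 'D_(y t - x t, (0 : R)) ell (x t, t)).
Proof.
move=> tab [cy dy]; have tab' : a <= t <= b by lra.
have [nS wm] := mode.2 t tab; have t0 : 0 <= t by move: a0 tab; lra.
have [ct _] := gbox tab'.
rewrite derive_ell.
have wmE : (fun q => w q t) = (fun q => m q t) by apply/funext.
have dr : is_derive t 1 rho
    (- (rho t *m (matrix_of (Dg Ex (fun q => m q t) (g t)) - matrix_of (ad k (m (g t) t))))
     - row_of (Dg Ex L (g t))).
  have tT : T0 < t < Tf by move: T0a bTf tab => h1 h2 /andP[h3 h4]; apply/andP; split; lra.
  by have := drho tT nS; rewrite wmE wm.
have dz : is_derive t 1 (fun s => y s - x s) (X (y t, t) - X (x t, t)).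
  by apply: is_deriveB; [exact: dy|exact: dx].
exact: (adjoint_derivative hA hk hk1 hEx hc HR t0 ct (hg.1 t) (dx tab) hL dr dz).
Qed.

(** [Phi] is the pairing plus the difference of the running costs accumulated so far. Its derivative
    consists of linearisation remainders alone, so [Phi] is nearly constant on [[a, b]], which moves
    the estimate from [b] to [a]. *)
Lemma gradient_step : gradient (cost_rel b) c (g b) (rho b) ->
  gradient (cost_rel a) c (g a) (rho a).
Proof.
move=> gb e e0.
have [cb _] := gbox bab.
have cp t : a <= t <= b -> {for t, continuous p}.
  move=> tab.
  exact: (continuous_covector hc (gbox tab).1 (hg.1 t) (@crho t)).
have [M M0 pM] := bounded_segment ab cp.
pose len := b - a + 1.
have len0 : 0 < len by rewrite /len ltr_wpDl// subr_ge0.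
(* As [|y - x| <= 2 * zeta], the remainders of the field and of the running cost contribute at most
   [e / (8 * len) * (2 * zeta)] each per unit of time, together at most [e / 2 * zeta] over
   [[a, b]]. The gradient at [b], used with [e / 4], takes the other half. The [+ 1] avoids dividing
   by zero. *)
pose e1 := e / (8 * (n%:R * M + 1) * len).
pose e2 := e / (8 * len).
have nM0 : 0 <= n%:R * M by rewrite mulr_ge0.
have e10 : 0 < e1 by rewrite divr_gt0// !mulr_gt0// ltr_wpDl.
have e20 : 0 < e2 by rewrite divr_gt0// mulr_gt0.
have ix t : a <= t <= b -> img c (x t) by move=> /gbox[ct _]; exact: img_fwd.
have [d1 d10 lin1] := uniform_linearization hA hc (Ck_chart_vf hA hk hk1 hc HR.1) ab xsol.1 ix e10.
have [d2 d20 lin2] := uniform_linearization hA hc Cell ab xsol.1 ix e20.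
have e4 : 0 < e / 4 by rewrite divr_gt0.
have bxb : bwd c (x b) = g b by rewrite /x (fwdK hA).
have cbw : {for x b, continuous (bwd c)} by apply: (continuous_bwd hA hc); exact: img_fwd.
have : \forall y \near x b, forall r', cost_rel b (bwd c y) r' ->
    `|r' - covector c (g b) (rho b) (fwd c (bwd c y) - x b)| <= e / 4 * `|fwd c (bwd c y) - x b|.
  have gb4 : \forall q \near bwd c (x b), forall r', cost_rel b q r' ->
    `|r' - covector c (g b) (rho b) (fwd c q - x b)| <= e / 4 * `|fwd c q - x b|.
    by rewrite bxb; exact: (gb _ e4).
  exact: (cbw _ gb4).
move=> /nbhs_ballP[d3 /= d30 Hd3].
(* The halving absorbs the stability factor 2. *)
pose dm := Num.min (Num.min d1 d2) d3 / 2.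
have dm0 : 0 < dm by rewrite divr_gt0// !lt_min d10 d20.
apply: filterS (near_in_box dm0) => q [cq qr qa] r' [h [hs hq ->]].
have [y [ya ys iy yx h1s]] := flow_in_box cq qr.
set zeta := `|fwd c q - x a| in qa yx *.
have zeta0 : 0 <= zeta by exact: normr_ge0.
have z2 : 2 * zeta < Num.min (Num.min d1 d2) d3 by move: qa; rewrite /dm; lra.
have [zd1 zd2 zd3] : [/\ 2 * zeta < d1, 2 * zeta < d2 & 2 * zeta < d3].
  by move: z2; rewrite !lt_min => /andP[/andP[-> ->] ->].
(* By uniqueness every trajectory from [q] follows [y] on [[a, b]], so the estimate reaches all
   values related to [q]. *)
have hE t : a <= t <= b -> h t = bwd c (y t).
  move=> tab; rewrite -[in RHS](clamp_id tab).
  apply: (sol_unique hA hk hk1 pw a0 _ _ h1s tab).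
    by rewrite clamp_id// ya (fwdK hA).
  exact: sol_sub hs.
have hs' : sol A k w S b Tf h by exact: sol_sub hs.
have costb : cost_rel b (bwd c (y b)) (cost_to_go b h - cost_to_go b g).
  by exists h; split => //; exact: hE.
have := Hd3 (y b); rewrite -ball_normE /= distrC => /(_ (le_lt_trans (yx b bab) zd3) _ costb).
rewrite (bwdK hA hc (iy b bab)) -/(p b) => gradb.
have ch := hs.1; have cg := hg.1.
have cLh := continuous_running ch; have cLg := continuous_running cg.
rewrite (cost_to_goB ab bTf ch cg).
have am : a - 1 < a by rewrite ltrBlDr ltrDl.
rewrite (primitive_integral cLh am ab) (primitive_integral cLg am ab).
pose Phi t := (p t *m (y t - x t)) 0 0 +
  (primitive (a - 1) (fun t => L (h t)) t - primitive (a - 1) (fun t => L (g t)) t).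
pose rem t := X (y t, t) - X (x t, t) - 'D_(y t - x t, (0 : R)) X (x t, t).
pose reml t := ell (y t, t) - ell (x t, t) - 'D_(y t - x t, (0 : R)) ell (x t, t).
have dprim h' t : continuous (fun t => L (h' t)) -> a <= t <= b ->
    is_derive t 1 (primitive (a - 1) (fun t => L (h' t))) (L (h' t)).
  by move=> cL tab; apply: is_derive_primitive => //; lra.
have dPhi t : a < t < b -> is_derive t 1 Phi ((p t *m rem t) 0 0 + reml t).
  move=> tab; have tab' : a <= t <= b by case/andP: tab => /ltW-> /ltW->.
  have D := is_deriveD (derivative_pairing tab ys)
    (is_deriveB (dprim h t cLh tab') (dprim g t cLg tab')).
  apply: (is_derive_eq D); rewrite /reml /rem /ell /= -(hE t tab').
  have -> : bwd c (x t) = g t by rewrite /x (fwdK hA)//; exact: (gbox tab').1.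
  by rewrite -addrA; congr (_ + _); rewrite addrC.
have cPhi t : a <= t <= b -> {for t, continuous Phi}.
  move=> tab; apply: cvgD; last by apply: cvgB; apply: (is_derive_continuous (dprim _ t _ tab)).
  have cz : {for t, continuous (fun s => y s - x s)}.
    by apply: cvgB; [exact: ys.1|exact: xsol.1].
  have cpz : {for t, continuous (fun s => p s *m (y s - x s))} by exact: cvg_mulmx (cp t tab) cz.
  by apply: (continuous_comp (g := fun M : 'M[R]_1 => M 0 0) cpz); exact: coord_continuous.
have bPhi t : a < t < b -> `|(p t *m rem t) 0 0 + reml t| <= (e / (4 * len)) * (2 * zeta).
  move=> tab; have tab' : a <= t <= b by case/andP: tab => /ltW-> /ltW->.
  have z1 := yx t tab'.
  have b1 : `|rem t| <= e1 * `|y t - x t| by apply: lin1 => //; exact: le_lt_trans zd1.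
  have b2 : `|reml t| <= e2 * `|y t - x t| by apply: lin2 => //; exact: le_lt_trans zd2.
  have b3 : `|(p t *m rem t) 0 0| <= n%:R * M * (e1 * `|y t - x t|).
    apply: (le_trans (cV_coord_le _ _ _)); apply: (le_trans (mulmx_norm_le _ _)).
    apply: ler_pM => //.
    by apply: ler_wpM2l => //; exact: pM.
  apply: (le_trans (ler_normD _ _)).
  have b4 : n%:R * M * e1 <= e / (8 * len).
    rewrite /e1; exact: scaled_quotient_le.
  have b5 : n%:R * M * (e1 * `|y t - x t|) <= e / (8 * len) * `|y t - x t|.
    by rewrite mulrA ler_wpM2r.
  apply: (le_trans (lerD (le_trans b3 b5) b2)); rewrite -mulrDl.
  have -> : e / (8 * len) + e2 = e / (4 * len) by rewrite /e2; field; rewrite gt_eqF.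
  by apply: ler_wpM2l => //; rewrite divr_ge0 ?ltW// mulr_gt0.
have := mean_value0 ab cPhi dPhi bPhi; rewrite /Phi ya => mv.
have fin : e / (4 * len) * (2 * zeta) * (b - a) <= e / 2 * zeta.
  by apply: average_le => //; rewrite /len lerDl.
have gb' : `|cost_to_go b h - cost_to_go b g - (p b *m (y b - x b)) 0 0| <= e / 2 * zeta.
  by apply: (le_trans gradb); have := yx b bab; nra.
rewrite -/(p a) -/(x a); set Lh := primitive _ _ in mv *.
set Lg := primitive _ (fun t => L (g t)) in mv *.
have -> : cost_to_go b h - cost_to_go b g + (Lh b - Lh a - (Lg b - Lg a)) -
    covector c (g a) (rho a) (fwd c q - x a) =
  (cost_to_go b h - cost_to_go b g - (p b *m (y b - x b)) 0 0) +
  ((p b *m (y b - x b)) 0 0 + (Lh b - Lg b) - ((p a *m (fwd c q - x a)) 0 0 + (Lh a - Lg a))).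
  by rewrite /covector -/(p a); ring.
apply: (le_trans (ler_normD _ _)).
have -> : e * zeta = e / 2 * zeta + e / 2 * zeta by field.
by apply: lerD => //; apply: le_trans fin.
Qed.

Lemma costate_step : costate_is_gradient b -> costate_is_gradient a.
Proof.
move=> [Rb gb]; split; first exact: reachable_step.
have [ca _] := gbox aab; have [cb _] := gbox bab.
move=> c' hc' ca'; apply: (gradient_chart hc hc' ca ca').
exact: gradient_step (gb c hc cb).
Qed.

End Step.

Lemma box_along m h (t0 : R) : C1_time A m -> continuous h ->
  exists c H (r d : R), [/\ A c, represents c H m, 0 < d,
    ode_box (cylinder c) (chart_vf k c H) (fwd c (h t0)) t0 r d &
    exists2 d', 0 < d' <= d & forall t, `|t - t0| < d' ->
      dom c (h t) /\ `|fwd c (h t) - fwd c (h t0)| < r].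
Proof.
move=> Cm ch; have [c hc ct] := lie_cover hA (h t0).
have [H [HR [r [d box]]]] := mode_box hA hk hk1 t0 hc Cm ct.
have [[r0 d0] _ _ _ _] := box.
have [d1 d10 near1] := curve_near hA hc ch ct r0.
exists c, H, r, d; split => //; exists (Num.min d1 d).
  by rewrite lt_min d10 d0 ge_min lexx orbT.
by move=> t; rewrite lt_min => /andP[td _]; exact: near1.
Qed.

(** [Q] composes over adjacent intervals. The short intervals end or begin at the chosen time [s],
    so that a switch at [s] is never interior to them. *)
Theorem costate_gradient a : T0 <= a <= Tf -> costate_is_gradient a.
Proof.
move=> /andP[T0a aTf].
pose Q (u v : R) := costate_is_gradient v -> costate_is_gradient u.
suff : Q a Tf by apply; exact: costate_is_gradient_end.
apply: interval_chain => //; first by move=> u v w' _ _ _ _ Quv Qvw /Qvw.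
move=> s /andP[as_ sT].
have [d d0 [[m1 mode1] [m2 mode2] _]] := pw s.
have [c1 [H1 [r1 [e1 [hc1 HR1 e10 box1 [d1 /andP[d10 de1] near1]]]]]] := box_along s mode1.1 hg.1.
have [c2 [H2 [r2 [e2 [hc2 HR2 e20 box2 [d2 /andP[d20 de2] near2]]]]]] := box_along s mode2.1 hg.1.
exists (Num.min d (Num.min d1 d2)); first by rewrite !lt_min d0 d10 d20.
split=> [u au|v vT sv].
  rewrite ltrBlDr -ltrBlDl !lt_min => /and3P[ud ud1 ud2] us.
  have mode : mode_on A w S u s m1 by apply: mode_on_sub mode1 => //; lra.
  apply: (costate_step hc1 HR1 box1 mode) => //.
  - by rewrite ler0_norm; lra.
  - by rewrite subrr normr0 ltW.
  - exact: le_trans au.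
  - by move=> t tus; apply: near1; rewrite ler0_norm; lra.
rewrite -ltrBlDl !lt_min => /and3P[vd vd1 vd2].
have mode : mode_on A w S s v m2 by apply: mode_on_sub mode2 => //; lra.
apply: (costate_step hc2 HR2 box2 mode) => //.
- by rewrite subrr normr0 ltW.
- by rewrite ger0_norm; lra.
- exact: le_trans as_.
- by move=> t tus; apply: near2; rewrite ger0_norm; lra.
Qed.

End CostToGo.

(** * Moving a switching time *)

Section Drift.
Context {R : realType} {n : nat}.
Local Notation E := 'cV[R]_n.
Variables (U : set (E * R)) (X : E * R -> E) (x0 : E) (t0 r d : R).
Hypothesis box : ode_box U X x0 t0 r d.

(** The bound on the field keeps the curve near [x0], where by continuity its velocity is nearly
    [X (x0, t0)]. The time [s] at which the curve is known to be near [x0] is arbitrary in [[u, v]],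
    because the curves in use are prescribed at either end. *)
Lemma solves_drift e : {for (x0, t0), continuous X} -> 0 < e ->
  exists2 de, 0 < de <= d & forall y u v s, `|u - t0| < de -> `|v - t0| < de ->
    u <= s <= v -> solves X y u v -> (forall t, u <= t <= v -> `|y t - x0| <= 2 * r) ->
    `|y s - x0| < de ->
    (forall t, u <= t <= v -> `|y t - x0| < e) /\
    `|y v - y u - (v - u) *: X (x0, t0)| <= e * (v - u).
Proof.
have [[r0 d0] _ [M HM] _ _] := box; move=> cX e0.
have : \forall xt \near (x0, t0), `|X (x0, t0) - X xt| < e.
  by move/cvgrPdist_lt: cX; apply.
move=> /nbhs_ballP[eta /= eta0 Heta].
pose kap := Num.min e eta; have kap0 : 0 < kap by rewrite lt_min e0.
have M1 : 0 < 2 * (`|M| + 1) by rewrite mulr_gt0// ltr_wpDl.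
have q0 : 0 < kap / (2 * (`|M| + 1)) by rewrite divr_gt0.
(* With this radius, [|y s - x0| + |M| * |t - s| < de + 2 * |M| * de <= kap]. *)
exists (Num.min d (kap / (2 * (`|M| + 1)))).
  by rewrite lt_min d0 q0 ge_min lexx.
set de := Num.min _ _ => y u v s ud vd suv ys y2 ysx.
have de0 : 0 < de by exact: le_lt_trans ysx.
have ded : de <= d by rewrite ge_min lexx.
have dek : de * (2 * (`|M| + 1)) <= kap.
  by rewrite -ler_pdivlMr// /de ge_min lexx orbT.
have ke : kap <= e by rewrite ge_min lexx.
have keta : kap <= eta by rewrite ge_min lexx orbT.
have Mp : 0 <= `|M| by [].
have td t : u <= t <= v -> `|t - t0| < de.
  by move=> tuv; move: ud vd; rewrite !ltr_norml; lra.
have yk t : u <= t <= v -> `|y t - x0| < kap.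
  move=> tuv.
  have yts : `|y t - y s| <= `|M| * `|t - s|.
    apply: (@mean_value_abs _ _ y (fun t => X (y t, t))) => x xst.
    - by apply: ys.1; exact: (between_minmax suv tuv).
    - by apply: ys.2; exact: (strictly_between_minmax suv tuv).
    - have xuv := strictly_between_minmax suv tuv xst.
      apply: le_trans (ler_norm M); apply: HM.
        by apply: y2; lra.
      by apply: ltW; apply: (lt_le_trans (td x _) ded); lra.
  have ts : `|t - s| < 2 * de.
    by move: (td _ tuv) (td _ suv); rewrite !ltr_norml; lra.
  rewrite -(subrK (y s) (y t)) -addrA; apply: (le_lt_trans (ler_normD _ _)).
  by nra.
split=> [t tuv|]; first exact: lt_le_trans (yk t tuv) ke.
apply: (@mean_value _ _ y (fun t => X (y t, t))).
- by case/andP: suv; exact: le_trans.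
- exact: ys.1.
- exact: ys.2.
move=> t tuv; have tuv' : u <= t <= v by lra.
rewrite distrC; apply: ltW; apply: Heta; split => /=; rewrite -ball_normE /= distrC.
  exact: lt_le_trans (yk t tuv') keta.
by apply: (lt_le_trans (td t tuv')); nra.
Qed.

Lemma flow_drift e : {for (x0, t0), continuous X} -> 0 < e ->
  exists2 de, 0 < de & forall u v s y0, `|u - t0| < de -> `|v - t0| < de ->
    u <= s <= v -> `|y0 - x0| < de -> exists y : R -> E, [/\ y s = y0, solves X y u v,
      forall t, u <= t <= v -> U (y t, t), forall t, u <= t <= v -> `|y t - x0| < e &
      `|y v - y u - (v - u) *: X (x0, t0)| <= e * (v - u)].
Proof.
move=> cX e0; have [de /andP[de0 ded] drift] := solves_drift cX e0.
have [[r0 d0] inU _ ex _] := box.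
exists (Num.min de r); first by rewrite lt_min de0.
move=> u v s y0; rewrite !lt_min => /andP[ud _] /andP[vd _] suv /andP[yd /ltW yr].
have td t : u <= t <= v -> `|t - t0| <= d.
  by move: ud vd; rewrite ler_norml !ltr_norml; lra.
have [y ys Hy] := ex s y0 (td s suv) yr; exists y.
have yX : solves X y u v.
  split=> t tuv; first exact: is_derive_continuous (Hy t (td t tuv)).2.
  by apply: (Hy t (td t _)).2; lra.
have [||ye yV] := drift y u v s ud vd suv yX.
- by move=> t /td/Hy[].
- by rewrite ys.
split => // t tuv; have tdt := td t tuv.
exact: (inU _ _ (Hy t tdt).1 tdt).
Qed.

End Drift.

(** * First-order change of the cost when the mode is replaced on a short interval *)

Section Needle.
Context {R : realType} {n : nat} {G : GroupTopological.type}.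
Variables (A : set (chart R n G)) (hA : is_lie_group A).
Variables (k : chart R n G) (hk : A k) (hk1 : dom k 1%g).
Local Notation E := 'cV[R]_n.
Variables (w : G -> R -> E) (S : set R) (pw : piecewise A w S).
Variables (T0 Tf : R) (hT0 : 0 <= T0).
Variables (L phi : G -> R) (hL : C1 A L).
Variables (g : R -> G) (hg : sol A k w S T0 Tf g) (rho : R -> 'rV[R]_n).
Variables (tau : R) (T0tau : T0 <= tau) (tauTf : tau <= Tf).
Hypothesis grad : costate_is_gradient A k w S Tf L phi g rho tau.

Section Chart.
Variables (c : chart R n G) (hc : A c) (ctau : dom c (g tau)).
Let x0 := fwd c (g tau).

(** A displacement known to first order is enough: the gradient property is applied to [y] itself,
    and the covector is small on the deviation of [y - x0] from [de *: V]. *)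
Lemma gradient_along (V : E) e : 0 < e -> exists2 eta, 0 < eta &
  forall (de : R) y r', 0 <= de -> de < eta -> `|y - x0 - de *: V| <= eta * de ->
    cost_rel A k w S Tf L phi g tau (bwd c y) r' ->
    `|r' - de * covector k c (g tau) (rho tau) V| <= e * de.
Proof.
move=> e0; have [_ /(_ c hc ctau) gr] := grad.
have V1 : 0 < `|V| + 1 by rewrite ltr_wpDl.
have e10 : 0 < e / (2 * (`|V| + 1)) by rewrite divr_gt0// mulr_gt0.
have bx : bwd c x0 = g tau by rewrite /x0 (fwdK hA).
have cbw : {for x0, continuous (bwd c)} by apply: (continuous_bwd hA hc); exact: img_fwd.
have : \forall y \near x0, img c y /\ forall r', cost_rel A k w S Tf L phi g tau (bwd c y) r' ->
    `|r' - covector k c (g tau) (rho tau) (fwd c (bwd c y) - x0)| <=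
    e / (2 * (`|V| + 1)) * `|fwd c (bwd c y) - x0|.
  near=> y; split; first by near: y; apply: (near_img hA hc); exact: img_fwd.
  near: y; apply: (cbw [set q | forall r', cost_rel A k w S Tf L phi g tau q r' ->
    `|r' - covector k c (g tau) (rho tau) (fwd c q - x0)| <=
    e / (2 * (`|V| + 1)) * `|fwd c q - x0|]).
  by rewrite bx; exact: gr.
move=> /nbhs_ballP[d3 /= d30 Hd3].
pose lN := n%:R * `|rho tau *m invmx (left_matrix k c (g tau))|.
have lN0 : 0 <= lN by rewrite mulr_ge0.
have q0 : 0 < e / (2 * (lN + 1)) by rewrite divr_gt0// mulr_gt0// ltr_wpDl.
(* With [eta <= 1] the displacement is at most [de * (|V| + 1)], which the second bound keeps below
   [d3]; by the third bound the deviation costs at most [e / 2 * de]. *)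
exists (Num.min 1 (Num.min (d3 / (`|V| + 1)) (e / (2 * (lN + 1))))).
  by rewrite !lt_min ltr01 q0 divr_gt0.
set eta := Num.min _ _ => de y r' de0 deeta yV cr.
have eta1 : eta <= 1 by rewrite ge_min lexx.
have etad : eta * (`|V| + 1) <= d3.
  by rewrite -ler_pdivlMr// /eta !ge_min lexx orbT.
have etal : eta * (2 * (lN + 1)) <= e.
  by rewrite -ler_pdivlMr ?mulr_gt0 ?ltr_wpDl// /eta !ge_min lexx !orbT.
have eta0 : 0 < eta by exact: le_lt_trans deeta.
have yx : `|y - x0| <= de * (`|V| + 1).
  rewrite -(subrK (de *: V) (y - x0)); apply: (le_trans (ler_normD _ _)).
  by rewrite normrZ (ger0_norm de0); nra.
have [|iy Hr] := Hd3 y.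
  by rewrite -ball_normE /= distrC; apply: (le_lt_trans yx); nra.
have := Hr r' cr; rewrite (bwdK hA hc iy) => H1.
have -> : r' - de * covector k c (g tau) (rho tau) V =
  (r' - covector k c (g tau) (rho tau) (y - x0)) + covector k c (g tau) (rho tau) (y - x0 - de *: V).
  rewrite (covectorB _ _ _ _ _ (de *: V)).
  have -> : covector k c (g tau) (rho tau) (de *: V) = de * covector k c (g tau) (rho tau) V.
    by rewrite /covector -scalemxAr mxE.
  by ring.
apply: (le_trans (ler_normD _ _)).
have b1 : `|r' - covector k c (g tau) (rho tau) (y - x0)| <= e / 2 * de.
  apply: (le_trans H1); apply: (@le_trans _ _ (e / (2 * (`|V| + 1)) * (de * (`|V| + 1)))).
    by rewrite ler_wpM2l// ltW.
  by rewrite le_eqVlt; apply/orP; left; apply/eqP; field; lra.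
have b2 : `|covector k c (g tau) (rho tau) (y - x0 - de *: V)| <= e / 2 * de.
  apply: (le_trans (covector_norm _ _ _ _ _)); rewrite -/lN.
  apply: (@le_trans _ _ (lN * (eta * de))); first exact: ler_wpM2l.
  by rewrite mulrA ler_wpM2r//; nra.
by rewrite (splitr e) mulrDl lerD.
Unshelve. all: by end_near. Qed.

(** To first order the running cost over a short interval depends on its length only, so the running
    costs of the old and the new curve cancel. *)
Lemma running_along e : 0 < e -> exists2 eta, 0 < eta &
  forall u v h (y : R -> E), u <= v -> continuous h ->
    (forall t, u <= t <= v -> h t = bwd c (y t) /\ `|y t - x0| < eta) ->
    `|\int[lebesgue_measure]_(t in `[u, v]) L (h t) - (v - u) * L (g tau)| <= e * (v - u).
Proof.
move=> e0; have bx : bwd c x0 = g tau by rewrite /x0 (fwdK hA).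
have cL : {for x0, continuous (fun y => L (bwd c y))}.
  exact: (Ck_continuous (hL hc) (img_fwd ctau)).
have : \forall y \near x0, `|L (bwd c x0) - L (bwd c y)| < e.
  by move/cvgrPdist_lt: cL; apply.
move=> /nbhs_ballP[eta /= eta0 Heta]; exists eta => // u v h y uv ch Hy.
apply: integral_segment_bound => //; first exact: (continuous_running hA hL ch).
move=> t tuv; have [-> yt] := Hy t tuv; rewrite distrC -bx; apply: ltW; apply: Heta.
by rewrite -ball_normE /= distrC.
Qed.

Lemma reach_ball : exists2 eta, 0 < eta & forall y, `|y - x0| < eta ->
  img c y /\ exists2 h, sol A k w S tau Tf h & h tau = bwd c y.
Proof.
have [re _] := grad.
have bx : bwd c x0 = g tau by rewrite /x0 (fwdK hA).
have cbw : {for x0, continuous (bwd c)} by apply: (continuous_bwd hA hc); exact: img_fwd.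
have : \forall y \near x0, img c y /\ exists2 h, sol A k w S tau Tf h & h tau = bwd c y.
  near=> y; split; first by near: y; apply: (near_img hA hc); exact: img_fwd.
  by near: y; move: re; rewrite /reachable -bx => /cbw.
move=> /nbhs_ballP[eta /= eta0 Heta]; exists eta => // y yx; apply: Heta.
by rewrite -ball_normE /= distrC.
Unshelve. all: by end_near. Qed.

End Chart.

Lemma cost_to_go_eq a h h' : a <= Tf -> (forall t, a <= t <= Tf -> h t = h' t) ->
  cost_to_go Tf L phi a h = cost_to_go Tf L phi a h'.
Proof.
move=> aT hh; rewrite /cost_to_go hh ?aT ?lexx//; congr (_ + _).
by apply: eq_Rintegral => t; rewrite inE /= in_itv /= => /hh ->.
Qed.

Lemma mode_on_self m u v : C1_time A m -> mode_on A m set0 u v m.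
Proof. by move=> Cm; split=> // t _; split=> // -[]. Qed.

(** The first-order change of the cost, per unit of time, when [m] is replaced by [m'] near
    [tau]. *)
Definition jump (m m' : G -> R -> E) : R :=
  (rho tau *m (m' (g tau) tau - m (g tau) tau)) 0 0.

Lemma jumpE c H H' m m' : A c -> dom c (g tau) -> represents c H m -> represents c H' m' ->
  covector k c (g tau) (rho tau)
    (chart_vf k c H' (fwd c (g tau), tau) - chart_vf k c H (fwd c (g tau), tau)) = jump m m'.
Proof.
move=> hc ct HR HR'; have t0 : 0 <= tau by exact: le_trans T0tau.
rewrite (chart_vfE hA hk hk1 hc HR ct t0) (chart_vfE hA hk hk1 hc HR' ct t0).
rewrite !(left_translateE hA hk hk1 _ hc ct) -mulmxBr.
exact: (covector_left hA hk hk1).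
Qed.

Lemma continuous_chart_vf c H m : A c -> dom c (g tau) -> represents c H m ->
  {for (fwd c (g tau), tau), continuous (chart_vf k c H)}.
Proof.
move=> hc ct [CH _].
by apply: (Ck_continuous (Ck_chart_vf hA hk hk1 hc CH)); exact: img_fwd.
Qed.

(* The old mode is run backwards from y s to time tau, so that beyond s the new
   trajectory is one of the unperturbed system started at time tau. *)
Lemma needle_right d0 m m' e : 0 < d0 -> mode_on A w S tau (tau + d0) m -> C1_time A m' ->
  0 < e -> exists2 de, 0 < de & forall s, tau < s -> s < tau + de -> s <= Tf ->
    exists y h, [/\ sol A k m' set0 tau s y, y tau = g tau, sol A k w S s Tf h, y s = h s &
      `|cost_to_go Tf L phi tau (splice s y h) - cost_to_go Tf L phi tau g -
        (s - tau) * jump m m'| <= e * (s - tau)].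
Proof.
move=> d00 mode Cm' e0.
have [c hc ct] := lie_cover hA (g tau).
have [H [HR [r [d box]]]] := mode_box hA hk hk1 tau hc mode.1 ct.
have [H' [HR' [r' [d' box']]]] := mode_box hA hk hk1 tau hc Cm' ct.
have cX := continuous_chart_vf hc ct HR; have cX' := continuous_chart_vf hc ct HR'.
have t0 : 0 <= tau by exact: le_trans T0tau.
set x0 := fwd c (g tau) in box box' cX cX' *.
set X := chart_vf k c H in box cX *; set X' := chart_vf k c H' in box' cX' *.
pose V := X' (x0, tau) - X (x0, tau).
have e3 : 0 < e / 3 by rewrite divr_gt0.
have [n1 n10 gradV] := gradient_along hc ct V e3.
have [n2 n20 runs] := running_along hc ct e3.
have [n3 n30 reach] := reach_ball hc ct.
(* [n1 / 2] because the drift errors of the new and of the old mode add up in the displacement at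
   [tau]. *)
pose e2 := Num.min (Num.min (n1 / 2) n2) n3.
have e20 : 0 < e2 by rewrite !lt_min n20 n30 divr_gt0.
have [e2a e2b e2c] : [/\ e2 <= n1 / 2, e2 <= n2 & e2 <= n3].
  by split; rewrite /e2 !ge_min lexx ?orbT.
have [d2 d20 drift] := flow_drift box cX e20.
(* The new mode has to end within [d2] of [x0], where the old mode can be started backwards. *)
have e2'0 : 0 < Num.min e2 d2 by rewrite lt_min e20.
have [d1 d10 drift'] := flow_drift box' cX' e2'0.
exists (Num.min (Num.min d1 d2) (Num.min d0 n1)); first by rewrite !lt_min d10 d20 d00.
move=> s ts; rewrite -ltrBlDl !lt_min => /andP[/andP[s1 s2] /andP[s0 sn]] sT.
have st : 0 <= s - tau by rewrite subr_ge0 ltW.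
have ts' : tau <= s <= s by rewrite lexx ltW.
have tt' : tau <= tau <= s by rewrite lexx ltW.
have [||||y [yt ys Uy ye yV]] := drift' tau s tau x0.
- by rewrite subrr normr0.
- by rewrite ger0_norm.
- exact: tt'.
- by rewrite subrr normr0.
have {}ye t : tau <= t <= s -> `|y t - x0| < e2 /\ `|y t - x0| < d2.
  by move=> /ye; rewrite lt_min => /andP[].
have [||||z [zs zsol Uz ze zV]] := drift tau s s (y s).
- by rewrite subrr normr0.
- by rewrite ger0_norm.
- exact: ts'.
- exact: (ye s ts').2.
have [|iz [h hsol ht]] := reach (z tau); first exact: lt_le_trans (ze _ tt') e2c.
have modes : mode_on A w S tau s m.
  by apply: mode_on_sub mode; [exact: lexx|rewrite -lerBlDl ltW].
have zzsol := chart_sol hA hk hk1 hc HR modes t0 (ltW ts) Uz zsol.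
have hz t : tau <= t <= s -> h t = bwd c (z t).
  move=> tu; rewrite -[in RHS](clamp_id tu).
  apply: (sol_unique hA hk hk1 pw t0 _ _ zzsol tu); first by rewrite clamp_id.
  exact: sol_sub hsol.
have yysol := chart_sol hA hk hk1 hc HR' (mode_on_self tau s Cm') t0 (ltW ts)
  Uy ys.
set yy := fun t => bwd c (y (clamp tau s t)) in yysol.
have yyh : yy s = h s by rewrite /yy clamp_id// hz// zs.
exists yy, h; split => //.
- by rewrite /yy clamp_id// yt (fwdK hA).
- exact: (sol_sub (ltW ts) (lexx Tf) hsol).
set hh := splice s yy h.
have chh : continuous hh by apply: continuous_splice => //; [exact: yysol.1|exact: hsol.1].
have cost1 : `|(cost_to_go Tf L phi tau h - cost_to_go Tf L phi tau g) -
    (s - tau) * jump m m'| <= e / 3 * (s - tau).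
  rewrite -(jumpE hc ct HR HR').
  apply: (gradV _ (z tau)) => //; last by exists h; split.
  (* As [z s = y s] and [y tau = x0], the displacement at [tau] is the drift of [y] minus the drift
     of [z]. *)
  have -> : z tau - x0 - (s - tau) *: V =
      (y s - y tau - (s - tau) *: X' (x0, tau)) - (z s - z tau - (s - tau) *: X (x0, tau)).
    rewrite zs yt /V scalerBr; move: (_ *: X' _) (_ *: X _) => p q; zmodule.
  apply: (le_trans (ler_normB _ _)).
  apply: (le_trans (lerD yV zV)).
  rewrite -mulrDl ler_wpM2r//.
  by rewrite (splitr n1) lerD// (le_trans _ e2a)// ge_min lexx.
have cost2 := cost_to_goB hA phi hL (ltW ts) sT chh hsol.1.
have cost3 : cost_to_go Tf L phi s hh = cost_to_go Tf L phi s h.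
  by apply: cost_to_go_eq => // t /andP[st' _]; rewrite /hh spliceR.
have run1 := runs tau s hh y (ltW ts) chh.
have run2 := runs tau s h z (ltW ts) hsol.1.
have {}run1 : `|\int[lebesgue_measure]_(t in `[tau, s]) L (hh t) - (s - tau) * L (g tau)| <=
    e / 3 * (s - tau).
  apply: run1 => t tu; split; last exact: lt_le_trans (ye t tu).1 e2b.
  by rewrite /hh spliceL ?/yy ?clamp_id//; case/andP: tu.
have {}run2 : `|\int[lebesgue_measure]_(t in `[tau, s]) L (h t) - (s - tau) * L (g tau)| <=
    e / 3 * (s - tau).
  by apply: run2 => t tu; split; [exact: hz|exact: lt_le_trans (ze t tu) e2b].
apply: (error_sum _ cost1 run1 run2).
by move: cost2; rewrite cost3 subrr add0r => <-; ring.
Qed.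

(** The new mode starts from [g s], and on [[s, tau]] the curve [g] itself is the one under the old
    mode. Both arrive at time [tau], where the gradient at [g tau] is applied to the difference of
    the two end points. *)
Lemma needle_left d0 m m' e : 0 < d0 -> mode_on A w S (tau - d0) tau m -> C1_time A m' ->
  0 < e -> exists2 de, 0 < de & forall s, s < tau -> tau - de < s -> T0 <= s ->
    exists y h, [/\ sol A k m' set0 s tau y, y s = g s, sol A k w S tau Tf h, y tau = h tau &
      `|cost_to_go Tf L phi s (splice tau y h) - cost_to_go Tf L phi s g -
        (tau - s) * jump m m'| <= e * (tau - s)].
Proof.
move=> d00 mode Cm' e0.
have [c hc ct] := lie_cover hA (g tau).
have [H [HR [r [d box]]]] := mode_box hA hk hk1 tau hc mode.1 ct.
have [H' [HR' [r' [d' box']]]] := mode_box hA hk hk1 tau hc Cm' ct.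
have [[r0 _] _ _ _ _] := box.
have cX := continuous_chart_vf hc ct HR; have cX' := continuous_chart_vf hc ct HR'.
set x0 := fwd c (g tau) in box box' cX cX' *.
set X := chart_vf k c H in box cX *; set X' := chart_vf k c H' in box' cX' *.
pose V := X' (x0, tau) - X (x0, tau).
have e3 : 0 < e / 3 by rewrite divr_gt0.
have [n1 n10 gradV] := gradient_along hc ct V e3.
have [n2 n20 runs] := running_along hc ct e3.
have [n3 n30 reach] := reach_ball hc ct.
pose e2 := Num.min (Num.min (n1 / 2) n2) n3.
have e20 : 0 < e2 by rewrite !lt_min n20 n30 divr_gt0.
have [e2a e2b e2c] : [/\ e2 <= n1 / 2, e2 <= n2 & e2 <= n3].
  by split; rewrite /e2 !ge_min lexx ?orbT.
have [d2 /andP[d20 _] drift] := solves_drift box cX e20.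
have [d1 d10 drift'] := flow_drift box' cX' e20.
have rd0 : 0 < Num.min d1 (Num.min d2 r) by rewrite !lt_min d10 d20.
have [d3 d30 gnear] := curve_near hA hc hg.1 ct rd0.
exists (Num.min (Num.min d1 d2) (Num.min d0 (Num.min n1 d3))).
  by rewrite !lt_min d10 d20 d00 n10.
move=> s st; rewrite ltrBlDr -ltrBlDl !lt_min => /andP[/andP[s1 s2] /and3P[s0 sn s3]] T0s.
have s00 : 0 <= s by exact: le_trans T0s.
have ts : 0 <= tau - s by rewrite subr_ge0 ltW.
have ss' : s <= s <= tau by rewrite lexx ltW.
have tt' : s <= tau <= tau by rewrite lexx ltW.
have gn t : s <= t <= tau -> dom c (g t) /\ `|fwd c (g t) - x0| < Num.min d1 (Num.min d2 r).
  by move=> tst; apply: gnear; rewrite distrC ger0_norm; lra.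
have modes : mode_on A w S s tau m.
  by apply: mode_on_sub mode; [rewrite lerBlDr -lerBlDl ltW|exact: lexx].
have gsol : sol A k w S s tau g by exact: (sol_sub T0s tauTf hg).
have xsol := sol_chart hA hk hk1 hc HR modes s00 (fun t tst => (gn t tst).1) gsol.
have [||||| xe xV] := drift _ s tau tau _ _ _ xsol.
- by rewrite distrC ger0_norm.
- by rewrite subrr normr0.
- exact: tt'.
- move=> t /gn[_]; rewrite !lt_min => /and3P[_ _ /ltW tr].
  by rewrite (le_trans tr)// mulr_natl mulr2n lerDl ltW.
- by rewrite subrr normr0.
have [||||y [ys ysol Uy ye yV]] := drift' s tau s (fwd c (g s)).
- by rewrite distrC ger0_norm.
- by rewrite subrr normr0.
- exact: ss'.
- by have [_] := gn s ss'; rewrite !lt_min => /andP[].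
have [|iy [h hsol ht]] := reach (y tau); first exact: lt_le_trans (ye _ tt') e2c.
have yysol := chart_sol hA hk hk1 hc HR' (mode_on_self s tau Cm') s00 (ltW st) Uy ysol.
set yy := fun t => bwd c (y (clamp s tau t)) in yysol.
have yyh : yy tau = h tau by rewrite /yy clamp_id// ht.
exists yy, h; split => //.
  by rewrite /yy clamp_id// ys (fwdK hA hc (gn s ss').1).
set hh := splice tau yy h.
have chh : continuous hh by apply: continuous_splice => //; [exact: yysol.1|exact: hsol.1].
have hhsol : sol A k w S tau Tf hh.
  by apply: (sol_eq chh _ hsol) => t /andP[tT _]; rewrite /hh spliceR// ltW.
have cost1 : `|(cost_to_go Tf L phi tau hh - cost_to_go Tf L phi tau g) -
    (tau - s) * jump m m'| <= e / 3 * (tau - s).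
  rewrite -(jumpE hc ct HR HR').
  apply: (gradV _ (y tau)) => //; last by exists hh; split => //; rewrite /hh spliceR.
  have -> : y tau - x0 - (tau - s) *: V =
      (y tau - y s - (tau - s) *: X' (x0, tau)) -
      (x0 - fwd c (g s) - (tau - s) *: X (x0, tau)).
    rewrite ys /V scalerBr; move: (_ *: X' _) (_ *: X _) => p q; zmodule.
  apply: (le_trans (ler_normB _ _)).
  apply: (le_trans (lerD yV xV)).
  by rewrite -mulrDl ler_wpM2r// (splitr n1) lerD.
have cost2 := cost_to_goB hA phi hL (ltW st) tauTf chh hg.1.
have run1 : `|\int[lebesgue_measure]_(t in `[s, tau]) L (hh t) - (tau - s) * L (g tau)| <=
    e / 3 * (tau - s).
  apply: (runs s tau hh y (ltW st) chh) => t tu; split; last exact: lt_le_trans (ye t tu) e2b.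
  by rewrite /hh spliceL ?/yy ?clamp_id//; case/andP: tu.
have run2 : `|\int[lebesgue_measure]_(t in `[s, tau]) L (g t) - (tau - s) * L (g tau)| <=
    e / 3 * (tau - s).
  apply: (runs s tau g _ (ltW st) hg.1) => t tu; split; last exact: lt_le_trans (xe t tu) e2b.
  by rewrite (fwdK hA hc (gn t tu).1).
exact: (error_sum cost2 cost1 run1 run2).
Qed.

End Needle.

Lemma continuous_within_clamp {R : realType} (Y : topologicalType) (f : R -> Y) (a b : R) :
  a <= b -> {within `[a, b], continuous f} -> continuous (f \o clamp a b).
Proof.
move=> ab /subspace_continuousP cf t.
have tab : [set` `[a, b]] (clamp a b t) by rewrite /= in_itv /=; exact: clampP.
move=> U /(cf _ tab) cU.
have {}cU : \forall x \near clamp a b t, [set` `[a, b]] x -> U (f x) by exact: cU.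
have cs : \forall s \near t, [set` `[a, b]] (clamp a b s) -> U (f (clamp a b s)).
  exact: (continuous_clamp cU).
change (\forall s \near t, U (f (clamp a b s))).
apply: filterS cs => s; apply.
by rewrite /= in_itv /=; exact: clampP.
Qed.

Lemma unit_step_const {R : realType} (u v a t t' : R) : u < t < v -> u < t' < v ->
  ~ (u < a < v) -> unit_step (t - a) = unit_step (t' - a).
Proof.
move=> tuv tuv' auv; rewrite /unit_step !subr_ge0.
case: (leP a t) => at_; case: (leP a t') => at'; rewrite //=; case: auv; lra.
Qed.

(** * The switched system as a piecewise field *)

Section Switching.
Context {R : realType} {n N : nat} {G : GroupTopological.type}.
Variables (A : set (chart R n G)) (hA : is_lie_group A).
Variables (k : chart R n G) (hk : A k) (hk1 : dom k 1%g).
Variables (T0 Tf : R) (hT0 : 0 <= T0) (hTf : T0 < Tf).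
Variables (f : 'I_N.+1 -> G -> R -> 'cV[R]_n) (hf : forall i, C1_time A (f i)).
Implicit Types (T : 'cV[R]_N) (h : R -> G).

Lemma C1_time_sum m (a : 'I_m -> R) (h : 'I_m -> G -> R -> 'cV[R]_n) :
  (forall i, C1_time A (h i)) -> C1_time A (fun p t => \sum_i a i *: h i p t).
Proof.
move=> Ch c hc; have Hs i := cid2 (Ch i c hc).
pose H i := sval (Hs i).
exists (fun xt => \sum_i a i *: H i xt).
  apply: (Ck_sum (open_cylinder hA hc)) => i.
  apply: (Ck_scale (open_cylinder hA hc)); first exact: Ck_cst.
  by rewrite /H; case: (Hs i).
move=> x t ix t0; apply: eq_bigr => i _; congr (_ *: _).
by rewrite /H; case: (Hs i) => /= Hi _; apply.
Qed.

Lemma C1_time_addZ (a : R) (h h' : G -> R -> 'cV[R]_n) : C1_time A h -> C1_time A h' ->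
  C1_time A (fun p t => h p t + a *: h' p t).
Proof.
move=> Ch Ch' c hc; have [H CH HE] := Ch c hc; have [H' CH' HE'] := Ch' c hc.
exists (fun xt => H xt + a *: H' xt); last first.
  by move=> x t ix t0; rewrite HE ?HE'.
apply: (Ck_add (open_cylinder hA hc) CH).
by apply: (Ck_scale (open_cylinder hA hc)) => //; exact: Ck_cst.
Qed.

(** Contains [T0] and [Tf] as well, where the first and the last step jump. *)
Definition switch_set T : set R := [set t | exists j : 'I_N.+2, t = stime T0 Tf T j].

Lemma stime_ord T (i : 'I_N) : stime T0 Tf T i.+1 = T i 0.
Proof. by rewrite /= valK. Qed.

Lemma nonswitchingE T t : T0 < t < Tf -> ~ switch_set T t <-> forall i, t != T i 0.
Proof.
move=> tT; split=> [nS i|nT [[[|j] jN] /= tj]].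
- apply/eqP => ti; apply: nS; have iN : (i.+1 < N.+2)%N by rewrite ltnS ltnW// ltnS.
  by exists (Ordinal iN); rewrite ti -stime_ord.
- by move: tT; rewrite tj ltxx.
- move: tj; case: insubP => [i _ _ ti|_ ti]; first by move: (nT i); rewrite ti eqxx.
  by move: tT; rewrite ti ltxx andbF.
Qed.

(** The steps are constant between switching times and are frozen at the midpoint. With unordered
    transition times the result is a signed combination of the [f i], still of class C1. *)
Lemma switched_mode T u v : u < v -> (forall t, u < t < v -> ~ switch_set T t) ->
  exists m, mode_on A (switched T0 Tf f T) (switch_set T) u v m.
Proof.
move=> uv nS; pose t' := (u + v) / 2.
exists (fun p t => \sum_(i < N.+1)
  (unit_step (t' - stime T0 Tf T i) - unit_step (t' - stime T0 Tf T i.+1)) *: f i p t).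
split=> [|t tuv]; first exact: C1_time_sum.
split=> [|p]; first exact: nS.
have stepE (j : nat) : (j < N.+2)%N ->
    unit_step (t - stime T0 Tf T j) = unit_step (t' - stime T0 Tf T j).
  move=> jN; apply: (unit_step_const tuv); first by rewrite /t'; lra.
  by move=> /nS; apply; exists (Ordinal jN).
apply: eq_bigr => i _; congr (_ *: _); rewrite !stepE//.
  by rewrite ltnS.
by apply: ltnW; rewrite ltnS.
Qed.

Lemma piecewise_switched T : piecewise A (switched T0 Tf f T) (switch_set T).
Proof.
move=> t.
have near_switch (j : 'I_N.+2) : \forall s \near t, s != t -> s != stime T0 Tf T j.
  have [->|tj] := eqVneq t (stime T0 Tf T j); first by near=> s.
  apply/nbhs_ballP; exists `|t - stime T0 Tf T j| => /=; first by rewrite normr_gt0 subr_eq0.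
  by move=> s; rewrite /ball /= => ts _; apply: contraTneq ts => ->; rewrite ltxx.
have near_switches : \forall s \near t, forall j : 'I_N.+2, s != t -> s != stime T0 Tf T j.
  exact: filter_forall near_switch.
move: near_switches => /nbhs_ballP[d /= d0 Hd]; exists d => //.
have free s : t - d < s < t + d -> s != t -> ~ switch_set T s.
  move=> sd st [j sj]; have bs : ball t d s by rewrite /ball /= ltr_norml; lra.
  by have := Hd s bs j st; rewrite -sj eqxx.
split.
- apply: switched_mode => [|s sd]; first by lra.
  by apply: free; [lra|apply/eqP => st; lra].
- apply: switched_mode => [|s sd]; first by lra.
  by apply: free; [lra|apply/eqP => st; lra].
- move=> nSt; apply: switched_mode => [|s sd]; first by lra.
  by have [->//|] := eqVneq s t; exact: free.
Unshelve. all: by end_near. Qed.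

Section Perturbation.
Variables (i : 'I_N) (T : 'cV[R]_N) (s : R).

Definition move_switch : 'cV[R]_N := \col_j (if j == i then s else T j 0).

Let T' := move_switch.

Lemma step_move (t : R) j : unit_step (t - stime T0 Tf T' j) =
  unit_step (t - stime T0 Tf T j) +
  (j == i.+1)%:R * (unit_step (t - s) - unit_step (t - T i 0)).
Proof.
case: j => [|j] /=; first by rewrite mul0r addr0.
rewrite eqSS; case: insubP => [i' _ ij|/negP jN].
  rewrite mxE -ij val_eqE; case: eqP => [->|_]; last by rewrite mul0r addr0.
  by rewrite mul1r addrCA subrr addr0.
case: eqP => [ji|_]; last by rewrite mul0r addr0.
by case: jN; rewrite ji.
Qed.

(** [T i 0] occurs only in the step that closes mode [i] and in the step that opens mode [i + 1]. *)
Lemma switched_move p t : switched T0 Tf f T' p t = switched T0 Tf f T p t +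
  (unit_step (t - T i 0) - unit_step (t - s)) *:
    (f (widen_ord (leqnSn N) i) p t - f (lift ord0 i) p t).
Proof.
set de := unit_step (t - T i 0) - unit_step (t - s).
have pick (j0 : 'I_N.+1) : \sum_(j < N.+1) (j == j0)%:R *: f j p t = f j0 p t.
  rewrite (bigD1 j0)//= eqxx scale1r big1 ?addr0// => j /negPf ->.
  by rewrite scale0r.
rewrite scalerBr -(pick (widen_ord _ _)) -(pick (lift ord0 i)) !scaler_sumr /switched.
have := step_move t; move: (stime T0 Tf T') (stime T0 Tf T) => st' st stE.
rewrite -sumrB -big_split /=; apply: eq_bigr => j _.
rewrite (stE j) (stE j.+1) !scalerA -scalerBl -scalerDl; congr (_ *: _).
rewrite eqSS -(inj_eq val_inj j) -(inj_eq val_inj j) /= /bump /= add1n /de.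
by ring.
Qed.

Lemma switch_set_move t : switch_set T t -> t = T i 0 \/ switch_set T' t.
Proof.
move=> [[[|j] jN] /= tj]; first by right; exists ord0.
move: tj; case: insubP => [i' _ ij ti|jN' ti].
  have [ii|ii] := eqVneq i' i; first by left; rewrite ti ii.
  right; exists (Ordinal jN) => /=; rewrite -ij valK mxE (negPf ii) ti.
  by [].
by right; exists (Ordinal jN) => /=; rewrite insubN.
Qed.

End Perturbation.

Variables (g0 : G) (L phi : G -> R).

Lemma trajectory_sol T h : is_trajectory A k T0 Tf f g0 T h ->
  sol A k (switched T0 Tf f T) (switch_set T) T0 Tf (h \o clamp T0 Tf).
Proof.
move=> [ch _ dh]; split; first exact: (continuous_within_clamp (ltW hTf) ch).
move=> t tT nS; rewrite /= clamp_id; last by lra.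
apply: (@near_eq_velocity _ _ _ A k h).
  apply: filterS (near_between tT) => x xT.
  by rewrite /= clamp_id//; lra.
by apply: dh; split => //; exact/nonswitchingE.
Qed.

Lemma sol_trajectory T h : sol A k (switched T0 Tf f T) (switch_set T) T0 Tf h ->
  h T0 = g0 -> is_trajectory A k T0 Tf f g0 T h.
Proof.
move=> [ch dh] h0; split => [|//|t [tT nT]]; first exact: continuous_subspaceT.
by apply: dh => //; exact/nonswitchingE.
Qed.

(** [trajectory] selects some trajectory; [h] shows that there is one, and uniqueness identifies the
    selected one with [h] on [[T0, Tf]]. *)
Lemma cost_sol T h : sol A k (switched T0 Tf f T) (switch_set T) T0 Tf h ->
  h T0 = g0 -> cost A k T0 Tf f g0 L phi T = cost_to_go Tf L phi T0 h.
Proof.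
move=> hs h0; have ht := sol_trajectory hs h0.
have tr : is_trajectory A k T0 Tf f g0 T (trajectory A k T0 Tf f g0 T).
  rewrite /trajectory.
  exact: (@xgetPex _ (fun=> g0) [set h | is_trajectory A k T0 Tf f g0 T h] (ex_intro _ h ht)).
apply: (cost_to_go_eq L phi (ltW hTf)) => t tT.
have e0 : (trajectory A k T0 Tf f g0 T \o clamp T0 Tf) T0 = h T0.
  by rewrite /= clamp_id ?lexx ?ltW// h0; case: tr.
have := sol_unique hA hk hk1 (piecewise_switched T) hT0 e0 (trajectory_sol tr) hs tT.
by rewrite /= clamp_id.
Qed.

End Switching.

(** * The cost after moving one transition time *)

Section MoveSwitch.
Context {R : realType} {n N : nat} {G : GroupTopological.type}.
Variables (A : set (chart R n G)) (hA : is_lie_group A).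
Variables (k : chart R n G) (hk : A k) (hk1 : dom k 1%g).
Variables (T0 Tf : R) (hT0 : 0 <= T0) (hTf : T0 < Tf).
Variables (f : 'I_N.+1 -> G -> R -> 'cV[R]_n) (hf : forall i, C1_time A (f i)).
Variables (L phi : G -> R) (hL : C1 A L) (g0 : G).
Variables (T : 'cV[R]_N) (g : R -> G) (rho : R -> 'rV[R]_n) (i : 'I_N).
Local Notation w := (switched T0 Tf f T).
Local Notation S := (switch_set T0 Tf T).
Local Notation tau := (T i 0).
Local Notation fi := (f (widen_ord (leqnSn N) i)).
Local Notation fi1 := (f (lift ord0 i)).
Local Notation J := (cost A k T0 Tf f g0 L phi).
Local Notation ctg := (cost_to_go Tf L phi).
Hypotheses (hg : sol A k w S T0 Tf g) (g0E : g T0 = g0).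
Hypotheses (T0tau : T0 <= tau) (tauTf : tau <= Tf).
Hypothesis grad : costate_is_gradient A k w S Tf L phi g rho tau.

Let pw := piecewise_switched hA T0 Tf hf.

Let slope := (rho tau *m (fi (g tau) tau - fi1 (g tau) tau)) 0 0.

(** The field between the old and the new position of the transition time, if [m] was active there
    before: [a] is 1 for a move to the right and -1 for a move to the left. If [m] is [fi1] and [a]
    is 1, it is [fi]. *)
Definition switch_mode (a : R) (m : G -> R -> 'cV[R]_n) (p : G) (t : R) :=
  m p t + a *: fi p t + (- a) *: fi1 p t.

Lemma C1_time_switch_mode a m : C1_time A m -> C1_time A (switch_mode a m).
Proof.
move=> Cm.
exact: (C1_time_addZ hA (- a) (C1_time_addZ hA a Cm (hf _)) (hf _)).
Qed.

Lemma jump_switch_mode a m : jump g rho tau m (switch_mode a m) = a * slope.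
Proof.
rewrite /jump /switch_mode.
have -> : m (g tau) tau + a *: fi (g tau) tau + (- a) *: fi1 (g tau) tau - m (g tau) tau =
    a *: (fi (g tau) tau - fi1 (g tau) tau).
  rewrite scaleNr scalerBr; move: (a *: _) (a *: _) (m _ _) => u v x; zmodule.
by rewrite -scalemxAr mxE.
Qed.

Lemma cost_to_go_prefix a b h h' : a <= b -> b <= Tf -> continuous h -> continuous h' ->
  (forall t, a <= t <= b -> h t = h' t) -> ctg a h - ctg a h' = ctg b h - ctg b h'.
Proof.
move=> ab bT ch ch' hh; rewrite (cost_to_goB hA phi hL ab bT ch ch').
have -> : \int[lebesgue_measure]_(t in `[a, b]) L (h t) =
    \int[lebesgue_measure]_(t in `[a, b]) L (h' t).
  by apply: eq_Rintegral => t; rewrite inE /= in_itv /= => /hh ->.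
by rewrite subrr addr0.
Qed.

Let tau0 : 0 <= tau. Proof. exact: le_trans T0tau. Qed.

(** The new trajectory is [g] up to [tau], the needle up to [s], and a solution of the unmoved
    system afterwards; the difference of steps in [wE] is 0, 1 and 0 on these intervals. *)
Lemma move_right e : 0 < e -> exists2 de, 0 < de & forall s, tau < s -> s < tau + de ->
  s <= Tf -> `|J (move_switch i T s) - J T - (s - tau) * slope| <= e * (s - tau).
Proof.
move=> e0; have [d d0 [_ [m mode] _]] := pw T tau.
have [de de0 needle] := needle_right hA hk hk1 (pw T) hT0 hL T0tau grad d0 mode
  (C1_time_switch_mode 1 mode.1) e0.
exists (Num.min d de); first by rewrite lt_min d0.
move=> s ts; rewrite -ltrBlDl lt_min => /andP[sd sde] sT.
have [|y [h [ysol yt hsol yh]]] := needle s ts _ sT; first by rewrite -ltrBlDl.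
rewrite jump_switch_mode mul1r => est.
have sy : splice s y h tau = g tau by rewrite spliceL// ltW.
pose h' := splice tau g (splice s y h).
have wE p t : switched T0 Tf f (move_switch i T s) p t = w p t +
    (unit_step (t - tau) - unit_step (t - s)) *: (fi p t - fi1 p t) by exact: switched_move.
have sol1 : sol A k (switched T0 Tf f (move_switch i T s)) (switch_set T0 Tf (move_switch i T s))
    T0 tau g.
  have gsol : sol A k w S T0 tau g by exact: (sol_sub (lexx T0) tauTf hg).
  apply: sol_ext gsol => t tT nS'; split=> [/(switch_set_move i s)[tt|//]|p].
    by move: tT; rewrite tt ltxx andbF.
  rewrite wE /unit_step.
  have -> : (0 <= t - tau) = false by apply/negbTE; rewrite -ltNge; lra.
  have -> : (0 <= t - s) = false by apply/negbTE; rewrite -ltNge; lra.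
  by rewrite subrr scale0r addr0.
have sol2 : sol A k (switched T0 Tf f (move_switch i T s)) (switch_set T0 Tf (move_switch i T s))
    tau s y.
  apply: sol_ext ysol => t tts _; split=> [[]|p].
  have -> : switch_mode 1 m p t = w p t + (fi p t - fi1 p t).
    rewrite /switch_mode scale1r scaleN1r (mode.2 t _).2 ?addrA//; lra.
  rewrite wE /unit_step.
  have -> : 0 <= t - tau by lra.
  have -> : (0 <= t - s) = false by apply/negbTE; rewrite -ltNge; lra.
  by rewrite subr0 scale1r.
have sol3 : sol A k (switched T0 Tf f (move_switch i T s)) (switch_set T0 Tf (move_switch i T s))
    s Tf h.
  apply: sol_ext hsol => t tT nS'; split=> [/(switch_set_move i s)[tt|//]|p].
    by move: tT; rewrite tt; lra.
  rewrite wE /unit_step.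
  have -> : 0 <= t - tau by lra.
  have -> : 0 <= t - s by lra.
  by rewrite subrr scale0r addr0.
have sol23 := sol_splice hA hk hk1 (pw _) tau0 (ltW ts) sT yh sol2 sol3.
have hsol' := sol_splice hA hk hk1 (pw _) hT0 T0tau tauTf (esym sy) sol1 sol23.
have h'0 : h' T0 = g0 by rewrite /h' spliceL.
rewrite (cost_sol hA hk hk1 hT0 hTf hf L phi hsol' h'0) (cost_sol hA hk hk1 hT0 hTf hf L phi hg g0E).
have -> : ctg T0 h' - ctg T0 g = ctg tau h' - ctg tau g.
  apply: (cost_to_go_prefix T0tau tauTf hsol'.1 hg.1) => t /andP[_ tt].
  by rewrite spliceL.
have -> : ctg tau h' = ctg tau (splice s y h).
  by apply: cost_to_go_eq => // t /andP[tt _]; rewrite /h' spliceR.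
exact: est.
Qed.

(** Between [s] and [tau] the difference of steps is now -1; the sign cancels against that of
    [s - tau]. *)
Lemma move_left e : 0 < e -> exists2 de, 0 < de & forall s, s < tau -> tau - de < s ->
  T0 <= s -> `|J (move_switch i T s) - J T - (s - tau) * slope| <= e * (tau - s).
Proof.
move=> e0; have [d d0 [[m mode] _ _]] := pw T tau.
have [de de0 needle] := needle_left hA hk hk1 hT0 hL hg T0tau tauTf grad d0 mode
  (C1_time_switch_mode (-1) mode.1) e0.
exists (Num.min d de); first by rewrite lt_min d0.
move=> s st; rewrite ltrBlDr -ltrBlDl lt_min => /andP[sd sde] T0s.
have [|y [h [ysol ys hsol yh]]] := needle s st _ T0s; first by rewrite ltrBlDr -ltrBlDl.
rewrite jump_switch_mode => est.
have sy : splice tau y h s = g s by rewrite spliceL// ltW.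
pose h' := splice s g (splice tau y h).
have wE p t : switched T0 Tf f (move_switch i T s) p t = w p t +
    (unit_step (t - tau) - unit_step (t - s)) *: (fi p t - fi1 p t) by exact: switched_move.
have sT : s <= Tf by apply: (le_trans (ltW st)).
have sol1 : sol A k (switched T0 Tf f (move_switch i T s)) (switch_set T0 Tf (move_switch i T s))
    T0 s g.
  have gsol : sol A k w S T0 s g by exact: (sol_sub (lexx T0) sT hg).
  apply: sol_ext gsol => t tT nS'; split=> [/(switch_set_move i s)[tt|//]|p].
    by move: tT; rewrite tt; lra.
  rewrite wE /unit_step.
  have -> : (0 <= t - tau) = false by apply/negbTE; rewrite -ltNge; lra.
  have -> : (0 <= t - s) = false by apply/negbTE; rewrite -ltNge; lra.
  by rewrite subrr scale0r addr0.
have sol2 : sol A k (switched T0 Tf f (move_switch i T s)) (switch_set T0 Tf (move_switch i T s))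
    s tau y.
  apply: sol_ext ysol => t tts _; split=> [[]|p].
  have -> : switch_mode (-1) m p t = w p t - (fi p t - fi1 p t).
    by rewrite /switch_mode opprK scale1r scaleN1r (mode.2 t _).2 ?opprB ?addrA 1?addrAC//; lra.
  rewrite wE /unit_step.
  have -> : (0 <= t - tau) = false by apply/negbTE; rewrite -ltNge; lra.
  have -> : 0 <= t - s by lra.
  by rewrite sub0r scaleN1r.
have sol3 : sol A k (switched T0 Tf f (move_switch i T s)) (switch_set T0 Tf (move_switch i T s))
    tau Tf h.
  apply: sol_ext hsol => t tT nS'; split=> [/(switch_set_move i s)[tt|//]|p].
    by move: tT; rewrite tt ltxx.
  rewrite wE /unit_step.
  have -> : 0 <= t - tau by lra.
  have -> : 0 <= t - s by lra.
  by rewrite subrr scale0r addr0.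
have s0 : 0 <= s by exact: le_trans T0s.
have sol23 := sol_splice hA hk hk1 (pw _) s0 (ltW st) tauTf yh sol2 sol3.
have hsol' := sol_splice hA hk hk1 (pw _) hT0 T0s sT (esym sy) sol1 sol23.
have h'0 : h' T0 = g0 by rewrite /h' spliceL.
rewrite (cost_sol hA hk hk1 hT0 hTf hf L phi hsol' h'0) (cost_sol hA hk hk1 hT0 hTf hf L phi hg g0E).
have -> : ctg T0 h' - ctg T0 g = ctg s h' - ctg s g.
  apply: (cost_to_go_prefix T0s sT hsol'.1 hg.1) => t /andP[_ tt].
  by rewrite spliceL.
have -> : ctg s h' = ctg s (splice tau y h).
  by apply: cost_to_go_eq => // t /andP[tt _]; rewrite /h' spliceR.
have -> : (s - tau) * slope = (tau - s) * (-1 * slope) by ring.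
exact: est.
Qed.

End MoveSwitch.

Lemma stime_mono {R : realType} (N : nat) (T0 Tf : R) (T : 'cV[R]_N) j d :
  (forall j, (j <= N)%N -> stime T0 Tf T j <= stime T0 Tf T j.+1) ->
  (j + d <= N.+1)%N -> stime T0 Tf T j <= stime T0 Tf T (j + d).
Proof.
move=> hT; elim: d => [|d IH]; first by rewrite addn0.
by rewrite addnS => jd; apply: le_trans (hT _ jd); apply: IH; exact: ltnW.
Qed.

Theorem lemma1 (R : realType) (n N : nat) (G : GroupTopological.type)
    (A : set (chart R n G)) (hA : is_lie_group A)
    (k : chart R n G) (hk : A k) (hk1 : dom k 1%g)
    (E : 'cV[R]_n -> G) (hE : is_exponential A k E)
    (T0 Tf : R) (hT0 : 0 <= T0) (hTf : T0 < Tf)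
    (f : 'I_N.+1 -> G -> R -> 'cV[R]_n) (hf : forall i, C1_time A (f i))
    (L phi : G -> R) (hL : C1 A L) (hphi : C1 A phi)
    (g0 : G) (T : 'cV[R]_N)
    (hT : forall j, (j <= N)%N -> stime T0 Tf T j <= stime T0 Tf T j.+1)
    (g : R -> G) (hg : is_trajectory A k T0 Tf f g0 T g)
    (rhoT : R -> 'rV[R]_n)
    (hrho : is_costate k T0 Tf f L phi E T g rhoT) :
  is_mode_gradient T0 Tf (cost A k T0 Tf f g0 L phi) T
    (\col_i (rhoT (T i 0) *m
              (f (widen_ord (leqnSn N) i) (g (T i 0)) (T i 0)
               - f (lift ord0 i) (g (T i 0)) (T i 0))) 0 0).
Proof.
move=> i; set tau := T i 0.
have T0tau : T0 <= tau.
  have := @stime_mono _ _ _ _ _ 0 i.+1 hT; rewrite add0n stime_ord; apply.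
  by rewrite ltnS ltnW.
have tauTf : tau <= Tf.
  have := @stime_mono _ _ _ _ _ i.+1 (N - i) hT.
  rewrite stime_ord addSn subnKC ?(ltnW (ltn_ord i))//= insubN ?ltnn//; exact.
have tautT : T0 <= tau <= Tf by rewrite T0tau.
have gs := trajectory_sol hTf hg.
have [crho rhoTf drho] := hrho.
(* [costate_gradient] works with curves continuous on the whole line, whereas [g] and [rhoT] are
   controlled on [[T0, Tf]] only. *)
pose gc := g \o clamp T0 Tf; pose rc := rhoT \o clamp T0 Tf.
have clampTf : clamp T0 Tf Tf = Tf by rewrite clamp_id// lexx ltW.
have rcTf : rc Tf = row_of (Dg E phi (gc Tf)) by rewrite /rc /gc /= clampTf.
have drc t : T0 < t < Tf -> ~ switch_set T0 Tf T t ->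
  is_derive t 1 rc (- (rc t *m (matrix_of (Dg E (fun p => switched T0 Tf f T p t) (gc t))
      - matrix_of (ad k (switched T0 Tf f T (gc t) t)))) - row_of (Dg E L (gc t))).
  move=> tT nS; have ct : clamp T0 Tf t = t by rewrite clamp_id//; lra.
  have -> : gc t = g t by rewrite /gc /= ct.
  have -> : rc t = rhoT t by rewrite /rc /= ct.
  have nsw : nonswitching T0 Tf T t by split => //; exact/(nonswitchingE T tT).
  apply: near_eq_is_derive (drho t nsw).
  by apply: filterS (near_between tT) => x xT; rewrite /rc /= clamp_id//; lra.
have g0E : gc T0 = g0 by rewrite /gc /= clamp_id ?lexx ?ltW//; case: hg.
have grad := costate_gradient hA hk hk1 hE (piecewise_switched hA T0 Tf hf T) hT0 hL hphi gs
  (continuous_within_clamp (ltW hTf) crho) rcTf drc tautT.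
have gct : gc tau = g tau by rewrite /gc /= clamp_id.
have rct : rc tau = rhoT tau by rewrite /rc /= clamp_id.
rewrite mxE -/tau -gct -rct; set l := (_ *m _) 0 0.
apply/cvgrPdist_le => e e0.
have [d1 d10 right] := move_right hA hk hk1 hT0 hTf hf hL gs g0E T0tau tauTf grad e0.
have [d2 d20 left] := move_left hA hk hk1 hT0 hTf hf hL gs g0E T0tau tauTf grad e0.
(* [s] lies on either side of [tau] within [[T0, Tf]]; if [tau] is an endpoint, one side is empty
   and the limit is one-sided. *)
rewrite near_withinE; apply/nbhs_ballP; exists (Num.min d1 d2) => /=.
  by rewrite lt_min d10.
move=> s; rewrite /ball /= lt_min !ltr_norml => /andP[bs1 bs2] st.
rewrite /= in_itv /= => /andP[T0s sTf].
rewrite -/(move_switch i T s); move: (cost A k T0 Tf f g0 L phi) right left => J right left.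
have sn : s - tau != 0 by rewrite subr_eq0.
have -> : l - (J (move_switch i T s) - J T) / (s - tau) =
    - ((J (move_switch i T s) - J T - (s - tau) * l) / (s - tau)) by field.
rewrite normrN normrM normfV ler_pdivrMr ?normr_gt0//.
have [ts|ts|ts] := ltgtP tau s; last by rewrite ts subrr eqxx in sn.
- rewrite (@gtr0_norm _ (s - tau)) ?subr_gt0//; apply: right => //.
  by move: bs1; rewrite -/tau; lra.
- rewrite (@ltr0_norm _ (s - tau)) ?subr_lt0// opprB; apply: left => //.
  by move: bs2; rewrite -/tau; lra.
Qed.
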